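(* Let $K$ be a number field with ring of integers $\mathcal{O}_K$, let $d\ge 1$ be an integer and let $\varepsilon>0$. There exists a constant $B>0$ depending only on $K$, $d$ and $\varepsilon$ such that for every polynomial $f(x,y)\in\mathcal{O}_K[x,y]$ of degree $d$ that is irreducible over $K$ and every real $H>0$, the set $$S=\{(x,y)\in\mathcal{O}_K^2: H(x)\le H,\ H(y)\le H,\ f(x,y)=0\}$$ satisfies $$|S|\le B\,H^{\frac{1}{d}+\varepsilon},$$ where $H(\cdot)$ is the multiplicative height on $K$.
   Context: For a number field $K$, let $M_K$ be its set of places. For an Archimedean place $v$ associated with an embedding $\sigma:K\to\mathbb{C}$, $|\alpha|_v=|\sigma(\alpha)|$ (usual absolute value). For a non-Archimedean place $v$ associated with a prime ideal $\mathfrak{p}$ above the rational prime $p$, $|\alpha|_v=p^{-v_{\mathfrak{p}}(\alpha)/e_{\mathfrak{p}}}$, where $v_{\mathfrak{p}}(\alpha)$ is the exponent of $\mathfrak{p}$ in the factorization of $\alpha\mathcal{O}_K$ and $e_{\mathfrak{p}}$ is the ramification index (and $|0|_v=0$). Put $n_v=[K_v:\mathbb{Q}_v]$. The multiplicative height of $\alpha\in K$ (relative to $K$, not normalized by the degree) is $H(\alpha)=\prod_{v\in M_K}\max(1,|\alpha|_v^{n_v})$. The degree of $f$ is its total degree. *)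

(* Defs.v *)
From HB Require Import structures.
From mathcomp Require Import all_boot all_order all_algebra all_field.
From mathcomp Require Import complex.
From mathcomp Require Import all_classical all_reals all_analysis.
(* Partial import: the notations of mpoly clash with those of mathcomp-analysis. *)
From mathcomp Require Import (canonicals, coercions) mpoly.

Set Implicit Arguments.
Unset Strict Implicit.
Unset Printing Implicit Defensive.

Import Order.TTheory GRing.Theory Num.Theory numFieldNormedType.Exports.

Local Open Scope classical_set_scope.
Local Open Scope ring_scope.

Section IntegersAndIdeals.
Variable K : fieldExtType rat.

Definition ring_of_integers : set K := [set x | integralOver (intr : int -> K) x].

Definition is_ideal (I : set K) : Prop :=
  [/\ I `<=` ring_of_integers, I 0,
      forall x y, I x -> I y -> I (x + y)
    & forall a x, ring_of_integers a -> I x -> I (a * x)].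

(* A non-Archimedean place comes from a nonzero prime, so 0 is excluded. *)
Definition is_prime_ideal (P : set K) : Prop :=
  [/\ is_ideal P, exists2 x, P x & x != 0, ~ P 1
    & forall a b, ring_of_integers a -> ring_of_integers b ->
        P (a * b) -> P a \/ P b].

Definition principal (x : K) : set K :=
  [set x * a | a in ring_of_integers].

Definition ideal_mul (I J : set K) : set K :=
  [set z | exists2 s : seq (K * K),
     {in s, forall u, I u.1 /\ J u.2} & z = \sum_(u <- s) u.1 * u.2].

Definition ideal_prod (s : seq (set K)) : set K :=
  foldr ideal_mul ring_of_integers s.

(* The factorization of the fractional ideal [x O_K], x != 0, is
   [prod t * (prod s)^-1] where s and t are lists of primes (with
   multiplicities) having no prime in common. *)
Definition is_factorization (x : K) (t s : seq (set K)) : Prop :=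
  [/\ {in t, forall P, is_prime_ideal P},
      {in s, forall P, is_prime_ideal P},
      {in t, forall P, P \notin s}
    & ideal_mul (principal x) (ideal_prod s) = ideal_prod t].

(* The default value 0 of [xget] is only reached when x = 0. *)
Definition prime_val (P : set K) (x : K) : int :=
  xget 0 [set k : int | exists t s : seq (set K),
    is_factorization x t s /\
    k = (count_mem P t)%:Z - (count_mem P s)%:Z].

Definition residue_char (P : set K) : nat :=
  xget 0%N [set p : nat | prime p /\ P p%:R].

Definition ramification_index (P : set K) : int :=
  prime_val P (residue_char P)%:R.

End IntegersAndIdeals.

Section Places.
Variables (R : realType) (K : fieldExtType rat).

Definition arch_abs (sigma : {rmorphism K -> R[i]}) (x : K) : R :=
  complex.Re `|sigma x|.

Definition prime_abs (P : set K) (x : K) : R :=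
  if x == 0 then 0
  else (residue_char P)%:R `^
         (- (prime_val P x)%:~R / (ramification_index P)%:~R).

(* A place is represented by its normalized absolute value; this identifies
   an embedding with its complex conjugate, and nothing else. *)
Definition places : set (K -> R) :=
  [set v | (exists sigma : {rmorphism K -> R[i]}, v = arch_abs sigma) \/
           (exists2 P : set K, is_prime_ideal P & v = prime_abs P)].

Definition is_cauchy (v : K -> R) (u : nat -> K) : Prop :=
  forall e : R, 0 < e ->
    exists N, forall m n, (N <= m)%N -> (N <= n)%N -> v (u m - u n) < e.

Definition is_null (v : K -> R) (u : nat -> K) : Prop :=
  (fun n => v (u n)) @ \oo --> (0 : R).

(* K_v (resp. Q_v) is the field of Cauchy sequences of K (resp. of rationals)
   modulo null sequences for v; b represents a basis of K_v over Q_v. *)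
Definition is_local_basis (v : K -> R) (n : nat) (b : 'I_n -> nat -> K) : Prop :=
  let rat_cauchy (c : nat -> rat) := is_cauchy v (fun k => ratr (c k)) in
  [/\ forall i, is_cauchy v (b i),
      forall u, is_cauchy v u -> exists c : 'I_n -> nat -> rat,
        (forall i, rat_cauchy (c i)) /\
        is_null v (fun k => u k - \sum_(i < n) ratr (c i k) * b i k)
    & forall c : 'I_n -> nat -> rat, (forall i, rat_cauchy (c i)) ->
        is_null v (fun k => \sum_(i < n) ratr (c i k) * b i k) ->
        forall i, is_null v (fun k => ratr (c i k))].

(* n_v = [K_v : Q_v] *)
Definition local_degree (v : K -> R) : nat :=
  xget 0%N [set n | exists b : 'I_n -> nat -> K, is_local_basis v b].

(* For each x all but finitely many factors are 1, so this finitely supported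
   product is the product over all places. *)
Definition height (x : K) : R :=
  \big[*%R/1]_(v \in places) Num.max 1 (v x ^+ local_degree v).

End Places.

Definition mpoly_irreducible (n : nat) (F : fieldType) (f : mpoly.mpoly n F) : Prop :=
  [/\ f != 0, f \isn't a GRing.unit
    & forall g h : mpoly.mpoly n F, f = g * h ->
        g \is a GRing.unit \/ h \is a GRing.unit].

(* [mmeasure mdeg] is the library's [msize], the total degree plus 1. *)
Definition total_degree (n : nat) (F : fieldType) (f : mpoly.mpoly n F) : nat :=
  (mpoly.mmeasure (@mpoly.mdeg n) f).-1.

Definition eval2 (F : fieldType) (f : mpoly.mpoly 2 F) (x y : F) : F :=
  mpoly.meval (tnth [tuple x; y]) f.

(* Main.v *)
(* The p-adic determinant method, with rational primes instead of prime ideals.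
   Let n = [K : Q]. The height of an integer x is the product over the embeddings
   sigma of max(1, |sigma x|), so the points lie in boundedly many boxes
   |sigma x| <= A_sigma, |sigma y| <= B_sigma with prod A_sigma and prod B_sigma at
   most H^(1+o(1)). Inside a box f may be replaced by a multiple whose coefficients
   have conjugates bounded by a power of H (minors of the matrix of the monomials
   at the points). Then boundedly many primes p with p^n = H^(1/d+o(1)) suffice for
   every point with f_y <> 0 to have f_y invertible modulo one of them. Modulo p
   there are at most d^n p^n such points: p^n abscissas, and for each one at most d
   ordinates in each of the n embeddings of O_K/p in a splitting field. On a class
   the curve is y = phi(x) modulo any power of p by Newton's method, so the
   determinant of s monomials at s points of the class is divisible by
   p^(s(s-1)/2), as a Vandermonde determinant times an integer. For s = dM
   monomials not divisible by the leading monomial of f, of total degree about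
   dM^2/2, its norm is too small unless it vanishes. The class then lies on a curve
   of bounded degree without common component with f, and Bezout bounds its size. *)
From HB Require Import structures.
Require Import Defs.
From mathcomp Require Import finmap.
From mathcomp Require Import all_boot all_order all_algebra all_field perm.
From mathcomp Require Import complex.
From mathcomp Require Import all_classical all_reals all_analysis.
From mathcomp Require Import (canonicals, coercions) mpoly.
From mathcomp Require Import ring lra zify.

Set Implicit Arguments.
Unset Strict Implicit.
Unset Printing Implicit Defensive.

Import Order.TTheory GRing.Theory Num.Theory numFieldNormedType.Exports.

Local Open Scope classical_set_scope.
Local Open Scope ring_scope.

(** * Common zeros of plane curves *)

(** The exponent 1/d comes from comparing two quantities that are quadratic in s = dM: the degrees
    of the s monomials add up to about s^2/(2d), which governs the size of the determinant, while
    p^(n s(s-1)/2) divides its norm. The determinant must vanish as soon as p^n exceeds H^(1/d) by a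
    small power of H, and a large M makes that power arbitrarily small. Two obstacles shape the
    rest. The bound must not depend on the coefficients of f: either the points of a box are so few
    that Bezout's bound already counts them, or they determine f up to a scalar, and a suitable
    multiple of f has coefficients bounded in terms of the box alone. Moreover all sizes are
    measured by one scale l = 2^k, about H^(1/L): the sides of the boxes and the primes are
    bracketed between powers of l, so that each estimate becomes an inequality between integer
    exponents, and the roundings cost boundedly many factors l, which a large L makes negligible. *)

Definition bieval (A : nzRingType) (f : {poly {poly A}}) (x y : A) : A :=
  f.[y%:P].[x].

(** The outer variable is y and the coefficients are polynomials in x. Substituting x first leaves a
    polynomial in y alone, to which root counting and Taylor expansion apply. *)
Lemma bieval_horner (A : comNzRingType) (f : {poly {poly A}}) x y :
  bieval f x y = (map_poly (horner_eval x) f).[y].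
Proof.
have E : horner_eval x y%:P = y by rewrite /horner_eval hornerC.
by rewrite -{2}E horner_map.
Qed.

Section GaussBezout.
Variable F : fieldType.
Implicit Types (c q : {poly F}) (f g h k : {poly {poly F}}).

Definition irreducible_bipoly f : Prop :=
  [/\ f != 0, f \isn't a GRing.unit
    & forall g h, f = g * h -> g \is a GRing.unit \/ h \is a GRing.unit].

Lemma bipoly_scaleI q : q != 0 -> injective ( *:%R q : {poly {poly F}} -> _).
Proof.
move=> q0 f g; rewrite -!mul_polyC; apply: mulfI; by rewrite polyC_eq0.
Qed.

(** Gauss's argument: if [q] divides neither factor, take the least indices i and j of coefficients
    that it does not divide. In the coefficient of index i + j of the product, every term but the
    product of these two is divisible by [q]. *)
Lemma irreducible_coef_dvd q f g h : irreducible_poly q -> q *: f = g * h ->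
  (exists g', g = q *: g') \/ (exists h', h = q *: h').
Proof.
move=> qirr qf.
have divE (u : {poly {poly F}}) : (forall i, q %| u`_i) ->
    exists u', u = q *: u'.
  move=> qu; exists (\poly_(i < size u) (u`_i %/ q)).
  apply/polyP => i; rewrite coefZ coef_poly.
  case: ltnP => [_|lei]; first by rewrite mulrC divpK.
  by rewrite nth_default // mulr0.
have [qg|/boolp.existsNP [i0 ng]] := boolp.pselect (forall i, q %| g`_i).
  by left; exact: divE.
have [qh|/boolp.existsNP [j0 nh]] := boolp.pselect (forall i, q %| h`_i).
  by right; exact: divE.
exfalso.
have eg : exists i, ~~ (q %| g`_i) by exists i0; exact/negP.
have eh : exists i, ~~ (q %| h`_i) by exists j0; exact/negP.
case: (ex_minnP eg) => i ngi mini; case: (ex_minnP eh) => j nhj minj.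
have := congr1 (fun u : {poly {poly F}} => u`_(i + j)) qf.
rewrite coefZ coefM.
have lti : (i < (i + j).+1)%N by rewrite ltnS leq_addr.
rewrite (bigD1 (Ordinal lti)) //= addKn => E.
have : q %| g`_i * h`_j.
  rewrite -[g`_i * h`_j](addrK (\sum_(i1 < (i + j).+1 | i1 != Ordinal lti)
    g`_i1 * h`_(i + j - i1))) -E dvdp_sub ?dvdp_mulr //.
  apply: (big_ind (fun u => q %| u)) => //; first by move=> *; rewrite dvdp_add.
  move=> l; rewrite -val_eqE /= => nel.
  have [lt|gt] : (l < i)%N \/ (i < l)%N by lia.
    rewrite dvdp_mulr //; apply: contraT => /mini; lia.
  rewrite dvdp_mull //; apply: contraT => /minj; have := ltn_ord l; lia.
rewrite Gauss_dvdpr ?irreducible_poly_coprime //.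
exact/negP.
Qed.

(* Stands in for the factorization into irreducible polynomials. *)
Lemma poly_factor_ind (P : {poly F} -> Prop) :
  (forall a : F, a != 0 -> P a%:P) -> (forall q, irreducible_poly q -> P q) ->
  (forall c q, c != 0 -> q != 0 -> P c -> P q -> P (c * q)) ->
  forall c, c != 0 -> P c.
Proof.
move=> Pc Pirr Pm c; have [n] := ubnP (size c).
elim: n c => // n IH c /ltnSE-len c0.
have [le1|gt1] := leqP (size c) 1.
  move: c0; rewrite (size1_polyC le1) polyC_eq0; exact: Pc.
have [irr|] := boolp.pselect (irreducible_poly c); first exact: Pirr.
move=> nirr; have : exists q, [/\ size q != 1%N, q %| c & ~~ (q %= c)].
  apply: boolp.contrapT => /boolp.forallNP nq; apply: nirr; split=> // q q1 qc.
  by apply: contraT => qnc; case: (nq q).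
case=> q [q1 qc qnc].
have E : c = (c %/ q) * q by rewrite divpK.
have q0 : q != 0 by apply: contraNneq c0 => q0; rewrite E q0 mulr0.
have e0 : c %/ q != 0 by apply: contraNneq c0 => e0; rewrite E e0 mul0r.
have lq : (size q < size c)%N.
  by rewrite ltn_neqAle dvdp_leq // andbT dvdp_size_eqp // qnc.
have szc : size c = (size (c %/ q) + size q).-1 by rewrite {1}E size_mul.
have sq0 : (0 < size q)%N by rewrite size_poly_gt0.
have se0 : (0 < size (c %/ q)%R)%N by rewrite size_poly_gt0.
rewrite E; apply: Pm => //; apply: IH => //; last by exact: leq_trans lq _.
have q1' : size q <> 1%N by apply/eqP.
rewrite {}szc in len; move: q1' sq0 se0 len; case: (size q) => [|[|a]] // _ _ _; rewrite addnS /= addnS; apply: leq_trans; exact: leq_addr.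
Qed.

(** Pseudo-division yields factorizations only up to a factor in x. Its irreducible factors are
    cancelled one at a time from [g] or from [h], which leaves the degrees in y unchanged. *)
Lemma gauss_factor c f g h : c != 0 -> c *: f = g * h ->
  exists g' h', [/\ f = g' * h', size g' = size g & size h' = size h].
Proof.
move=> c0; move: c c0 f g h; apply: poly_factor_ind.
- move=> a a0 f g h E; exists ((a^-1)%:P *: g), h; split=> //.
    by rewrite -scalerAl -E scalerA -polyCM mulVf // scale1r.
  by rewrite size_scale // polyC_eq0 invr_eq0.
- move=> q qirr f g h E.
  have q0 : q != 0 by rewrite -size_poly_gt0 ltnW // qirr.1.
  have [[g' gE]|[h' hE]] := irreducible_coef_dvd qirr E.
    exists g', h; split=> //; last by rewrite gE size_scale.
    by apply: (bipoly_scaleI q0); rewrite E gE scalerAl.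
  exists g, h'; split=> //; last by rewrite hE size_scale.
  by apply: (bipoly_scaleI q0); rewrite E hE scalerAr.
- move=> c q c0 q0 IHc IHq f g h; rewrite -scalerA => /IHc[g1 [h1 [E s1 s2]]].
  have [g2 [h2 [E2 s3 s4]]] := IHq _ _ _ E.
  by exists g2, h2; rewrite s3 s4.
Qed.

Lemma irreducible_bipoly_content f q f' : irreducible_bipoly f ->
  (1 < size f)%N -> f = q *: f' -> size q = 1%N.
Proof.
move=> [f0 fu firr] sf fE.
have : f = q%:P * f' by rewrite mul_polyC.
case/firr; rewrite poly_unitE.
  by rewrite coefC eqxx => /andP[_]; rewrite poly_unitE => /andP[/eqP].
case/andP => /eqP s1 _; move: sf.
have [q0|q0] := eqVneq q 0; first by rewrite fE q0 scale0r !size_poly0.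
by rewrite fE size_scale // s1 ltnn.
Qed.

(** [f] is primitive, so an irreducible factor of [c] cannot divide it; it divides the cofactor [k],
    from which it cancels. *)
Lemma irreducible_bipoly_dvdZ c f g k : irreducible_bipoly f ->
  (1 < size f)%N -> c != 0 -> c *: g = f * k -> exists k', g = f * k'.
Proof.
move=> firr sf c0; move: c c0 g k; apply: poly_factor_ind.
- move=> a a0 g k E; exists ((a^-1)%:P *: k).
  by rewrite -scalerAr -E scalerA -polyCM mulVf // scale1r.
- move=> q qirr g k E.
  have q0 : q != 0 by rewrite -size_poly_gt0 ltnW // qirr.1.
  have [[f' fE]|[h' hE]] := irreducible_coef_dvd qirr E.
    by move: qirr.1; rewrite (irreducible_bipoly_content firr sf fE).
  by exists h'; apply: (bipoly_scaleI q0); rewrite E hE scalerAr.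
- move=> c q c0 q0 IHc IHq g k; rewrite -scalerA => /IHc[k' /IHq]; exact.
Qed.

(** If the resultant vanished, the pseudo-gcd of [f] and [g] would have positive degree in y. By
    Gauss's lemma the pseudo-factorization of [f] through it becomes a true one with the same
    degrees, so irreducibility makes the cofactor [h1] constant in y. Then [f] divides [g] up to a
    factor in x, hence divides it. *)
Lemma irreducible_bipoly_resultant f g : irreducible_bipoly f ->
  (1 < size f)%N -> ~ (exists k, g = f * k) -> resultant f g != 0.
Proof.
move=> firr sf nfg; apply/negP; rewrite resultant_eq0 => sd.
set d := Pdiv.Idomain.gcdp f g in sd.
have := Pdiv.Idomain.dvdp_gcdl f g; have := Pdiv.Idomain.dvdp_gcdr f g.
rewrite !Pdiv.Idomain.dvdp_eq -/d => /eqP E2 /eqP E1.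
have d0 : d != 0 by rewrite -size_poly_gt0 ltnW.
set c1 := (X in X *: _) in E1; set h1 := (X in _ = X * _) in E1.
set c2 := (X in X *: _) in E2; set h2 := (X in _ = X * _) in E2.
have c10 : c1 != 0 by rewrite expf_neq0 // lead_coef_eq0.
have c20 : c2 != 0 by rewrite expf_neq0 // lead_coef_eq0.
have [h' [d' [fE sh' sd']]] := gauss_factor c10 E1.
have sh1 : size h1 = 1%N.
  case: firr => _ _ /(_ _ _ fE)[]; rewrite poly_unitE => /andP[/eqP].
    by rewrite sh'.
  by rewrite sd' => ds1; move: sd; rewrite ds1.
have h1E : h1 = (h1`_0)%:P by apply: size1_polyC; rewrite sh1.
have h10 : h1`_0 != 0 by rewrite -polyC_eq0 -h1E -size_poly_gt0 sh1.
apply: nfg; apply: (@irreducible_bipoly_dvdZ (h1`_0 * c2) f g (c1 *: h2)) => //.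
  by rewrite mulf_neq0.
rewrite -scalerA E2 scalerAr -mul_polyC -h1E -E1 mulrC.
by rewrite -scalerAl -scalerAr.
Qed.

Lemma size_det_leq (n m : nat) (A : 'M[{poly F}]_n) :
  (forall i j, (size (A i j) <= m.+1)%N) -> (size (\det A) <= (n * m).+1)%N.
Proof.
move=> Am; apply: (leq_trans (size_sum _ _ _)); apply/bigmax_leqP => s _.
rewrite -polyC1 -polyCN -polyC_exp size_Cmul ?expf_neq0 ?oppr_eq0 ?oner_eq0 //.
apply: (leq_trans (size_prod_leq _ _)); rewrite cardT size_enum_ord.
apply: leq_trans (_ : (\sum_(i < n) m.+1).+1 - n <= _)%N.
  by rewrite leq_sub2r // ltnS; apply: leq_sum => i _; exact: Am.
by rewrite sum_nat_const card_ord mulnS subSn ?leq_addr // addKn.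
Qed.

Lemma size_resultant_leq m f g :
  (size f <= m)%N -> (size g <= m)%N ->
  (forall i, (size (f`_i)%R <= m)%N) -> (forall i, (size (g`_i)%R <= m)%N) ->
  (size (resultant f g) <= (2 * m * m).+1)%N.
Proof.
move=> sf sg szf szg.
have := @size_det_leq _ m (Sylvester_mx f g); rewrite -/(resultant f g) => H.
apply: leq_trans (H _) _; last first.
  by rewrite ltnS leq_mul // mul2n -addnn leq_add // (leq_trans (leq_pred _)).
move=> i j; rewrite Sylvester_mxE; case: (fintype.split i) => k;
  case: (k <= j)%N; rewrite ?mulr1n ?mulr0n ?size_poly0 //;
  exact: leq_trans (leqnSn _).
Qed.

(** If all coefficients vanished at [x], the common factor X - x would contradict the primitivity of
    [f]. *)
Lemma irreducible_bipoly_fiber f x : irreducible_bipoly f -> (1 < size f)%N ->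
  map_poly (horner_eval x) f != 0.
Proof.
move=> firr sf; apply/eqP => f0.
have rt i : root f`_i x.
  by have := congr1 (fun u : {poly F} => u`_i) f0; rewrite coef_map coef0 => /eqP.
pose f' := \poly_(i < size f) (f`_i %/ ('X - x%:P)).
have : f = ('X - x%:P) *: f'.
  apply/polyP => i; rewrite coefZ coef_poly.
  case: ltnP => [_|lei]; first by rewrite mulrC divpK // dvdp_XsubCl.
  by rewrite nth_default // mulr0.
by move/(irreducible_bipoly_content firr sf); rewrite size_XsubC.
Qed.

(** At most 2m^2 + m abscissas, with at most m ordinates above each. *)
Definition bezout_bound m := ((2 * m * m + m) * m)%N.

(* The abscissas of the common zeros are roots of the resultant (of g itself
   when g does not involve the second variable). *)
Lemma irreducible_bipoly_common_zeros m f g (s : seq (F * F)) :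
  irreducible_bipoly f -> (1 < size f)%N -> ~ (exists k, g = f * k) ->
  (size f <= m)%N -> (size g <= m)%N ->
  (forall i, (size (f`_i)%R <= m)%N) -> (forall i, (size (g`_i)%R <= m)%N) ->
  uniq s ->
  (forall u, u \in s -> bieval f u.1 u.2 = 0 /\ bieval g u.1 u.2 = 0) ->
  (size s <= bezout_bound m)%N.
Proof.
move=> firr sf nfg fm gm szf szg us sz.
have [r [r0 rs rr]] : exists r : {poly F}, [/\ r != 0,
    (size r <= (2 * m * m + m).+1)%N &
    forall u, u \in s -> root r u.1].
  have [sg|sg] := ltnP 1 (size g).
    exists (resultant f g); split; first exact: irreducible_bipoly_resultant.
      by apply: leq_trans (size_resultant_leq fm gm szf szg) _; lia.
    have [uv _ E] := resultant_in_ideal sf sg.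
    move=> u /sz[fu gu]; have := congr1 (fun h => h.[(u.2)%:P].[u.1]) E.
    rewrite hornerC hornerD !hornerM hornerD !hornerM.
    by rewrite -/(bieval f _ _) -/(bieval g _ _) fu gu !mulr0 addr0 => /eqP.
  exists g`_0; have gE := size1_polyC sg; split.
  - by apply/eqP => g0; apply: nfg; exists 0; rewrite gE g0 mulr0.
  - by apply: leq_trans (szg 0%N) _; lia.
  - by move=> u /sz[_]; rewrite {1}gE /bieval hornerC => /eqP.
set N := (2 * m * m + m)%N in rs *.
have sub : {subset s <= [seq (x, y) | x <- undup (map fst s),
    y <- undup [seq u.2 | u <- s & u.1 == x]]}.
  move=> [x y] xys; apply/allpairsPdep; exists x, y; split=> //.
    by rewrite mem_undup; apply/mapP; exists (x, y).
  by rewrite mem_undup; apply/mapP; exists (x, y) => //; rewrite mem_filter eqxx.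
apply: leq_trans (uniq_leq_size us sub) _.
rewrite size_allpairs_dep /bezout_bound.
have sx : (size (undup (map fst s)) <= N)%N.
  rewrite -ltnS; apply: leq_trans rs; apply: max_poly_roots => //.
    apply/allP => x; rewrite mem_undup => /mapP[u us' ->]; exact: rr.
  exact: undup_uniq.
have sy x : (size (undup [seq u.2 | u <- s & u.1 == x]) <= m)%N.
  apply: leq_trans fm; apply: leq_trans (size_poly _ (fun i => (f`_i).[x])).
  apply: ltnW; apply: (@max_poly_roots _ (map_poly (horner_eval x) f)).
  - exact: irreducible_bipoly_fiber.
  - apply/allP => y; rewrite mem_undup => /mapP[u]; rewrite mem_filter.
    move=> /andP[/eqP ux /sz[fu _]] ->.
    by rewrite /root -bieval_horner -ux fu.
  - exact: undup_uniq.
rewrite sumnE big_map; apply: leq_trans (_ : \sum_(x <- undup (map fst s)) m <= _)%N.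
  by apply: leq_sum => x _; exact: sy.
by rewrite big_const_seq count_predT iter_addn_0 mulnC leq_mul2r sx orbT.
Qed.

End GaussBezout.

(** * Monomial determinants modulo powers of an element *)

Section Congruences.
Variable A : comNzRingType.
Implicit Types (d a b u x y : A) (g h : {poly A}).

Definition divides d a : Prop := exists c, a = d * c.

Lemma divides0 d : divides d 0. Proof. by exists 0; rewrite mulr0. Qed.

Lemma dividesD d a b : divides d a -> divides d b -> divides d (a + b).
Proof. by move=> [c ->] [e ->]; exists (c + e); rewrite mulrDr. Qed.

Lemma divides_mulr d a b : divides d a -> divides d (a * b).
Proof. by move=> [c ->]; exists (c * b); rewrite mulrA. Qed.

Lemma divides_mull d a b : divides d a -> divides d (b * a).
Proof. by rewrite mulrC; exact: divides_mulr. Qed.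

Lemma dividesN d a : divides d a -> divides d (- a).
Proof. by rewrite -mulN1r; exact: divides_mull. Qed.

Lemma dividesB d a b : divides d a -> divides d b -> divides d (a - b).
Proof. by move=> da /dividesN; exact: dividesD. Qed.

Lemma divides_sym d a b : divides d (a - b) -> divides d (b - a).
Proof. by move/dividesN; rewrite opprB. Qed.

Lemma divides_trans d a b c :
  divides d (a - b) -> divides d (b - c) -> divides d (a - c).
Proof. by move=> ab bc; have := dividesD ab bc; rewrite addrA subrK. Qed.

Lemma divides_mul d e a b : divides d a -> divides e b -> divides (d * e) (a * b).
Proof. by move=> [c ->] [f ->]; exists (c * f); rewrite mulrACA. Qed.

Lemma divides_subM d a a' b b' : divides d (a - a') -> divides d (b - b') ->
  divides d (a * b - a' * b').
Proof.
move=> da db; have -> : a * b - a' * b' = (a - a') * b + a' * (b - b') by ring.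
by apply: dividesD; [exact: divides_mulr|exact: divides_mull].
Qed.

Lemma divides_subX d a b n : divides d (a - b) -> divides d (a ^+ n - b ^+ n).
Proof. by move=> dab; rewrite subrXX; exact: divides_mulr. Qed.

Lemma divides_det n d (M N : 'M[A]_n) :
  (forall i j, divides d (M i j - N i j)) -> divides d (\det M - \det N).
Proof.
move=> MN; apply: (big_ind2 (fun a b => divides d (a - b))).
- by rewrite subrr; exact: divides0.
- by move=> a a' b b' da db; rewrite opprD addrACA; exact: dividesD.
- move=> s _; apply: divides_subM; first by rewrite subrr; exact: divides0.
  apply: (big_ind2 (fun a b => divides d (a - b))) => //.
    by rewrite subrr; exact: divides0.
  by move=> *; exact: divides_subM.
Qed.

(** Dividing twice by X - a gives the second-order remainder over any commutative ring, with no
    factorial in a denominator. *)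
Lemma horner_taylor1 g a b : exists c,
  g.[b] - g.[a] = (b - a) * (g^`().[a] + (b - a) * c).
Proof.
have quot (p : {poly A}) : exists h, p - (p.[a])%:P = h * ('X - a%:P).
  by apply/factor_theorem; rewrite /root hornerD hornerN hornerC subrr.
have [h hE] := quot g; have [k kE] := quot h.
have ev (p q : {poly A}) : p - (p.[a])%:P = q * ('X - a%:P) ->
    p.[b] - p.[a] = (b - a) * q.[b].
  move=> /(congr1 (fun v => v.[b])).
  by rewrite hornerM !hornerD !hornerN !hornerC hornerX mulrC.
exists k.[b]; rewrite (ev _ _ hE) -(ev _ _ kE).
have -> : g^`().[a] = h.[a].
  have := congr1 (fun v => v^`().[a]) hE.
  rewrite derivB derivC subr0 derivM derivXsubC mulr1 hornerD hornerM.
  by rewrite hornerXsubC subrr mulr0 add0r.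
by rewrite addrCA subrr addr0.
Qed.

Lemma divides_horner d g a b : divides d (b - a) -> divides d (g.[b] - g.[a]).
Proof. by have [c ->] := horner_taylor1 g a b; exact: divides_mulr. Qed.

Lemma divides_bieval d (f : {poly {poly A}}) x y x' y' :
  divides d (x - x') -> divides d (y - y') ->
  divides d (bieval f x y - bieval f x' y').
Proof.
move=> dx dy; apply: (@divides_trans _ _ (bieval f x y')).
  by rewrite !bieval_horner; exact: divides_horner.
exact: divides_horner.
Qed.

Lemma horner_bieval (f : {poly {poly A}}) (phi : {poly A}) x :
  f.[phi].[x] = bieval f x phi.[x].
Proof. by rewrite bieval_horner -[LHS]/(horner_eval x _) -horner_map. Qed.

Lemma bieval_deriv (f : {poly {poly A}}) x y :
  bieval f^`() x y = (map_poly (horner_eval x) f)^`().[y].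
Proof. by rewrite bieval_horner deriv_map. Qed.

(* Newton's iteration [phi := phi - u f(X, phi)] with a fixed approximate inverse
   [u] of the derivative parametrizes a residue class of the curve. *)
Lemma hensel_parametrization d (f : {poly {poly A}}) x0 y0 u n :
  divides d (1 - u * bieval f^`() x0 y0) ->
  exists phi : {poly A}, forall x y,
    divides d (x - x0) -> divides d (y - y0) -> bieval f x y = 0 ->
    divides (d ^+ n) (y - phi.[x]).
Proof.
move=> du; case: n => [|n].
  by exists 0 => x y _ _ _; exists (y - 0.[x]); rewrite expr0 mul1r.
elim: n => [|n [phi IH]].
  by exists y0%:P => x y _ dy _; rewrite hornerC expr1.
exists (phi - u *: f.[phi]) => x y dx dy fxy.
have dphi := IH x y dx dy fxy.
have dphi1 : divides d (phi.[x] - y).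
  by apply: divides_sym; move: dphi => [c ->]; rewrite exprS -mulrA; eexists.
rewrite hornerD hornerN hornerZ horner_bieval.
move: fxy; rewrite !bieval_horner => fxy.
have [c] := horner_taylor1 (map_poly (horner_eval x) f) y phi.[x].
rewrite fxy subr0 -bieval_deriv => ->.
set D := bieval _ x y; set w := phi.[x] in dphi dphi1 *.
(* The new error is the old one times a factor divisible by [d]: as [u] inverts the derivative only
   modulo [d], each iteration gains one power. *)
have -> : y - (w - u * ((w - y) * (D + (w - y) * c))) =
  (y - w) * ((1 - u * D) - u * c * (w - y)) by ring.
rewrite exprSr; apply: divides_mul dphi _; apply: dividesB; last first.
  exact: divides_mull.
have -> : 1 - u * D = (1 - u * bieval f^`() x0 y0) - u * (D - bieval f^`() x0 y0).
  by ring.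
by apply: dividesB => //; apply: divides_mull; exact: divides_bieval.
Qed.

(** Reducing each [G j] modulo the monic polynomial with roots [x i] keeps its values and brings its
    degree below n. The matrix is then a Vandermonde matrix times the matrix of the coefficients of
    the remainders. Coinciding points are allowed. *)
Lemma det_poly_Vandermonde n (x : 'I_n -> A) (G : 'I_n -> {poly A}) :
  exists c, \det (\matrix_(i, j) (G j).[x i]) =
            (\prod_(i < n) \prod_(j < n | (i < j)%N) (x j - x i)) * c.
Proof.
pose P := \prod_(i < n) ('X - (x i)%:P).
have Pm : P \is monic by exact: monic_prod_XsubC.
have sP : size P = n.+1 by rewrite size_prod_XsubC /index_enum -enumT size_enum_ord.
pose C j := Pdiv.Ring.rmodp (G j) P.
have sC j : (size (C j) <= n)%N.
  by rewrite -ltnS -sP Pdiv.Ring.ltn_rmodpN0 // monic_neq0.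
exists (\det (\matrix_(k, j) (C j)`_k : 'M[A]_n)).
have -> : \matrix_(i, j) (G j).[x i] =
    (Vandermonde n (\row_i x i))^T *m \matrix_(k, j) (C j)`_k.
  apply/matrixP => i j; rewrite !mxE.
  rewrite {1}(Pdiv.RingMonic.rdivp_eq Pm (G j)) hornerD hornerM.
  have -> : P.[x i] = 0.
    by rewrite horner_prod (bigD1 i) //= hornerXsubC subrr mul0r.
  rewrite mulr0 add0r -/(C j) (horner_coef_wide _ (sC j)).
  by apply: eq_bigr => k _; rewrite !mxE mulrC.
rewrite det_mulmx det_tr det_Vandermonde; congr (_ * _).
by apply: eq_bigr => i _; apply: eq_bigr => j _; rewrite !mxE.
Qed.

Lemma divides_prod_pairs n d (x : 'I_n -> A) :
  (forall i j, divides d (x j - x i)) ->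
  divides (d ^+ 'C(n, 2)) (\prod_(i < n) \prod_(j < n | (i < j)%N) (x j - x i)).
Proof.
move=> dx.
have cnt (i : 'I_n) : (\sum_(j < n | (i < j)%N) 1)%N = (n - i.+1)%N.
  rewrite sum1_card -[RHS](size_iota i.+1) cardE -(size_map val).
  apply: perm_size; apply: uniq_perm; first by rewrite map_inj_uniq ?enum_uniq //; exact: val_inj.
    exact: iota_uniq.
  move=> k; rewrite mem_iota; apply/mapP/idP => [[j]|].
    rewrite mem_enum unfold_in => ij ->; have := ltn_ord j; rewrite /= in ij *; lia.
  move=> ik; have kn : (k < n)%N by have := ltn_ord i; lia.
  by exists (Ordinal kn) => //; rewrite mem_enum unfold_in /=; lia.
have -> : 'C(n, 2) = (\sum_(i < n) \sum_(j < n | (i < j)%N) 1)%N.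
  rewrite -bin2_sum big_mkord (reindex_inj rev_ord_inj) /=.
  by apply: eq_bigr => i _; rewrite cnt.
apply: (big_rec2 (fun k a => divides (d ^+ k) a)).
  by exists 1; rewrite expr0 mul1r.
move=> i k a _ da; rewrite exprD; apply: divides_mul => //.
apply: (big_rec2 (fun k a => divides (d ^+ k) a)).
  by exists 1; rewrite expr0 mul1r.
by move=> j k' a' _ da'; rewrite exprD; apply: divides_mul.
Qed.

Lemma divides_det_monomials n d (f : {poly {poly A}}) x0 y0 u
  (x y : 'I_n -> A) (e : 'I_n -> nat * nat) :
  divides d (1 - u * bieval f^`() x0 y0) ->
  (forall i, divides d (x i - x0)) -> (forall i, divides d (y i - y0)) ->
  (forall i, bieval f (x i) (y i) = 0) ->
  divides (d ^+ 'C(n, 2)) (\det (\matrix_(i, j) (x i ^+ (e j).1 * y i ^+ (e j).2))).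
Proof.
move=> du dx dy fxy.
(* Newton's method is run to the precision that the Vandermonde product provides. *)
have [phi Hphi] := hensel_parametrization 'C(n, 2) du.
pose G j : {poly A} := 'X^((e j).1) * phi ^+ (e j).2.
have := @divides_det _ (d ^+ 'C(n, 2))
  (\matrix_(i, j) (x i ^+ (e j).1 * y i ^+ (e j).2))
  (\matrix_(i, j) (G j).[x i]).
have [c ->] := det_poly_Vandermonde x G.
move=> H; rewrite -[X in divides _ X](subrK
  ((\prod_(i < n) \prod_(j < n | (i < j)%N) (x j - x i)) * c)).
apply: dividesD.
  apply: H => i j; rewrite !mxE /G hornerM horner_exp hornerX horner_exp.
  apply: divides_subM; first by rewrite subrr; exact: divides0.
  by apply: divides_subX; exact: Hphi.
apply: divides_mulr; apply: divides_prod_pairs => i j.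
exact: divides_trans (dx j) (divides_sym (dx i)).
Qed.

End Congruences.

(** * Primes between two powers *)

Section PrimesInRange.
Local Open Scope nat_scope.

(** Legendre's formula: the terms floor(2n/p^k) - 2 floor(n/p^k) are at most 1 and vanish when p^k >
    2n. *)
Lemma logn_central_bin p n : prime p -> 0 < n -> p ^ logn p 'C(n.*2, n) <= n.*2.
Proof.
move=> pp n0; have p1 := prime_gt1 pp.
have le2 : n <= n.*2 by rewrite -addnn leq_addr.
apply: leq_trans (_ : p ^ trunc_log p n.*2 <= _); last first.
  by rewrite trunc_logP // double_gt0.
rewrite leq_exp2l //.
have E : n.*2 - n = n by rewrite -addnn addnK.
have := congr1 (logn p) (bin_fact le2); rewrite E.
rewrite !lognM ?muln_gt0 ?fact_gt0 ?bin_gt0 // !logn_fact //.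
have -> : \sum_(1 <= k < n.+1) n %/ p ^ k = \sum_(1 <= k < n.*2.+1) n %/ p ^ k.
  rewrite (big_cat_nat (n := n.+1) (p := n.*2.+1)) //=.
  rewrite [X in _ = _ + X]big1_seq ?addn0 // => k.
  rewrite mem_index_iota => /andP[_ /andP[nk _]].
  by rewrite divn_small // (ltn_trans nk) // ltn_expl.
rewrite -big_split /= => H.
have : \sum_(1 <= k < n.*2.+1) n.*2 %/ p ^ k <=
       \sum_(1 <= k < n.*2.+1) ((n %/ p ^ k + n %/ p ^ k) +
         (k <= trunc_log p n.*2)).
  apply: leq_sum => k _.
  have pk0 : 0 < p ^ k by rewrite expn_gt0 ltnW.
  have [le|gt] := leqP k (trunc_log p n.*2).
    rewrite addn1 -ltnS ltn_divLR // mulSn.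
    have := ltn_ceil n pk0; move: (n %/ p ^ k) => a; rewrite mulSn mulSn mulnDl.
    rewrite -addnn; lia.
  rewrite divn_small // ltnNge; apply: contraL gt => le.
  by rewrite -leqNgt trunc_log_max.
rewrite -H [X in _ <= X]big_split /= addnC leq_add2l => /leq_trans; apply.
elim: (n.*2) (trunc_log _ _) => [|m IH] T; first by rewrite big_geq.
rewrite big_nat_recr //=; have := IH T; have := IH m.
have [lem|gtm] := leqP m.+1 T; last by rewrite addn0.
have -> : \sum_(1 <= i < m.+1) (i <= T) = \sum_(1 <= i < m.+1) (i <= m).
  rewrite !big_nat; apply: eq_bigr => i /andP[_ im].
  have im' : i <= m by [].
  by rewrite im' (leq_trans im' (ltnW lem)).
by rewrite addn1 => le1 _; apply: leq_trans lem.
Qed.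

Lemma central_bin_ge n : 2 ^ n <= 'C(n.*2, n).
Proof.
elim: n => // n IH; rewrite doubleS expnS mul2n -addnn binS.
rewrite leq_add //; first by rewrite binS (leq_trans IH) ?leq_addl.
by rewrite (leq_trans IH) // leq_bin2l.
Qed.

(** Chebyshev's lower bound: the central binomial coefficient is at least 2^n, and each of its prime
    powers is at most 2n. *)
Lemma pow2_le_primes n : 0 < n ->
  2 ^ n <= n.*2 ^ size [seq p <- iota 0 n.*2.+1 | prime p].
Proof.
move=> n0; apply: leq_trans (central_bin_ge n) _.
have C0 : 0 < 'C(n.*2, n) by rewrite bin_gt0 -addnn leq_addr.
have sub : {subset primes 'C(n.*2, n) <= [seq p <- iota 0 n.*2.+1 | prime p]}.
  move=> p; rewrite mem_primes mem_filter mem_iota add0n ltnS /=.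
  move=> /and3P[pp _ pC]; rewrite pp /=.
  apply: leq_trans (logn_central_bin pp n0).
  by rewrite -{1}(expn1 p) leq_exp2l ?prime_gt1 // logn_gt0 mem_primes pp C0.
have := uniq_leq_size (primes_uniq _) sub => le.
apply: leq_trans (_ : n.*2 ^ size (primes 'C(n.*2, n)) <= _); last first.
  by rewrite leq_pexp2l // double_gt0.
rewrite {1}(prod_prime_decomp C0) prime_decompE big_map /=.
have : all prime (primes 'C(n.*2, n)).
  by apply/allP => p; rewrite mem_primes => /andP[].
elim: (primes _) => [|p s IHs] /=; first by rewrite big_nil.
move=> /andP[pp /IHs le']; rewrite big_cons expnS.
by rewrite leq_mul // logn_central_bin.
Qed.

Lemma linear_lt_pow2 c k : 4 * c < k -> k * c < 2 ^ k.-1.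
Proof.
elim: k => // k IH; rewrite ltnS leq_eqVlt => /predU1P[<-|lt] /=.
  have : (c.*2).+1 * (c.*2).+1 <= 2 ^ (4 * c).
    rewrite (_ : 4 * c = c.*2 + c.*2); last by rewrite -!addnn; lia.
    by rewrite expnD leq_mul // ltn_expl.
  by apply: leq_trans; rewrite -!addnn; nia.
have k0 : 0 < k by apply: leq_ltn_trans lt.
have := IH lt; case: k k0 {lt IH} => //= k _; rewrite expnS; nia.
Qed.

(** Put Z = 2^(k(e+1)). With fewer than [r] primes in the range there would be fewer than 2^(ke) + r
    primes up to Z, and the bound 2^(Z/2) <= Z^(number of primes) would give 2^(k-1) <= k(e+1)(r+1).
    The wide ratio 2^k between the two ends is what makes so crude a bound sufficient; it costs one
    unit in the exponent e. *)
Lemma primes_in_range r e : exists k0, forall k, k0 <= k ->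
  exists s : seq nat, [/\ uniq s, size s = r &
    forall p, p \in s -> [/\ prime p, 2 ^ (k * e) <= p & p <= 2 ^ (k * e.+1)]].
Proof.
exists (4 * (e.+1 * r.+1)).+1 => k kge.
have k0 : 0 < k by apply: leq_ltn_trans kge.
have := linear_lt_pow2 kge => klt.
pose Z := 2 ^ (k * e.+1); pose n := 2 ^ (k * e.+1).-1.
have ZE : n.*2 = Z by rewrite -mul2n -expnS prednK // muln_gt0 k0.
pose s := [seq p <- iota 0 Z.+1 | prime p & 2 ^ (k * e) <= p].
have us : uniq s by rewrite filter_uniq // iota_uniq.
have [rs|sr] := leqP r (size s).
  exists (take r s); split; first by rewrite take_uniq.
    by rewrite size_takel.
  move=> p /mem_take; rewrite mem_filter mem_iota add0n ltnS.
  by move=> /andP[/andP[-> ->] /= ->].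
have n0 : 0 < n by rewrite expn_gt0.
have := pow2_le_primes n0; rewrite ZE.
have sub : {subset [seq p <- iota 0 Z.+1 | prime p] <= iota 0 (2 ^ (k * e)) ++ s}.
  move=> p; rewrite mem_cat !mem_filter !mem_iota !add0n /= => /andP[-> ->] /=.
  by rewrite andbT leqNgt; case: ltnP.
have := uniq_leq_size (filter_uniq _ (iota_uniq _ _)) sub.
rewrite size_cat size_iota => le1 le2.
have : 2 ^ n <= 2 ^ (k * e.+1 * (2 ^ (k * e) * r.+1)).
  apply: leq_trans le2 _; rewrite [X in _ <= X]expnM leq_pexp2l ?expn_gt0 //.
  apply: leq_trans le1 _; rewrite mulnS leq_add2l (leq_trans (ltnW sr)) //.
  by rewrite leq_pmull // expn_gt0.
rewrite leq_exp2l // /n => bad.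
have : 2 ^ (k * e) * 2 ^ k.-1 <= 2 ^ (k * e) * (k * (e.+1 * r.+1)).
  apply: leq_trans (leq_trans bad _); last by lia.
  by rewrite -expnD leq_exp2l // mulnS; lia.
by rewrite leq_pmul2l ?expn_gt0 // leqNgt klt.
Qed.

End PrimesInRange.

(** * Integers of a number field *)

Lemma rat_integral_int (a : rat) : integralOver (intr : int -> rat) a ->
  exists z : int, a = z%:~R.
Proof.
case=> p pm pa; have : (ratr a : algC) \in Aint.
  apply: (@root_monic_Aint (map_poly intr p)).
  - have := rmorph_root (ratr : {rmorphism rat -> algC}) pa.
    by rewrite -map_poly_comp (eq_map_poly (g := intr)) // => z /=; rewrite ratr_int.
  - exact: monic_map.
  - by apply/polyOverP => i; rewrite coef_map /= intr_int.
move=> /(Cint_rat_Aint (Crat_rat a)); rewrite Cint_rat => /intrP[z ->].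
by exists z.
Qed.

Lemma integralOver_field (L M : fieldType) (f : {rmorphism L -> M}) (x : L) :
  integralOver (intr : int -> L) x <-> integralOver (intr : int -> M) (f x).
Proof.
have E (p : {poly int}) : map_poly intr p = map_poly f (map_poly intr p).
  by rewrite -map_poly_comp; apply: eq_map_poly => z /=; rewrite rmorph_int.
by split=> -[p pm px]; exists p => //; move: px; rewrite E fmorph_root.
Qed.

Section Generator.
Variable K : fieldExtType rat.

Lemma minPoly_rat (x : K) : exists2 p : {poly rat},
  map_poly (in_alg K) p = minPoly 1 x &
  forall h : {poly rat}, root (map_poly (in_alg K) h) x -> p %| h.
Proof.
have /polyOver1P[p pE] := minPolyOver 1 x.
exists p => [|h]; first by rewrite pE.
rewrite -(dvdp_map (in_alg K)) -pE => hx.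
by apply: minPoly_dvdp => //; apply/polyOver1P; exists h.
Qed.

Lemma primitive_element_rat :
  exists x : K, forall y, exists h : {poly rat}, y = (map_poly (in_alg K) h).[x].
Proof.
exists (separable_generator 1%AS {:K}%AS) => y.
have : y \in <<1; separable_generator 1%AS {:K}%AS>>%VS.
  rewrite -eq_adjoin_separable_generator ?memvf ?sub1v //.
  apply/separableP => z _; apply: pcharf0_separable.
  by move=> p; rewrite (fmorph_pchar (in_alg K)) pchar_num.
by move=> /Fadjoin1_polyP[h ->]; exists h.
Qed.

(** A generator times the leading coefficient of an integer polynomial killing it is integral; by
    Gauss's lemma its minimal polynomial then has integer coefficients. *)
Lemma integral_primitive_element : exists (theta : K) (q : {poly int}),
  [/\ q \is monic, root (map_poly intr q) theta,
      forall h : {poly rat}, root (map_poly (in_alg K) h) theta ->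
        map_poly (intr : int -> rat) q %| h
    & forall y, exists h : {poly rat}, y = (map_poly (in_alg K) h).[theta]].
Proof.
have [x0 gen] := primitive_element_rat.
have ratr_intr (P : {poly int}) : map_poly (in_alg K) (map_poly intr P) =
    map_poly intr P.
  by rewrite -map_poly_comp; apply: eq_map_poly => z; exact: (rmorph_int (in_alg K)).
have [P P0 Px] : exists2 P : {poly int}, P != 0 & root (map_poly intr P) x0.
  have [p pE _] := minPoly_rat x0; have [P [a a0 PE]] := rat_poly_scale p.
  have rp : root (map_poly (in_alg K) p) x0 by rewrite pE root_minPoly.
  have p0 : p != 0.
    by rewrite -(map_poly_eq0 (in_alg K)) pE monic_neq0 ?monic_minPoly.
  exists P; first by apply: contraNneq p0 => P0; rewrite PE P0 map_poly0 scaler0.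
  move: rp; rewrite PE map_polyZ ratr_intr rootZ //.
  by rewrite fmorph_eq0 invr_eq0 intr_eq0.
pose m := (size P).-1; pose c := lead_coef P.
have sP : (size P = m.+1)%N by rewrite prednK // size_poly_gt0.
have c0 : (c%:~R : K) != 0.
  by rewrite -(rmorph_int (in_alg K)) fmorph_eq0 intr_eq0 lead_coef_eq0.
have m0 : (0 < m)%N.
  rewrite lt0n; apply/eqP => m0; move: Px; rewrite /root.
  rewrite (size1_polyC (_ : (size P <= 1)%N)) ?sP ?m0 // map_polyC hornerC /=.
  by rewrite [P`_0](_ : _ = c) ?(negPf c0) // /c lead_coefE sP m0.
(* Multiplying P(x0) by c^(m-1) turns it into a monic expression in c x0. *)
pose p1 := \poly_(i < m.+1) (if i == m then 1 else P`_i * c ^+ (m.-1 - i)).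
have p1m : p1 \is monic.
  by rewrite monicE lead_coef_poly ?eqxx ?oner_eq0.
pose theta := c%:~R * x0.
have p1t : root (map_poly intr p1) theta.
  apply/rootP; have -> : (map_poly intr p1).[theta] =
      c%:~R ^+ m.-1 * (map_poly intr P).[x0].
    rewrite (@horner_coef_wide _ m.+1); last first.
      by rewrite (leq_trans (size_poly _ _)) // size_poly.
    rewrite (@horner_coef_wide _ m.+1 (map_poly intr P)); last first.
      by rewrite (leq_trans (size_poly _ _)) // sP.
    rewrite mulr_sumr; apply: eq_bigr => i _; rewrite !coef_map coef_poly ltn_ord /=.
    have [im|im] := eqVneq (i : nat) m.
      rewrite im exprMn mul1r mulrA; congr (_ * _).
      have -> : P`_m = c by rewrite /c lead_coefE sP.
      by rewrite -exprSr prednK.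
    have lim : (i < m)%N by have := ltn_ord i; lia.
    rewrite rmorphM rmorphXn /= exprMn !mulrA; congr (_ * _).
    rewrite [RHS]mulrC -mulrA -exprD; congr (_ * _ ^+ _); lia.
  by rewrite (rootP Px) mulr0.
have [p pE pmin] := minPoly_rat theta.
(* The integer form [q1] of [p] divides the monic [p1] over the integers, so its leading coefficient
   is 1 or -1. *)
have /dvdpP_rat_int[q1 [a a0 pq1] [r p1E]] : p %| map_poly (intr : int -> rat) p1.
  by apply: pmin; rewrite ratr_intr.
have lc1 : lead_coef q1 * lead_coef r = 1.
  by rewrite -lead_coefM -p1E; apply/eqP.
have lu : lead_coef q1 * lead_coef q1 = 1.
  have /eqP := congr1 absz lc1; rewrite abszM muln_eq1 => /andP[/eqP a1 _].
  have [->|->] : lead_coef q1 = 1 \/ lead_coef q1 = -1 by lia.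
    by rewrite mulr1.
  by rewrite mulrNN mulr1.
pose q := lead_coef q1 *: q1.
have l0 : ((lead_coef q1)%:~R : rat) != 0.
  rewrite intr_eq0; apply: contra_eqN lu => /eqP ->; rewrite mul0r eq_sym oner_eq0 //.
have qp : map_poly (intr : int -> rat) q %= p.
  rewrite /q map_polyZ /= pq1; apply: eqp_trans (eqp_scale _ l0) _.
  by rewrite eqp_sym eqp_scale.
exists theta, q; split.
- by rewrite monicE lead_coefZ lu.
- have : root (map_poly (in_alg K) p) theta by rewrite pE root_minPoly.
  rewrite pq1 map_polyZ ratr_intr rootZ ?fmorph_eq0 // => /rootP q1t.
  by rewrite /q map_polyZ /= /root hornerZ q1t mulr0.
- by move=> h /pmin; rewrite (eqp_dvdl _ qp).
- move=> y; have [h ->] := gen y.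
  exists (h \Po (c%:~R^-1 *: 'X)); rewrite map_comp_poly horner_comp.
  rewrite map_polyZ map_polyX hornerZ hornerX fmorphV rmorph_int.
  by rewrite /theta mulKf.
Qed.

End Generator.

Section Integers.
Variable L : fieldType.

(** The boolean form of integrality carries a subring structure, and so yields the ring [integer L]
    in which congruences and determinants are computed. *)
Definition integers : {pred L} := fun x => `[< integralOver (intr : int -> L) x >].

Lemma integersP x : reflect (integralOver (intr : int -> L) x) (x \in integers).
Proof. by apply: (iffP idP) => [/asboolP|?]; last apply/asboolP. Qed.

Lemma integers_subring_closed : subring_closed integers.
Proof.
split=> [|x y|x y].
- by apply/integersP; exact: integral1.
- by move=> /integersP xi /integersP yi; apply/integersP; exact: integral_sub.
- by move=> /integersP xi /integersP yi; apply/integersP; exact: integral_mul.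
Qed.

HB.instance Definition _ :=
  GRing.isSubringClosed.Build L integers integers_subring_closed.

Record integer := Integer { integer_val :> L; _ : integer_val \in integers }.
HB.instance Definition _ := [isSub for integer_val].
HB.instance Definition _ := [Choice of integer by <:].
HB.instance Definition _ := [SubChoice_isSubComNzRing of integer by <:].

(** A monic equation reads x g(x) + h_0 = 0. When h_0 is nonzero, g(x) is a cofactor; otherwise g is
    a monic equation of smaller degree. *)
Lemma integers_cofactor x : x \in integers -> x != 0 ->
  exists2 z : int, z != 0 & exists2 w, w \in integers & x * w = z%:~R.
Proof.
move=> xi x0; have /integersP[p pm px] := xi.
have [m] := ubnP (size p); elim: m p pm px => // m IH p pm px ltm.
have pE : p = (drop_poly 1 p) * 'X + (p`_0)%:P.
  rewrite -{1}(poly_take_drop 1 p) addrC expr1; congr (_ + _).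
  by apply/polyP => i; rewrite coef_take_poly coefC; case: i.
have sp : (1 < size p)%N.
  rewrite ltnNge; apply/negP => /size1_polyC E; move: px pm.
  rewrite E /root map_polyC hornerC /= monicE lead_coefC.
  by move=> /[swap] /eqP ->; rewrite oner_eq0.
have dm : drop_poly 1 p \is monic.
  by rewrite monicE lead_coefE size_drop_poly coef_drop_poly subn1 -subn2 addn1 -subSn // subn2 -lead_coefE.
have rE : x * (map_poly intr (drop_poly 1 p)).[x] + (p`_0)%:~R = 0.
  have := rootP px; rewrite {1}pE rmorphD rmorphM /= map_polyX map_polyC.
  by rewrite hornerD hornerMX hornerC mulrC.
have [p0|p0] := eqVneq p`_0 0.
  apply: (IH _ dm).
    move: rE; rewrite p0 addr0 => /eqP; rewrite mulf_eq0 (negPf x0).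
    by [].
  by rewrite size_drop_poly; lia.
exists (- p`_0); first by rewrite oppr_eq0.
exists (map_poly intr (drop_poly 1 p)).[x].
  rewrite horner_poly; apply: rpred_sum => i _.
  by rewrite rpredM ?rpredX // rpred_int.
by apply/eqP; rewrite rmorphN /= -subr_eq0 opprK rE.
Qed.

End Integers.

Arguments integers L : clear implicits.
Arguments integer L : clear implicits.

Lemma ratr_integers (C : numFieldType) (a : rat) :
  ratr a \in integers C -> exists z : int, a = z%:~R.
Proof.
move=> /integersP ai; apply: rat_integral_int.
exact/(integralOver_field (ratr : {rmorphism rat -> C})).
Qed.

(** * Embeddings as roots of the minimal polynomial *)

Section Embeddings.
Variables (K : fieldExtType rat) (C : numClosedFieldType).
Variables (theta : K) (q : {poly int}).
Hypothesis q_monic : q \is monic.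
Hypothesis q_theta : root (map_poly intr q) theta.
Hypothesis q_min : forall h : {poly rat}, root (map_poly (in_alg K) h) theta ->
  map_poly (intr : int -> rat) q %| h.
Hypothesis theta_gen : forall y, exists h : {poly rat},
  y = (map_poly (in_alg K) h).[theta].

Local Notation n := (size q).-1.
Local Notation Q := (map_poly (intr : int -> rat) q).

Lemma map_alg_intr (P : {poly int}) :
  map_poly (in_alg K) (map_poly intr P) = map_poly intr P.
Proof.
by rewrite -map_poly_comp; apply: eq_map_poly => z; exact: (rmorph_int (in_alg K)).
Qed.

Lemma map_ratr_intr (P : {poly int}) :
  map_poly (ratr : rat -> C) (map_poly intr P) = map_poly intr P.
Proof. by rewrite -map_poly_comp; apply: eq_map_poly => z /=; rewrite ratr_int. Qed.

Lemma Q_monic : Q \is monic. Proof. exact: monic_map. Qed.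

Lemma size_Q : size Q = size q.
Proof. by rewrite size_map_poly_id0 // intr_eq0 lead_coef_eq0 monic_neq0. Qed.

Lemma q_size_gt1 : (1 < size q)%N.
Proof.
rewrite ltnNge; apply/negP => /size1_polyC E; move: q_theta q_monic.
rewrite E /root map_polyC hornerC /= monicE lead_coefC.
by move=> /[swap] /eqP ->; rewrite oner_eq0.
Qed.

Lemma q_sizeE : size q = n.+1. Proof. by rewrite (ltn_predK q_size_gt1). Qed.

Lemma rep_subproof y : exists h : {poly rat},
  (size h <= n)%N /\ y = (map_poly (in_alg K) h).[theta].
Proof.
have [h ->] := theta_gen y; exists (h %% Q); split.
  by rewrite -ltnS -q_sizeE -size_Q ltn_modp monic_neq0 // Q_monic.
rewrite {1}(divp_eq h Q) rmorphD rmorphM /= hornerD hornerM map_alg_intr.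
by rewrite (rootP q_theta) mulr0 add0r.
Qed.

Definition rep y : {poly rat} := projT1 (cid (rep_subproof y)).

Lemma size_rep y : (size (rep y) <= n)%N.
Proof. by rewrite /rep; case: cid => h []. Qed.

Lemma repE y : y = (map_poly (in_alg K) (rep y)).[theta].
Proof. by rewrite /rep; case: cid => h []. Qed.

Lemma rep_mod y h : y = (map_poly (in_alg K) h).[theta] -> Q %| rep y - h.
Proof.
move=> yE; apply: q_min; rewrite /root rmorphB /= hornerD hornerN -repE.
by rewrite yE subrr.
Qed.

(** The element h(theta) is sent to h(z): two choices of h differ by a multiple of [q], which
    vanishes at [z]. *)
Lemma exists_embedding z : root (map_poly intr q) z ->
  exists sigma : {rmorphism K -> C}, sigma theta = z.
Proof.
move=> qz; pose f y := (map_poly (ratr : rat -> C) (rep y)).[z].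
have fE y h : y = (map_poly (in_alg K) h).[theta] -> f y = (map_poly ratr h).[z].
  move=> /rep_mod/dvdpP[g gE]; apply/eqP; rewrite -subr_eq0 -hornerN -hornerD.
  rewrite -rmorphB gE rmorphM /= map_ratr_intr hornerM.
  by rewrite (rootP qz) mulr0.
have fB : zmod_morphism f.
  move=> x y; rewrite (fE _ (rep x - rep y)); first by rewrite rmorphB /= hornerD hornerN.
  by rewrite rmorphB /= hornerD hornerN -!repE.
have fM : monoid_morphism f.
  split=> [|x y]; first by rewrite (fE _ 1) ?rmorph1 ?hornerC.
  rewrite (fE _ (rep x * rep y)); first by rewrite rmorphM /= hornerM.
  by rewrite rmorphM /= hornerM -!repE.
pose fA := GRing.isZmodMorphism.Build K C f fB.
pose fR := GRing.isMonoidMorphism.Build K C f fM.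
pose F : {rmorphism K -> C} := HB.pack f fA fR.
exists F; rewrite /F /= (fE _ 'X) ?map_polyX ?hornerX //.
Qed.

Lemma embedding_rep (sigma : {rmorphism K -> C}) h :
  sigma (map_poly (in_alg K) h).[theta] = (map_poly ratr h).[sigma theta].
Proof.
rewrite -horner_map -map_poly_comp; congr _.[_].
by apply: eq_map_poly => a; rewrite /= rmorphZ_num rmorph1 mulr1.
Qed.

Lemma embedding_root (sigma : {rmorphism K -> C}) :
  root (map_poly intr q) (sigma theta).
Proof.
by rewrite -map_ratr_intr /root -embedding_rep map_alg_intr (rootP q_theta) rmorph0.
Qed.

Lemma embedding_ext (sigma tau : {rmorphism K -> C}) :
  sigma theta = tau theta -> sigma =1 tau.
Proof. by move=> E y; rewrite (repE y) !embedding_rep E. Qed.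

(** Let d be the gcd of Q and its derivative. [theta] is a root of Q/d or of d, so Q divides one of
    them: the first case makes d constant, the second makes Q divide its derivative, a nonzero
    polynomial of smaller degree. *)
Lemma Q_separable : separable_poly Q.
Proof.
rewrite separable_poly.unlock.
have dQ : gcdp Q Q^`() %| Q by exact: dvdp_gcdl.
have := divpK dQ; set d := gcdp _ _; set e := _ %/ _ => E.
have Q0 : Q != 0 by rewrite monic_neq0 ?Q_monic.
have d0 : d != 0 by apply: contraNneq Q0 => d0; rewrite -E d0 mulr0.
have e0 : e != 0 by apply: contraNneq Q0 => e0; rewrite -E e0 mul0r.
have : root (map_poly (in_alg K) (e * d)) theta by rewrite E map_alg_intr.
rewrite rmorphM /= rootM => /orP[] /q_min dv.
  have := dvdp_leq e0 dv; rewrite -{1}E size_mul // coprimep_def -/d.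
  have : (0 < size d)%N by rewrite size_poly_gt0.
  have : (0 < size e)%N by rewrite size_poly_gt0.
  move: (size d) (size e) => a b; lia.
have := dvdp_trans dv (dvdp_gcdr Q Q^`()).
have Q'0 : Q^`() != 0.
  apply/eqP => /(congr1 (fun p : {poly rat} => p`_(size Q).-2)).
  rewrite coef_deriv coef0 size_Q prednK; last by have := q_size_gt1; lia.
  rewrite -size_Q -lead_coefE (eqP Q_monic) => /eqP; rewrite pnatr_eq0.
  by rewrite size_Q; have := q_size_gt1; lia.
by move=> /(dvdp_leq Q'0); rewrite leqNgt lt_size_deriv.
Qed.

(** [D] records the bad primes: modulo a prime that does not divide it, [q] stays separable. *)
Lemma q_bezout : exists U V : {poly int}, exists2 D : int, D != 0 &
  U * q + V * q^`() = D%:P.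
Proof.
have := Q_separable; rewrite separable_poly.unlock => /Bezout_eq1_coprimepP[[u v] /=].
have [U [a a0 ->]] := rat_poly_scale u; have [V [b b0 ->]] := rat_poly_scale v.
move=> E; exists (b *: U), (a *: V), (a * b); first by rewrite mulf_neq0.
have inj : injective (map_poly (intr : int -> rat)).
  by apply: map_inj_poly => //; exact: intr_inj.
apply: inj; rewrite rmorphD !rmorphM /= !map_polyZ map_polyC /= -deriv_map.
rewrite map_polyC /= -[RHS]mulr1 -E.
have a0' : (a%:~R : rat) != 0 by rewrite intr_eq0.
have b0' : (b%:~R : rat) != 0 by rewrite intr_eq0.
rewrite -polyCM mul_polyC -!scalerAl scalerDr !scalerA.
by congr (_ *: _ + _ *: _); [rewrite mulrAC mulfV // mul1r|rewrite mulfK].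
Qed.

Lemma exists_roots : exists z : 'I_n -> C,
  [/\ injective z, forall i, root (map_poly intr q) (z i)
    & forall w, root (map_poly intr q) w -> exists i, w = z i].
Proof.
have [r rE] := closed_field_poly_normal (map_poly (intr : int -> C) q).
have lc : lead_coef (map_poly (intr : int -> C) q) = 1.
  by apply/eqP; exact: monic_map.
rewrite lc scale1r in rE.
have sr : size r = n.
  have := congr1 (fun p : {poly C} => size p) rE; rewrite size_prod_XsubC.
  rewrite size_map_poly_id0 ?intr_eq0 ?lead_coef_eq0 ?monic_neq0 // => ->.
  by [].
have ur : uniq r.
  rewrite -separable_prod_XsubC -rE -map_ratr_intr separable_map.
  exact: Q_separable.
exists (fun i => r`_i); split.
- move=> i j /eqP; rewrite nth_uniq ?sr // => /eqP; exact: val_inj.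
- by move=> i; rewrite rE root_prod_XsubC mem_nth // sr.
- move=> w; rewrite rE root_prod_XsubC => wr.
  have iw : (index w r < n)%N by rewrite -sr index_mem.
  by exists (Ordinal iw); rewrite /= nth_index.
Qed.

End Embeddings.

(** * Norms, denominators and reduction modulo a rational prime *)

Section IntegersOfNumberField.
Variables (K : fieldExtType rat) (C : numClosedFieldType).
Variables (theta : K) (q : {poly int}).
Hypothesis q_monic : q \is monic.
Hypothesis q_theta : root (map_poly intr q) theta.
Hypothesis q_min : forall h : {poly rat}, root (map_poly (in_alg K) h) theta ->
  map_poly (intr : int -> rat) q %| h.
Hypothesis theta_gen : forall y, exists h : {poly rat},
  y = (map_poly (in_alg K) h).[theta].
Local Notation n := (size q).-1.
Variable sigma : 'I_n -> {rmorphism K -> C}.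
Hypothesis sigma_inj : injective (fun i => sigma i theta).

Let rep' y := rep q_monic q_theta theta_gen y.

Lemma sigma_rep i y :
  sigma i y = \sum_(k < n) ratr (rep' y)`_k * sigma i theta ^+ k.
Proof.
rewrite {1}(repE q_monic q_theta theta_gen y) embedding_rep -/(rep' y).
rewrite (@horner_coef_wide _ n); first by apply: eq_bigr => k _; rewrite coef_map.
by rewrite (leq_trans (size_poly _ _)) // size_rep.
Qed.

Let V : 'M[C]_n := Vandermonde n (\row_i sigma i theta).

Lemma Vandermonde_theta_neq0 : \det V != 0.
Proof.
rewrite det_Vandermonde prodf_seq_neq0; apply/allP => i _ /=.
rewrite prodf_seq_neq0; apply/allP => j _; apply/implyP => ij.
rewrite !mxE subr_eq0; apply: contraTneq ij => /sigma_inj ->.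
by rewrite ltnn.
Qed.

(** In the basis of powers of [theta], multiplication by [y] has a rational matrix, which the
    Vandermonde matrix of the conjugates diagonalizes; the product of the conjugates is its
    determinant. *)
Lemma norm_rat y : exists r : rat, \prod_i sigma i y = ratr r.
Proof.
pose M : 'M[rat]_n := \matrix_(k, l) (rep' (y * theta ^+ k))`_l.
exists (\det M); apply: (mulfI Vandermonde_theta_neq0).
have : V *m diag_mx (\row_i sigma i y) = map_mx ratr M *m V.
  apply/matrixP => k j; rewrite mul_mx_diag !mxE.
  rewrite mulrC -rmorphXn -rmorphM sigma_rep; apply: eq_bigr => l _.
  by rewrite !mxE.
move/(congr1 determinant); rewrite !det_mulmx det_diag det_map_mx.
rewrite [ratr _ * _]mulrC => <-.
by congr (_ * _); apply: eq_bigr => i _; rewrite mxE.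
Qed.

Lemma sigma_integers i x : x \in integers K -> sigma i x \in integers C.
Proof. by move=> /integersP xi; apply/integersP/(integralOver_field (sigma i)). Qed.

Lemma norm_int x : x \in integers K -> exists z : int, \prod_i sigma i x = z%:~R.
Proof.
move=> xi; have [r rE] := norm_rat x.
have : ratr r \in integers C.
  by rewrite -rE; apply: rpred_prod => i _; exact: sigma_integers.
by move=> /ratr_integers[z zE]; exists z; rewrite rE zE ratr_int.
Qed.

(** An embedding sends the cofactor z/x to the product of the other conjugates, which is integral,
    and integrality can be tested in [C]. *)
Lemma norm_cofactor x : x \in integers K -> x != 0 -> exists z : int,
  [/\ z != 0, \prod_i sigma i x = z%:~R & exists2 w, w \in integers K & x * w = z%:~R].
Proof.
move=> xi x0; have [z zE] := norm_int xi.
have z0 : z != 0.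
  rewrite -(intr_eq0 C) -zE; apply/prodf_neq0 => i _; by rewrite fmorph_eq0.
exists z; split=> //; exists (z%:~R / x); last by rewrite mulrC divfK.
have n0 : (0 < n)%N by have := q_size_gt1 q_monic q_theta; case: (size q) => [|[]].
pose i0 := Ordinal n0.
apply/integersP/(integralOver_field (sigma i0))/integersP.
rewrite fmorph_div rmorph_int -zE (bigD1 i0) //= mulrAC mulfV ?fmorph_eq0 // mul1r.
by apply: rpred_prod => i _; exact: sigma_integers.
Qed.

Lemma det_integers (m : nat) (A : 'M[C]_m) :
  (forall i j, A i j \in integers C) -> \det A \in integers C.
Proof.
move=> Ai; apply: rpred_sum => s _; rewrite rpredM ?rpred_sign //.
by apply: rpred_prod => i _; exact: Ai.
Qed.

Lemma theta_integer : theta \in integers K.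
Proof. by apply/integersP; exists q. Qed.

(** Cramer's rule for the Vandermonde system that expresses the conjugates of x through its rational
    coordinates: the determinant times a coordinate is integral. [D] is the determinant times an
    algebraic integer, so [D] times a coordinate is rational and integral, hence an integer. *)
Lemma integers_denominator : exists2 D : int, D != 0 &
  forall x, x \in integers K -> exists a : {poly int},
    (size a <= n)%N /\ D%:~R * x = (map_poly intr a).[theta].
Proof.
have thi i : sigma i theta \in integers C by apply: sigma_integers theta_integer.
have Vi k j : V k j \in integers C by rewrite !mxE rpredX.
have [D D0 [w wi wE]] := integers_cofactor (det_integers Vi) Vandermonde_theta_neq0.
exists D => // x xi.
have ck (k : 'I_n) : exists z : int, D%:~R * (rep' x)`_k = z%:~R.
  apply: (@ratr_integers C); rewrite rmorphM /= ratr_int -wE.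
  have : (\row_k ratr (rep' x)`_k) *m V *m \adj V =
      \det V *: (\row_(k < n) ratr (rep' x)`_k : 'rV[C]_n).
    by rewrite -mulmxA mul_mx_adj mul_mx_scalar.
  move=> /matrixP/(_ 0 k); rewrite !mxE => E.
  rewrite mulrAC -E mulrC rpredM //; apply: rpred_sum => j _.
  rewrite rpredM //.
    rewrite !mxE [X in X \in _](_ : _ = sigma j x) ?sigma_integers //.
    by rewrite sigma_rep; apply: eq_bigr => l _; rewrite !mxE.
  rewrite mxE /cofactor rpredM ?rpred_sign //; apply: det_integers => a b.
  by rewrite !mxE rpredX.
have [f fE] := boolp.choice ck.
exists (\poly_(k < n) (if insub k is Some k' then f k' else 0)).
rewrite size_poly; split=> //.
rewrite {1}(repE q_monic q_theta theta_gen x) -/(rep' x).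
rewrite (@horner_coef_wide _ n) ?(leq_trans (size_poly _ _)) ?size_rep //.
rewrite (@horner_coef_wide _ n) ?(leq_trans (size_poly _ _)) ?size_poly //.
rewrite mulr_sumr; apply: eq_bigr => k _.
rewrite mulrA; congr (_ * _); rewrite !coef_map coef_poly ltn_ord valK.
have := congr1 (in_alg K) (fE k); rewrite rmorphM rmorph_int => ->.
exact: (rmorph_int (in_alg K)).
Qed.

(** Division by the monic [q] takes place over the integers, so the relation persists at a root of
    [q] in any field, also in positive characteristic. *)
Lemma int_poly_theta0 (A : {poly int}) (L : fieldType) (t : L) :
  (map_poly intr A).[theta] = 0 -> root (map_poly intr q) t ->
  (map_poly intr A).[t] = 0.
Proof.
move=> A0 qt; have AE := Pdiv.RingMonic.rdivp_eq q_monic A.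
set r := Pdiv.Ring.rmodp A q in AE.
have r0 : r = 0.
  apply: (map_inj_poly (f := intr : int -> rat)) => //; first exact: intr_inj.
  rewrite map_poly0; apply/eqP; apply: contraT => rn0.
  have rt : root (map_poly (in_alg K) (map_poly intr r)) theta.
    move: A0; rewrite AE map_alg_intr /root rmorphD rmorphM /= hornerD hornerM.
    by rewrite (rootP q_theta) mulr0 add0r => ->.
  have := dvdp_leq rn0 (q_min rt); rewrite size_Q // leqNgt.
  rewrite (leq_ltn_trans (size_poly _ _)) // Pdiv.Ring.ltn_rmodpN0 //.
  exact: monic_neq0.
by rewrite AE r0 addr0 rmorphM /= hornerM (rootP qt) mulr0.
Qed.

Section Residues.
Variable D : int.
Hypothesis D_den : forall x, x \in integers K -> exists a : {poly int},
    (size a <= n)%N /\ D%:~R * x = (map_poly intr a).[theta].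
Variable p : nat.
Hypothesis p_prime : prime p.
Hypothesis pD : coprimez p D.

Lemma D_den_integer (x : integer K) : exists a : {poly int},
    (size a <= n)%N /\ D%:~R * val x = (map_poly intr a).[theta].
Proof. by apply: D_den; exact: valP. Qed.

Definition num (x : integer K) : {poly int} := projT1 (cid (D_den_integer x)).

Lemma size_num x : (size (num x) <= n)%N.
Proof. by rewrite /num; case: cid => a []. Qed.

Lemma numE x : D%:~R * val x = (map_poly intr (num x)).[theta].
Proof. by rewrite /num; case: cid => a []. Qed.

(** With u p + v D = 1 one has x = p u x + v D x, and D x is p times a polynomial in [theta]. *)
Lemma dvd_num (x : integer K) (a : {poly int}) :
  D%:~R * val x = (map_poly intr a).[theta] ->
  (forall k, (p %| a`_k)%Z) -> divides p%:R x.
Proof.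
move=> aE pa; have /coprimezP[[u v] /= uv] := pD.
pose b := \poly_(k < size a) (a`_k %/ p)%Z.
have aE' : a = p%:Z *: b.
  apply/polyP => k; rewrite coefZ coef_poly; case: ltnP => [_|le].
    by rewrite mulrC divzK.
  by rewrite mulr0 nth_default.
have bi : (map_poly intr b).[theta] \in integers K.
  rewrite horner_poly; apply: rpred_sum => i _.
  by rewrite rpredM ?rpredX ?theta_integer // rpred_int.
exists (u%:~R * x + v%:~R * Integer bi); apply: val_inj.
have E : p%:R * (map_poly intr b).[theta] = D%:~R * val x.
  by rewrite aE aE' map_polyZ /= hornerZ.
rewrite !(rmorphM, rmorphD, rmorph_int, rmorph_nat) /=.
have := congr1 (fun z : int => z%:~R : K) uv.
rewrite rmorphD !rmorphM /= => uv'.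
rewrite mulrDr [p%:R * (v%:~R * _)]mulrCA E.
have xE : val x = (u%:~R * p%:~R + v%:~R * D%:~R) * val x by rewrite uv' mul1r.
by rewrite [LHS]xE mulrDl -!mulrA; congr (_ + _); rewrite mulrCA.
Qed.

(** The code is the vector of the coefficients of D x modulo p. *)
Lemma residue_code : exists code : integer K -> {ffun 'I_n -> 'F_p},
  forall x x', code x = code x' -> divides p%:R (x - x').
Proof.
exists (fun x => [ffun k : 'I_n => ((num x)`_k)%:~R]) => x x' E.
apply: (@dvd_num _ (num x - num x')).
  by rewrite rmorphB mulrBr !numE rmorphB hornerD hornerN.
move=> k; rewrite (dvdz_pcharf (pchar_Fp p_prime)) coefB.
have [kn|nk] := ltnP k n; last first.
  by rewrite !nth_default ?subrr // (leq_trans (size_num _)).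
have := congr1 (fun f : {ffun 'I_n -> 'F_p} => f (Ordinal kn)) E.
by rewrite !ffunE /= rmorphB /= => ->; rewrite subrr.
Qed.

(** As [D] is invertible in [L], [theta] may be sent to [t]: x = a(theta)/D goes to a(t)/D, which
    does not depend on the choice of a by [int_poly_theta0]. *)
Lemma residue_morphism (L : fieldType) (t : L) : p \in [pchar L] ->
  root (map_poly intr q) t -> exists phi : {rmorphism integer K -> L},
    forall x a, D%:~R * val x = (map_poly intr a).[theta] ->
      D%:~R * phi x = (map_poly intr a).[t].
Proof.
move=> pL qt.
have DL : (D%:~R : L) != 0.
  rewrite -(dvdz_pcharf pL); apply/negP => pdD.
  have := pD; rewrite /coprimez /gcdz; have /gcdn_idPl -> : (p %| `|D|)%N by [].
  by move=> /eqP[] pE; move: p_prime; rewrite pE.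
pose f x := D%:~R^-1 * (map_poly intr (num x)).[t].
have same (a b : {poly int}) : (map_poly intr a).[theta] = (map_poly intr b).[theta] ->
    (map_poly intr a).[t] = (map_poly intr b).[t].
  move=> ab; apply/eqP; rewrite -subr_eq0 -hornerN -hornerD -rmorphB.
  apply/eqP; apply: int_poly_theta0 => //.
  by rewrite rmorphB /= hornerD hornerN ab subrr.
have fE x a : D%:~R * val x = (map_poly intr a).[theta] ->
    D%:~R * f x = (map_poly intr a).[t].
  by move=> aE; rewrite /f mulVKf //; apply: same; rewrite -numE.
have fB : zmod_morphism f.
  move=> x y; apply: (mulfI DL); rewrite mulrBr (fE x (num x)) ?numE //.
  rewrite (fE y (num y)) ?numE // -hornerN -hornerD -rmorphB; apply: fE.
  by rewrite !rmorphB hornerD hornerN -!numE -mulrBr.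
have fM : monoid_morphism f.
  split=> [|x y]; apply: (mulfI DL).
    by rewrite (fE _ D%:P) ?map_polyC ?hornerC ?mulr1 // rmorph1 mulr1.
  apply: (mulfI DL); rewrite [RHS](_ : _ = (D%:~R * f x) * (D%:~R * f y)); last by ring.
  rewrite (fE x (num x)) ?numE // (fE y (num y)) ?numE // -hornerM -rmorphM.
  rewrite (fE (x * y) (num (x * y))) ?numE //.
  rewrite -hornerZ -map_polyZ; apply: same.
  rewrite map_polyZ hornerZ -numE !rmorphM hornerM -!numE /=.
  by rewrite [LHS]mulrA; exact: mulrACA.
pose fA := GRing.isZmodMorphism.Build (integer K) L f fB.
pose fR := GRing.isMonoidMorphism.Build (integer K) L f fM.
pose F : {rmorphism integer K -> L} := HB.pack f fA fR.
by exists F.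
Qed.

Variable D' : int.
Hypothesis D'_bezout : exists U V : {poly int}, U * q + V * q^`() = D'%:P.
Hypothesis pD' : coprimez p D'.

(** Because p does not divide [D'], the reduction of [q] has n distinct roots in a splitting field,
    and each gives a morphism. If all of them kill x, the coefficients of D x modulo p form a
    polynomial of degree less than n with n roots, hence zero. *)
Lemma residue_morphisms : exists (L : fieldType)
  (phi : 'I_n -> {rmorphism integer K -> L}),
  p%:R = 0 :> L /\ forall x, (forall i, phi i x = 0) -> divides p%:R x.
Proof.
have qF0 : map_poly (intr : int -> 'F_p) q != 0.
  by rewrite monic_neq0 // monic_map.
have [L [rs rsE _]] := FinSplittingFieldFor qF0.
have pL : p \in [pchar L] by rewrite (fmorph_pchar (in_alg L)) pchar_Fp.
have rsE' : map_poly intr q = \prod_(z <- rs) ('X - z%:P) :> {poly L}.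
  apply/eqP; rewrite -eqp_monic ?monic_map ?monic_prod_XsubC //.
  apply: eqp_trans rsE; rewrite -map_poly_comp.
  have -> : map_poly (in_alg L \o intr) q = map_poly intr q.
    by apply: eq_map_poly => z; exact: (rmorph_int (in_alg L)).
  exact: eqpxx.
have srs : size rs = n.
  have := congr1 (fun f : {poly L} => size f) rsE'; rewrite size_prod_XsubC.
  by rewrite size_map_poly_id0 ?(eqP q_monic) ?rmorph1 ?oner_eq0 // => ->.
have D'L : (D'%:~R : L) != 0.
  rewrite -(dvdz_pcharf pL); apply/negP => pdD.
  have := pD'; rewrite /coprimez /gcdz; have /gcdn_idPl -> : (p %| `|D'|)%N by [].
  by move=> /eqP[] pE; move: p_prime; rewrite pE.
have urs : uniq rs.
  rewrite -separable_prod_XsubC -rsE' separable_poly.unlock.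
  have [U [W UW]] := D'_bezout.
  apply/Bezout_eq1_coprimepP.
  exists (D'%:~R^-1 *: map_poly intr U, D'%:~R^-1 *: map_poly intr W) => /=.
  rewrite -!scalerAl -scalerDr deriv_map -!rmorphM -rmorphD UW /= map_polyC /=.
  by rewrite -mul_polyC -polyCM mulVf.
have rt (i : 'I_n) : root (map_poly intr q) rs`_i.
  by rewrite rsE' root_prod_XsubC mem_nth // srs.
have [phi phiE] := boolp.choice (fun i => residue_morphism pL (rt i)).
exists L, phi; split=> [|x x0]; first exact: pcharf0 pL.
apply: (@dvd_num _ (num x)); first exact: numE.
move=> k; rewrite (dvdz_pcharf pL).
suff N0 : map_poly intr (num x) = 0 :> {poly L}.
  by have := congr1 (fun f : {poly L} => f`_k) N0; rewrite coef_map coef0 => /eqP.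
apply/eqP; apply: contraT => N0.
have al : all (root (map_poly intr (num x))) rs.
  apply/allP => w wrs; have iw : (index w rs < n)%N by rewrite -srs index_mem.
  have := phiE (Ordinal iw) x (num x) (numE x); rewrite x0 mulr0 nth_index //.
  by move=> E; rewrite /root -E.
have := max_poly_roots N0 al urs; rewrite ltnNge srs.
by rewrite (leq_trans (size_poly _ _) (size_num _)).
Qed.

End Residues.
End IntegersOfNumberField.

(** * Counting by fibres, minors and monomials *)

Lemma size_leq_fibers (T U : eqType) (f : T -> U) (s : seq T) (N1 N2 : nat) :
  (size (undup (map f s)) <= N1)%N ->
  (forall t, t \in s -> (size [seq u <- s | f u == f t] <= N2)%N) ->
  (size s <= N1 * N2)%N.
Proof.
move=> h1 h2; apply: leq_trans (leq_mul h1 (leqnn N2)).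
have -> : size s = (\sum_(u <- undup (map f s)) size [seq t <- s | f t == u])%N.
  rewrite -(sum1_size s) (eq_bigr (fun u => \sum_(t <- s | f t == u) 1)%N).
    rewrite (exchange_big_dep predT) //=; apply: eq_big_seq => t ts.
    have ft : f t \in undup (map f s) by rewrite mem_undup map_f.
    rewrite sum1_count (eq_count (a2 := pred1 (f t))).
      by rewrite count_uniq_mem ?undup_uniq // ft.
    by move=> u; rewrite /= eq_sym.
  by move=> u _; rewrite sum1_count size_filter.
apply: leq_trans (_ : \sum_(u <- undup (map f s)) N2 <= _)%N; last first.
  by rewrite big_const_seq count_predT iter_addn_0 mulnC.
rewrite big_seq [X in (_ <= X)%N]big_seq.
by apply: leq_sum => u; rewrite mem_undup => /mapP[t ts ->]; exact: h2.
Qed.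

Fixpoint seq_product (T : Type) (rs : seq (seq T)) : seq (seq T) :=
  if rs is r :: rs' then [seq x :: l | x <- r, l <- seq_product rs'] else [:: [::]].

Lemma size_seq_product (T : Type) (rs : seq (seq T)) m :
  all (fun r => size r <= m)%N rs -> (size (seq_product rs) <= m ^ size rs)%N.
Proof.
elim: rs => //= r rs IH /andP[rm /IH le]; rewrite size_allpairs expnS.
exact: leq_mul.
Qed.

Lemma mem_seq_product (T : eqType) (I : Type) (js : seq I) (v : I -> T)
  (r : I -> seq T) : (forall i, v i \in r i) ->
  map v js \in seq_product (map r js).
Proof.
move=> vr; elim: js => //= i js IH; apply/allpairsP.
by exists (v i, map v js); split=> //=; exact: vr.
Qed.

(** For a matrix of monomials at points, the dichotomy reads: some of the points give a nonzero
    minor, or a nontrivial combination of the monomials vanishes at all the points. *)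
Lemma minor_or_kernel (L : fieldType) (t s : nat) (A : 'M[L]_(t, s)) :
  (exists f : 'I_s -> 'I_t, \det (\matrix_(i, j) A (f i) j) != 0) \/
  (exists2 c : 'I_s -> L, exists k, c k != 0 & forall i, \sum_j c j * A i j = 0).
Proof.
have [fA|nfA] := boolP (row_full A).
  left; exists (fullrankfun fA).
  have := mxrank_fullrowsub fA; rewrite -/(row_free _) => rk.
  have : row_free (rowsub (fullrankfun fA) A).
    by rewrite -row_leq_rank rk.
  rewrite row_free_unit unitmxE unitfE.
  have -> // : \matrix_(i, j) A (fullrankfun fA i) j = rowsub (fullrankfun fA) A.
  by apply/matrixP => i j; rewrite !mxE.
right; have : kermx A^T != 0.
  rewrite kermx_eq0; apply: contra nfA.
  by rewrite -row_leq_rank mxrank_tr -col_leq_rank.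
move=> /rowV0Pn[u /sub_kermxP uA u0].
exists (fun j => u 0 j).
  by have /rV0Pn[k uk] := u0; exists k.
move=> i; have /matrixP/(_ 0 i) := uA; rewrite !mxE => E; rewrite -[RHS]E.
by apply: eq_bigr => j _; rewrite mxE.
Qed.

(** The bound depends on the column because a column holds the values of one monomial, bounded on a
    whole box. *)
Lemma norm_det_le (C : numClosedFieldType) (s : nat) (A : 'M[C]_s) (b : 'I_s -> C) :
  (forall i j, `|A i j| <= b j) -> `|\det A| <= s`!%:R * \prod_j b j.
Proof.
move=> Ab; apply: le_trans (ler_norm_sum _ _ _) _.
have card : #|{: perm_type 'I_s}| = s`!.
  by exact: card_Sn.
rewrite -card mulr_natl -sumr_const; apply: ler_sum => p _.
rewrite normrM normrX normrN1 expr1n mul1r normr_prod.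
rewrite [X in _ <= X](reindex_inj (@perm_inj _ p)) /=.
by apply: ler_prod => i _; rewrite normr_ge0 Ab.
Qed.

Section Monomials.
Variable A : comNzRingType.

Definition mono_bipoly (s : nat) (e : 'I_s -> nat * nat) (c : 'I_s -> A) :
  {poly {poly A}} := \sum_k (c k *: 'X^((e k).1))%:P * 'X^((e k).2).

Lemma bieval_mono_bipoly s e c x y :
  bieval (@mono_bipoly s e c) x y = \sum_k c k * (x ^+ (e k).1 * y ^+ (e k).2).
Proof.
rewrite /bieval /mono_bipoly horner_sum horner_sum; apply: eq_bigr => k _.
rewrite hornerM hornerC hornerXn -rmorphXn /= hornerM hornerC hornerZ hornerXn.
by rewrite mulrA.
Qed.

Lemma coef_mono_bipoly s e c i j :
  (@mono_bipoly s e c)`_j`_i = \sum_(k | e k == (i, j)) c k.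
Proof.
rewrite /mono_bipoly coef_sum coef_sum [RHS]big_mkcond /=.
apply: eq_bigr => k _; rewrite coefCM coefXn; case: (e k) => e1 e2.
rewrite xpair_eqE /= [j == _]eq_sym [e1 == i]eq_sym andbC.
case: eqP => _ /=; last by rewrite mulr0 coef0.
by rewrite mulr1 coefZ coefXn; case: eqP; rewrite ?mulr1 ?mulr0.
Qed.

Lemma coef_mono_bipoly_inj s e c k : injective e ->
  (@mono_bipoly s e c)`_(e k).2`_(e k).1 = c k.
Proof.
move=> einj; rewrite coef_mono_bipoly (big_pred1 k) // => l /=.
by rewrite -surjective_pairing (inj_eq einj).
Qed.

Lemma coef_mono_bipoly_supp s e c i j :
  (@mono_bipoly s e c)`_j`_i != 0 -> exists k, e k = (i, j).
Proof.
rewrite coef_mono_bipoly => nz; apply: boolp.contrapT => /boolp.forallNP ne.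
by move: nz; rewrite big_pred0 ?eqxx // => k; apply/eqP; exact: ne.
Qed.

Lemma size_bipoly_le (f : {poly {poly A}}) m :
  (forall i j, f`_j`_i != 0 -> (i < m)%N /\ (j < m)%N) ->
  (size f <= m)%N /\ forall j, (size (f`_j)%R <= m)%N.
Proof.
move=> fm; have coefs j : (size (f`_j)%R <= m)%N.
  apply/leq_sizeP => i mi; apply/eqP; apply: contraT => /fm[]; lia.
split=> //; apply/leq_sizeP => j mj; apply/polyP => i; rewrite coef0.
by apply/eqP; apply: contraT => /fm[]; lia.
Qed.

End Monomials.

Lemma bieval_map (A B : comNzRingType) (f : {rmorphism A -> B})
  (g : {poly {poly A}}) x y :
  bieval (map_poly (map_poly f) g) (f x) (f y) = f (bieval g x y).
Proof. by rewrite /bieval -map_polyC horner_map horner_map. Qed.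

Section NumberFieldStructure.
Variables (K : fieldExtType rat) (C : numClosedFieldType).

(* code takes p^n values, which bounds the number of abscissas modulo p; the phi i
   embed the integers modulo p in a product of fields, so that the ordinates above
   a given abscissa are counted as roots of n polynomials over fields. *)
Definition residue_data (n p : nat) : Prop :=
  (exists code : integer K -> {ffun 'I_n -> 'F_p},
     forall x x', code x = code x' -> divides p%:R (x - x')) /\
  (exists (L : fieldType) (phi : 'I_n -> {rmorphism integer K -> L}),
     p%:R = 0 :> L /\ forall x, (forall i, phi i x = 0) -> divides p%:R x).

Lemma number_field_structure : exists (n : nat) (sigma : 'I_n -> {rmorphism K -> C})
    (theta : K),
  [/\ (0 < n)%N,
      injective (fun i => sigma i theta) /\
        (forall tau : {rmorphism K -> C}, exists i, tau =1 sigma i),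
      forall x, x \in integers K -> x != 0 -> exists z : int,
        [/\ z != 0, \prod_i sigma i x = z%:~R &
            exists2 w, w \in integers K & x * w = z%:~R]
    & exists N, forall p, prime p -> (N < p)%N -> residue_data n p].
Proof.
have [theta [q [qm qt qmin gen]]] := integral_primitive_element K.
have [z [zinj zr zall]] := exists_roots C qm qt qmin.
have [sigma sE] := boolp.choice (fun i => exists_embedding qm qt qmin gen (zr i)).
have sinj : injective (fun i => sigma i theta).
  by move=> i j /=; rewrite !sE => /zinj.
exists (size q).-1, sigma, theta; split.
- have := q_size_gt1 qm qt; lia.
- split=> // tau; have [i iE] := zall _ (embedding_root qt tau).
  exists i; apply: (embedding_ext qm qt gen); by rewrite iE sE.
- exact: (norm_cofactor qm qt gen sinj).
have [D D0 Dden] := integers_denominator qm qt gen sinj.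
have [U [V [D' D'0 UV]]] := q_bezout qm qt qmin.
(* A larger prime divides neither the denominator nor the separability constant. *)
exists (absz D + absz D')%N => p pp ltp.
have cop (E : int) : E != 0 -> (absz E < p)%N -> coprimez p E.
  move=> E0 lt; rewrite /coprimez /gcdz /= eqz_nat -/(coprime _ _) prime_coprime //.
  by rewrite gtnNdvd // absz_gt0.
have pD : coprimez p D by apply: cop => //; lia.
have pD' : coprimez p D' by apply: cop => //; lia.
split; first exact: (residue_code qm qt Dden pp pD).
have [L [phi phiE]] := residue_morphisms qm qt qmin Dden pp pD
  (ex_intro _ U (ex_intro _ V UV)) pD'.
by exists L, phi.
Qed.

End NumberFieldStructure.

(** * The determinant method *)

Section LeadingExponents.
Local Open Scope nat_scope.

(* When X^a Y^b is the leading monomial of F, no nonzero combination of the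
   monomials with these exponents is a multiple of F. *)
Definition hook_exponents (a b m : nat) : seq (nat * nat) :=
  [seq (i, j) | i <- iota 0 a, j <- iota 0 m] ++
  [seq (a + i, j) | i <- iota 0 m, j <- iota 0 b].

Lemma size_hook_exponents a b m : size (hook_exponents a b m) = (a + b) * m.
Proof. by rewrite size_cat !size_allpairs !size_iota mulnDl [m * b]mulnC. Qed.

Lemma uniq_hook_exponents a b m : uniq (hook_exponents a b m).
Proof.
rewrite cat_uniq !allpairs_uniq ?iota_uniq //=.
- rewrite andbT; apply/hasPn => _ /allpairsP[[i j] [_ _ ->]] /=.
  by apply/negP => /allpairsP[[i' j'] /= []]; rewrite mem_iota => /andP[_ lt] _ [] E; lia.
- by move=> [i j] [i' j'] _ _ [/addnI -> ->].
- by move=> [i j] [i' j'] _ _ [-> ->].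
Qed.

Lemma hook_exponents_avoid a b m u : u \in hook_exponents a b m ->
  ~ (a <= u.1 /\ b <= u.2).
Proof.
rewrite mem_cat => /orP[] /allpairsP[[i j] /= [+ + ->]];
  rewrite !mem_iota /= !add0n; lia.
Qed.

Lemma hook_exponents_le a b m u : u \in hook_exponents a b m ->
  u.1 < a + b + m /\ u.2 < a + b + m.
Proof.
rewrite mem_cat => /orP[] /allpairsP[[i j] /= [+ + ->]];
  rewrite !mem_iota /= !add0n; lia.
Qed.

Lemma sum_iota_pairs c k l :
  2 * (\sum_(u <- [seq (c + i, j) | i <- iota 0 k, j <- iota 0 l]) (u.1 + u.2)) <=
  k * l * (2 * c + k + l).
Proof.
have gauss m : 2 * (\sum_(i <- iota 0 m) i) <= m * m.
  by have := bin2_sum m; rewrite /index_iota subn0 => ->; rewrite mulnC bin2 muln2 halfK; nia.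
rewrite big_allpairs_dep /=.
have -> : \sum_(i <- iota 0 k) \sum_(j <- iota 0 l) (c + i + j) =
  k * l * c + l * (\sum_(i <- iota 0 k) i) + k * (\sum_(j <- iota 0 l) j).
  transitivity (\sum_(i <- iota 0 k) (l * c + l * i + \sum_(j <- iota 0 l) j)).
    apply: eq_bigr => i _; rewrite big_split /= big_const_seq count_predT iter_addn_0.
    by rewrite size_iota; ring.
  rewrite !big_split /= !big_const_seq !count_predT !iter_addn_0 size_iota -big_distrr /=.
  by ring.
have := gauss k; have := gauss l.
move: (\sum_(i <- iota 0 k) i) (\sum_(i <- iota 0 l) i) => A B hl hk.
rewrite !mulnDr; nia.
Qed.

Lemma sum_hook_exponents a b m :
  2 * (\sum_(u <- hook_exponents a b m) (u.1 + u.2)) <=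
  (a + b) * m * (m + (a + b)).
Proof.
rewrite big_cat /= mulnDr.
have := sum_iota_pairs 0 a m; have := sum_iota_pairs a m b.
rewrite muln0 add0n; move: (\sum_(u <- _) _) (\sum_(u <- _) _) => A B h1 h2.
apply: leq_trans (leq_add h2 h1) _; nia.
Qed.

End LeadingExponents.

Section Determinants.
Variables (K : fieldExtType rat) (C : numClosedFieldType) (n : nat).
Variable sigma : 'I_n -> {rmorphism K -> C}.
Hypothesis norm_cof : forall x, x \in integers K -> x != 0 -> exists z : int,
  [/\ z != 0, \prod_i sigma i x = z%:~R &
      exists2 w, w \in integers K & x * w = z%:~R].
Local Notation O := (integer K).

Lemma norm_integer_ge1 (x : O) : x != 0 -> 1 <= `|\prod_i sigma i (val x)|.
Proof.
move=> x0; have [|z [z0 -> _]] := norm_cof (valP x); first by apply: contra_neq x0 => vx0; apply: val_inj; rewrite vx0.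
by rewrite -intr_norm ler1z -gtz0_ge1 normr_gt0.
Qed.

(** If the cofactor w were nonzero its norm would be at least 1, and that of p^m w at least
    p^(mn). *)
Lemma divides_det_eq0 (p m : nat) (x : O) (b : C) :
  divides (p%:R ^+ m) x -> `|\prod_i sigma i (val x)| <= b ->
  b < (p ^ (m * n))%:R -> x = 0.
Proof.
move=> [w ->] le lt; have b0 := le_trans (normr_ge0 _) le; apply/eqP; apply: contraLR lt => xw0.
have w0 : w != 0 by apply: contraNneq xw0 => ->; rewrite mulr0.
rewrite -real_leNgt ?realn ?(ger0_real b0) //.
apply: le_trans le.
rewrite (eq_bigr (fun i => p%:R ^+ m * sigma i (val w))); last first.
  by move=> i _; rewrite !rmorphM !rmorphXn !rmorph_nat.
rewrite big_split /= prodr_const card_ord normrM -exprM -natrX normr_nat.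
by rewrite ler_peMr ?ler0n // norm_integer_ge1.
Qed.

Variables (l W : nat) (kx ky : 'I_n -> nat).
Hypothesis l_gt0 : (0 < l)%N.
Hypothesis kxW : (\sum_i kx i <= W)%N.
Hypothesis kyW : (\sum_i ky i <= W)%N.

(** The sides are powers of the single scale [l]. The exponents add up to at most [W] over the
    embeddings, so [l ^ W] bounds the product of the sides, which may be very uneven. *)
Definition in_box (P : O * O) : Prop := forall i,
  `|sigma i (val P.1)| <= (l ^ kx i)%:R /\ `|sigma i (val P.2)| <= (l ^ ky i)%:R.

(** Under the embedding i the determinant is at most s! times l to the power [kx i] times the sum of
    the x-degrees plus [ky i] times the sum of the y-degrees. Only the sums of [kx] and [ky] enter
    the product over i, so the shape of the box does not matter. *)
Lemma norm_det_monomials (s : nat) (e : 'I_s -> nat * nat) (P : 'I_s -> O * O) :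
  (forall k, in_box (P k)) ->
  `|\prod_i sigma i (val (\det (\matrix_(k, j) ((P k).1 ^+ (e j).1 * (P k).2 ^+ (e j).2))))|
    <= (s`! ^ n * l ^ (W * \sum_j ((e j).1 + (e j).2)))%:R.
Proof.
move=> Pbox; rewrite normr_prod.
have le1 i : `|sigma i (val (\det (\matrix_(k, j) ((P k).1 ^+ (e j).1 * (P k).2 ^+ (e j).2))))|
    <= (s`! * l ^ (kx i * \sum_j (e j).1 + ky i * \sum_j (e j).2))%:R.
  rewrite -!det_map_mx.
  have -> : (s`! * l ^ (kx i * \sum_j (e j).1 + ky i * \sum_j (e j).2))%:R =
     s`!%:R * \prod_j (l ^ (kx i * (e j).1 + ky i * (e j).2))%:R :> C.
    rewrite natrM -natr_prod -expn_sum; congr (_ * (_ ^ _)%:R).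
    by rewrite !big_distrr -big_split.
  apply: norm_det_le => k j; rewrite expnD natrM !expnM.
  rewrite (natrX _ (l ^ kx i)) (natrX _ (l ^ ky i)).
  rewrite !mxE [sigma i _]rmorphM !rmorphXn normrM !normrX /=.
  have [] := Pbox k i; rewrite !natrX => hx hy.
  by apply: ler_pM; rewrite ?exprn_ge0 ?normr_ge0 //;
    apply: lerXn2r; rewrite ?nnegrE ?normr_ge0 ?exprn_ge0 ?ler0n.
apply: (@le_trans _ _ (\prod_(i < n)
    (s`! * l ^ (kx i * \sum_j (e j).1 + ky i * \sum_j (e j).2))%:R)).
  by apply: ler_prod => i _; rewrite normr_ge0 le1.
rewrite -natr_prod ler_nat big_split /= prod_nat_const card_ord leq_mul2l.
apply/orP; right; rewrite -expn_sum leq_pexp2l // big_split /= -!big_distrl /=.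
rewrite big_split /= mulnDr; apply: leq_add; exact: leq_mul.
Qed.

Variables (F : {poly {poly K}}) (d a b M : nat).
Hypothesis F_irr : irreducible_bipoly F.
Hypothesis F_size : (1 < size F)%N.
Hypothesis F_deg : forall i j, F`_j`_i != 0 -> (i + j <= d)%N.
Hypothesis ab_d : (a + b = d)%N.
Hypothesis F_lead : forall G : {poly {poly K}}, G != 0 ->
  (forall i j, G`_j`_i != 0 -> ~ (a <= i /\ b <= j)%N) -> ~ exists k, G = F * k.

Lemma F_sizes : (size F <= (d + M).+1)%N /\ forall j, (size (F`_j)%R <= (d + M).+1)%N.
Proof using F_deg.
apply: size_bipoly_le => i j /F_deg ijd; rewrite !ltnS.
by split; apply: leq_trans (leq_addr M d); apply: leq_trans ijd; rewrite ?leq_addr ?leq_addl.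
Qed.

Local Notation s := (size (hook_exponents a b M)).
Local Notation Bz := (bezout_bound (d + M).+1).

Lemma vanishing_bound (T : seq (O * O)) (G : {poly {poly K}}) :
  ~ (exists k, G = F * k) ->
  (forall i j, G`_j`_i != 0 -> (i < (d + M).+1)%N /\ (j < (d + M).+1)%N) ->
  uniq T ->
  (forall P, P \in T -> bieval F (val P.1) (val P.2) = 0 /\
                        bieval G (val P.1) (val P.2) = 0) ->
  (size T <= Bz)%N.
Proof using F_irr F_size F_deg.
move=> nG /size_bipoly_le[sG1 sG2] uT TFG; have [sF1 sF2] := F_sizes.
rewrite -(size_map (fun P : O * O => (val P.1, val P.2))).
apply: (irreducible_bipoly_common_zeros F_irr F_size nG sF1 sG1 sF2 sG2).
  by rewrite map_inj_uniq // => -[x y] [x' y'] [/val_inj -> /val_inj ->].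
by move=> _ /mapP[P PT ->]; exact: TFG.
Qed.

(** [F] carries irreducibility and Bezout's bound; [g], which will be a multiple of [F] with
    integral coefficients, carries the congruences. *)
Lemma class_bound (T : seq (O * O)) (g : {poly {poly O}}) (p : nat) (u x0 y0 : O) :
  uniq T ->
  (forall P, P \in T -> [/\ bieval F (val P.1) (val P.2) = 0,
     bieval g P.1 P.2 = 0, in_box P, divides p%:R (P.1 - x0) &
     divides p%:R (P.2 - y0)]) ->
  divides p%:R (1 - u * bieval g^`() x0 y0) ->
  (s`! ^ n * l ^ (W * \sum_(v <- hook_exponents a b M) (v.1 + v.2)) < p ^ ('C(s, 2) * n))%N ->
  (size T <= Bz)%N.
Proof.
move=> uT TP du num.
pose P i : O * O := nth (0, 0) T i.
pose e (j : 'I_s) : nat * nat := nth (0%N, 0%N) (hook_exponents a b M) j.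
have PT (i : 'I_(size T)) : P i \in T by rewrite mem_nth.
have einj : injective e.
  move=> j j' /eqP; rewrite nth_uniq ?uniq_hook_exponents //.
  by move/eqP/val_inj.
pose A : 'M[K]_(size T, s) := \matrix_(i, j) (val (P i).1 ^+ (e j).1 * val (P i).2 ^+ (e j).2).
have [[f /eqP[]]|[c [k ck] Ac]] := minor_or_kernel A.
  pose D : O := \det (\matrix_(i, j) ((P (f i)).1 ^+ (e j).1 * (P (f i)).2 ^+ (e j).2)).
  have : D = 0.
    apply: (@divides_det_eq0 p 'C(s, 2) _ (s`! ^ n * l ^ (W * \sum_j ((e j).1 + (e j).2)))%:R).
    - apply: (@divides_det_monomials _ _ _ g x0 y0 u (fun i => (P (f i)).1)
         (fun i => (P (f i)).2)) => // i; by have [] := TP _ (PT (f i)).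
    - by apply: norm_det_monomials => i; have [] := TP _ (PT (f i)).
    - rewrite ltr_nat; move: num; rewrite (big_nth (0%N, 0%N)) big_mkord.
      exact.
  move=> /(congr1 val); rewrite rmorph0 -det_map_mx => D0.
  rewrite -[RHS]D0; congr (\det _); apply/matrixP => i j.
  by rewrite !mxE rmorphM !rmorphXn.
have eM j : e j \in hook_exponents a b M by rewrite mem_nth.
apply: (@vanishing_bound T (mono_bipoly e c)) => //.
- apply: F_lead.
    apply: contra_neq ck => G0; rewrite -(coef_mono_bipoly_inj c k einj) G0.
    by rewrite !coef0.
  move=> i j /coef_mono_bipoly_supp[k' ek'].
  by have := hook_exponents_avoid (eM k'); rewrite ek'.
- move=> i j /coef_mono_bipoly_supp[k' ek'].
  by have := hook_exponents_le (eM k'); rewrite ek' /= ab_d; lia.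
- move=> Q QT; have [FQ _ _ _ _] := TP _ QT; split=> //.
  rewrite bieval_mono_bipoly.
  have iQ : (index Q T < size T)%N by rewrite index_mem.
  rewrite -[RHS](Ac (Ordinal iQ)); apply: eq_bigr => j _.
  by rewrite mxE /P nth_index.
Qed.

Lemma residue_bound (T : seq (O * O)) (g : {poly {poly O}}) (p : nat) :
  prime p -> residue_data K n p -> uniq T -> (size g <= d.+1)%N ->
  (forall P, P \in T -> [/\ bieval F (val P.1) (val P.2) = 0,
     bieval g P.1 P.2 = 0, in_box P &
     exists u, divides p%:R (1 - u * bieval g^`() P.1 P.2)]) ->
  (s`! ^ n * l ^ (W * \sum_(v <- hook_exponents a b M) (v.1 + v.2)) < p ^ ('C(s, 2) * n))%N ->
  (size T <= p ^ n * (d ^ n * Bz))%N.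
Proof.
move=> pp [[code codeP] [L [phi [pL phiP]]]] uT sg TP num.
have phi_eq i x x' : divides p%:R (x - x') -> phi i x = phi i x'.
  move=> [c cE]; apply/eqP; rewrite -subr_eq0 -rmorphB cE rmorphM rmorph_nat pL.
  by rewrite mul0r.
apply: (@size_leq_fibers _ _ (fun P => code P.1)).
  have /card_uniqP <- := undup_uniq [seq code P.1 | P <- T].
  by rewrite (leq_trans (max_card _)) // card_ffun card_Fp // card_ord.
move=> P0 P0T; set T1 := [seq P <- T | _].
have T1T P : P \in T1 -> P \in T by rewrite mem_filter => /andP[].
have T1x P : P \in T1 -> divides p%:R (P.1 - P0.1).
  by rewrite mem_filter => /andP[/eqP /codeP].
pose r (i : 'I_n) := undup [seq phi i P.2 | P <- T1].
have rd i : (size (r i) <= d)%N.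
  pose h := map_poly (horner_eval (phi i P0.1)) (map_poly (map_poly (phi i)) g).
  have hE P : P \in T1 -> h.[phi i P.2] = 0.
    move=> PT1; have E := phi_eq i _ _ (T1x _ PT1).
    rewrite /h -bieval_horner -E bieval_map.
    by have [_ -> _ _] := TP _ (T1T _ PT1); rewrite rmorph0.
  (* The derivative is invertible modulo p at [P0], so the fibre polynomial cannot vanish
     identically in [L]. *)
  have h0 : h != 0.
    apply/eqP => h0; have [_ _ _ [u [c uc]]] := TP _ P0T.
    have := congr1 (phi i) uc; rewrite rmorphM rmorph_nat pL mul0r rmorphB rmorph1.
    rewrite rmorphM -bieval_map bieval_horner -!deriv_map -/h h0 deriv0 horner0.
    by rewrite mulr0 subr0 => /eqP; rewrite oner_eq0.
  rewrite -ltnS; apply: leq_trans (leq_trans (leq_trans (size_poly _ _) (size_poly _ _)) sg).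
  apply: (@max_poly_roots _ h) => //; last exact: undup_uniq.
  apply/allP => w; rewrite mem_undup => /mapP[P PT1 ->].
  by apply/eqP; exact: hE.
(* The vector of the images of an ordinate determines it modulo p, and takes at most d^n values. *)
apply: (@size_leq_fibers _ _ (fun P => [seq phi i P.2 | i <- enum 'I_n])).
  have le : (size (seq_product [seq r i | i <- enum 'I_n]) <= d ^ n)%N.
    rewrite -[X in (_ <= _ ^ X)%N]size_enum_ord -(size_map r); apply: size_seq_product.
    by apply/allP => _ /mapP[i _ ->].
  apply: leq_trans le; apply: uniq_leq_size; first exact: undup_uniq.
  move=> w; rewrite mem_undup => /mapP[P PT1 ->]; apply: mem_seq_product => i.
  by rewrite mem_undup; apply/mapP; exists P.
move=> Q0 Q0T1; have [_ _ _ [u du]] := TP _ (T1T _ Q0T1).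
apply: (@class_bound _ g p u Q0.1 Q0.2) => //.
  by rewrite !filter_uniq.
move=> P; rewrite mem_filter => /andP[/eqP Peq PT1].
have [FP gP Pb _] := TP _ (T1T _ PT1); split=> //.
  exact: divides_trans (T1x _ PT1) (divides_sym (T1x _ Q0T1)).
apply: phiP => i; rewrite rmorphB; apply/eqP; rewrite subr_eq0; apply/eqP.
by move/eq_in_map: Peq; apply; rewrite mem_enum.
Qed.

(** With x w = z and a z + b p = 1, the inverse is a w. *)
Lemma coprime_inverse (p : nat) (x : O) (z : int) : prime p ->
  ~~ (p %| `|z|)%N -> (exists2 w : K, w \in integers K & val x * w = z%:~R) ->
  exists u, divides p%:R (1 - u * x).
Proof.
move=> pp npz [w wi xw].
have /coprimezP[[u v] /= uv] : coprimez z p.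
  by rewrite /coprimez /gcdz /= eqz_nat -/(coprime _ _) coprime_sym prime_coprime.
exists (u%:~R * Integer wi), v%:~R.
apply: val_inj; rewrite !(rmorphB, rmorphM, rmorph_int, rmorph_nat, rmorph1) /=.
have uv' := congr1 (fun z : int => z%:~R : K) uv.
rewrite rmorphD !rmorphM /= in uv'.
rewrite -mulrA [w * _]mulrC xw.
by apply/eqP; rewrite subr_eq mulrC addrC uv'.
Qed.

Lemma prod_primes_dvd (ps : seq nat) (m : nat) : uniq ps -> all prime ps ->
  all (fun p => p %| m)%N ps -> (\prod_(p <- ps) p %| m)%N.
Proof.
elim: ps => [|p ps IH] /=; first by rewrite big_nil dvd1n.
move=> /andP[pps ups] /andP[pp aps] /andP[pm apm].
rewrite big_cons Gauss_dvd ?pm ?IH //.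
rewrite big_seq; apply: (big_ind (fun m => coprime p m)) => [|k k'|q qps].
- exact: coprimen1.
- by rewrite coprimeMr => -> ->.
- rewrite prime_coprime // dvdn_prime2 ?(allP aps _ qps) //.
  by apply: contraNneq pps => ->.
Qed.

(** If all these primes divided the nonzero norm, so would their product, which is at least l^(E+1).
    A prime that does not divide the norm makes x invertible. *)
Lemma good_prime (ps : seq nat) (E : nat) (x : O) : uniq ps -> all prime ps ->
  all (fun p => l <= p)%N ps -> size ps = E.+1 -> (1 < l)%N -> x != 0 ->
  `|\prod_i sigma i (val x)| <= (l ^ E)%:R ->
  exists2 p, p \in ps & exists u, divides p%:R (1 - u * x).
Proof.
move=> ups aps lps sps l1 x0.
have vx0 : val x != 0.
  by apply: contra_neq x0 => vx0; apply: val_inj; rewrite vx0.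
have [z [z0 -> xw]] := norm_cof (valP x) vx0 => zE.
have [|/allPn[p pps npz]] := boolP (all (fun p => p %| `|z|)%N ps); last first.
  by exists p => //; apply: coprime_inverse npz xw; exact: (allP aps).
move=> /(prod_primes_dvd ups aps)/dvdn_leq; rewrite absz_gt0 z0 => /(_ isT) le.
have : (l ^ E.+1 <= \prod_(p <- ps) p)%N.
  rewrite -sps; elim: {ups aps sps le} ps lps => //= [|p ps IH] /=.
    by rewrite big_nil.
  by move=> /andP[lp /IH le]; rewrite big_cons expnS leq_mul.
move=> /leq_trans/(_ le); rewrite leqNgt => /negP[].
apply: leq_ltn_trans (_ : l ^ E < _)%N; last by rewrite ltn_exp2l.
by move: zE; rewrite -intr_norm -natr_absz ler_nat.
Qed.

Lemma sigma_valM i (x y : O) :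
  sigma i (val (x * y)) = sigma i (val x) * sigma i (val y).
Proof. by rewrite !rmorphM. Qed.

Lemma norm_det_unif (m : nat) (A : 'M[O]_m) (i : 'I_n) (Z : nat) :
  (forall k j, `|sigma i (val (A k j))| <= Z%:R) ->
  `|sigma i (val (\det A))| <= (m`! * Z ^ m)%:R.
Proof.
move=> AZ; rewrite -!det_map_mx natrM.
have -> : (Z ^ m)%:R = \prod_(j < m) (Z%:R : C).
  by rewrite prodr_const card_ord natrX.
by apply: norm_det_le => k j; rewrite !mxE; exact: AZ.
Qed.

Lemma norm_monomial (P : O * O) (u : nat * nat) i : in_box P -> (u.1 + u.2 <= d)%N ->
  `|sigma i (val (P.1 ^+ u.1 * P.2 ^+ u.2))| <= (l ^ (W * d))%:R.
Proof.
move=> Pb ud; have [] := Pb i.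
have lW (k : 'I_n -> nat) : (\sum_j k j <= W)%N -> (l ^ k i)%:R <= (l ^ W)%:R :> C.
  move=> kW; rewrite ler_nat leq_pexp2l // (leq_trans _ kW) //.
  by rewrite (bigD1 i) //= leq_addr.
move=> /le_trans/(_ (lW _ kxW)) hx /le_trans/(_ (lW _ kyW)) hy.
have -> : sigma i (val (P.1 ^+ u.1 * P.2 ^+ u.2)) =
    sigma i (val P.1) ^+ u.1 * sigma i (val P.2) ^+ u.2.
  by rewrite !rmorphM !rmorphXn.
rewrite normrM !normrX.
apply: (@le_trans _ _ ((l ^ W)%:R ^+ u.1 * (l ^ W)%:R ^+ u.2)).
  by apply: ler_pM; rewrite ?exprn_ge0 ?normr_ge0 //;
    apply: lerXn2r; rewrite ?nnegrE ?normr_ge0 ?ler0n.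
by rewrite -exprD -natrX -expnM ler_nat leq_pexp2l // leq_mul2l ud orbT.
Qed.

Lemma bieval_deriv_mono (A : comNzRingType) (m : nat) (e : 'I_m -> nat * nat)
  (c : 'I_m -> A) x y :
  bieval (mono_bipoly e c)^`() x y =
  \sum_k (c k * (x ^+ (e k).1 * y ^+ (e k).2.-1)) *+ (e k).2.
Proof.
rewrite /bieval /mono_bipoly raddf_sum !horner_sum; apply: eq_bigr => k _ /=.
rewrite derivM derivC mul0r add0r derivXn hornerM hornerC hornerMn hornerXn.
rewrite -rmorphXn /= hornerM hornerZ hornerXn hornerMn hornerC.
by rewrite mulrnAr mulrA.
Qed.

Lemma bipoly_mono (A : comNzRingType) (m : nat) (e : 'I_m -> nat * nat)
  (f : {poly {poly A}}) : injective e ->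
  (forall i j, f`_j`_i != 0 -> exists k, e k = (i, j)) ->
  f = mono_bipoly e (fun k => f`_(e k).2`_(e k).1).
Proof.
move=> einj supp; apply/polyP => j; apply/polyP => i.
have [f0|/supp[k ek]] := eqVneq (f`_j`_i) 0.
  rewrite f0 coef_mono_bipoly big1 // => k /eqP ->.
  exact: f0.
by have := coef_mono_bipoly_inj (fun k => f`_(e k).2`_(e k).1) k einj; rewrite ek.
Qed.

(** There are at most N = (d+1)^2 monomials besides the leading one, each at most Z = l^(Wd) on the
    box. The coefficients of the rescaled polynomial are at most N! Z^N, and its derivative at a
    point has at most N + 1 terms, each with a further factor d Z. The constant (N+1) d N! is
    absorbed into one more factor l, and n counts the conjugates. *)
Definition scaling_exponent := (n * (W * d * ((d.+1 * d.+1).+1)).+1)%N.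
Definition scaling_constant := ((d.+1 * d.+1).+1 * d * (d.+1 * d.+1)`!)%N.

(* The coefficients of g are, by Cramer's rule, minors of the matrix of the monomials
   of degree at most d at points of T, hence integers of controlled size. *)
Lemma scaling (T : seq (O * O)) : uniq T ->
  (forall P, P \in T -> bieval F (val P.1) (val P.2) = 0 /\ in_box P) ->
  (Bz < size T)%N -> (scaling_constant <= l)%N ->
  exists (g : {poly {poly O}}) (c : K), [/\ c != 0,
     map_poly (map_poly val) g = c%:P *: F, (size g <= d.+1)%N &
     forall P, in_box P ->
       `|\prod_i sigma i (val (bieval g^`() P.1 P.2))| <= (l ^ scaling_exponent)%:R].
Proof.
move=> uT TP sT cl.
pose box := [seq (i, j) | i <- iota 0 d.+1, j <- iota 0 d.+1].
pose ms := [seq u <- box | (u.1 + u.2 <= d)%N && (u != (a, b))].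
have ubox : uniq box.
  by rewrite allpairs_uniq ?iota_uniq // => -[i j] [i' j'] _ _ [-> ->].
have ums : uniq ms by rewrite filter_uniq.
pose s1 := size ms; pose e (k : 'I_s1) : nat * nat := nth (0%N, 0%N) ms k.
(* The leading exponent comes first: the linear system below expresses the other coefficients
   through the leading one. *)
pose e' (k : 'I_s1.+1) : nat * nat := nth (0%N, 0%N) ((a, b) :: ms) k.
have s1le : (s1 <= d.+1 * d.+1)%N.
  rewrite /s1 size_filter (leq_trans (count_size _ _)) //.
  by rewrite size_allpairs !size_iota.
have ems k : e k \in ms by rewrite mem_nth.
have abms : (a, b) \notin ms by rewrite mem_filter eqxx andbF.
have einj : injective e.
  by move=> k k' /eqP; rewrite nth_uniq // => /eqP/val_inj.
have e'inj : injective e'.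
  move=> k k' /eqP; rewrite nth_uniq //= ?abms ?ums //.
  by move=> /eqP/val_inj.
have e'0 : e' ord0 = (a, b) by [].
have e'l k : e' (lift ord0 k) = e k by [].
have e'd k : ((e' k).1 + (e' k).2 <= d)%N.
  have [j ->|->] := unliftP ord0 k; last by rewrite e'0 /= ab_d.
  by rewrite e'l; have := ems j; rewrite mem_filter => /andP[/andP[]].
have supp i j : (i + j <= d)%N -> exists k, e' k = (i, j).
  move=> ijd; have [E|ne] := eqVneq (i, j) (a, b); first by exists ord0; rewrite e'0 E.
  have ijm : (i, j) \in ms.
    rewrite mem_filter ne andbT ijd andTb; apply/allpairsP; exists (i, j).
    by rewrite !mem_iota; split=> //=; lia.
  have lt : (index (i, j) ms < s1)%N by rewrite index_mem.
  by exists (lift ord0 (Ordinal lt)); rewrite e'l /e /= nth_index.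
pose Fc k := F`_(e' k).2`_(e' k).1.
have FE : F = mono_bipoly e' Fc by apply: bipoly_mono => // i j /F_deg/supp.
(* Otherwise [F] would contain no multiple of its leading monomial, although it is a multiple of
   itself. *)
have Fab : Fc ord0 != 0.
  apply/eqP => F0; apply: (F_lead (G := F)); last by exists 1; rewrite mulr1.
    by case: F_irr.
  move=> i j ij0 [ai bj]; have := F_deg ij0 => ijd.
  have [ia jb] : i = a /\ j = b by lia.
  by move: ij0; rewrite ia jb; have := F0; rewrite /Fc e'0 /= => ->; rewrite eqxx.
pose P i : O * O := nth (0, 0) T i.
have PT (i : 'I_(size T)) : P i \in T by rewrite mem_nth.
pose A : 'M[K]_(size T, s1) := \matrix_(i, j) (val (P i).1 ^+ (e j).1 * val (P i).2 ^+ (e j).2).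
(* In the second case a combination of the monomials other than the leading one vanishes on [T]
   without being a multiple of [F], and Bezout's bound contradicts the size of [T]. *)
have [[f detA]|[c [k ck] Ac]] := minor_or_kernel A; last first.
  have [] : ~ (exists G, mono_bipoly e c = F * G).
    apply: F_lead.
      apply: contra_neq ck => G0; rewrite -(coef_mono_bipoly_inj c k einj) G0.
      by rewrite !coef0.
    move=> i j /coef_mono_bipoly_supp[k' ek'].
    have := ems k'; rewrite ek' mem_filter /= => /andP[/andP[ijd ne] _] [ai bj].
    by case/eqP: ne; congr (_, _); lia.
  apply: boolp.contrapT => nG.
  move: sT; rewrite ltnNge => /negP; apply.
  apply: (vanishing_bound nG) => //.
    move=> i j /coef_mono_bipoly_supp[k' ek'].
    by have := ems k'; rewrite ek' mem_filter /= => /andP[/andP[ijd _] _]; lia.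
  move=> Q QT; have [FQ _] := TP _ QT; split=> //.
  rewrite bieval_mono_bipoly.
  have iQ : (index Q T < size T)%N by rewrite index_mem.
  rewrite -[RHS](Ac (Ordinal iQ)); apply: eq_bigr => j _.
  by rewrite mxE /P nth_index.
pose Mo : 'M[O]_s1 := \matrix_(i, j) ((P (f i)).1 ^+ (e j).1 * (P (f i)).2 ^+ (e j).2).
pose vo : 'cV[O]_s1 := \col_i ((P (f i)).1 ^+ a * (P (f i)).2 ^+ b).
pose c0 := \det Mo; pose cj j := - (\adj Mo *m vo) j 0.
pose c' (k : 'I_s1.+1) := if unlift ord0 k is Some j then cj j else c0.
have c'0 : c' ord0 = c0 by rewrite /c' unlift_none.
have c'l j : c' (lift ord0 j) = cj j by rewrite /c' liftK.
have c0E : val c0 != 0.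
  rewrite -det_map_mx; move: detA; congr (\det _ != 0).
  by apply/matrixP => i j; rewrite !mxE rmorphM !rmorphXn.
(* The vanishing of [F] at the chosen points is an invertible linear system for its coefficients, so
   Cramer's rule makes the minors proportional to them, with ratio [lam]. *)
pose lam := val c0 / Fc ord0.
have c'E k : val (c' k) = lam * Fc k.
  have [j ->|->] := unliftP ord0 k; last by rewrite c'0 /lam divfK.
  pose MK : 'M[K]_s1 := map_mx val Mo; pose vK : 'cV[K]_s1 := map_mx val vo.
  pose Fv : 'cV[K]_s1 := \col_j0 Fc (lift ord0 j0).
  have MF : MK *m Fv = - Fc ord0 *: vK.
    apply/matrixP => i0 k0; rewrite !mxE ord1.
    have [FP _] := TP _ (PT (f i0)).
    apply/eqP; rewrite mulNr -addr_eq0; apply/eqP; rewrite -[RHS]FP [in RHS]FE.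
    rewrite bieval_mono_bipoly big_ord_recl addrC; congr (_ + _).
      by rewrite e'0 !(rmorphM, rmorphXn).
    apply: eq_bigr => j0 _; rewrite !mxE e'l !(rmorphM, rmorphXn).
    exact: mulrC.
  have adjF : \det MK *: Fv = - Fc ord0 *: (\adj MK *m vK).
    by rewrite -mul_scalar_mx -mul_adj_mx -mulmxA MF -scalemxAr.
  have adjFj : \det MK * Fc (lift ord0 j) = - Fc ord0 * (\adj MK *m vK) j 0.
    have := congr1 (fun v : 'cV[K]_s1 => v j 0) adjF.
    by rewrite [LHS]mxE [RHS]mxE [Fv j 0]mxE.
  have -> : val (c' (lift ord0 j)) = - (\adj MK *m vK) j 0.
    by rewrite c'l /cj rmorphN /MK /vK -map_mx_adj -map_mxM [in RHS]mxE.
  by rewrite /lam mulrAC -det_map_mx adjFj mulrAC mulNr mulfV // mulN1r.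
have lam0 : lam != 0 by rewrite mulf_neq0 ?invr_eq0.
pose Z := (l ^ (W * d))%N.
have Z0 : (0 < Z)%N by rewrite expn_gt0 l_gt0.
have c'Z k i : `|sigma i (val (c' k))| <= (s1`! * Z ^ s1)%:R.
  have bound1 (Q : O * O) (u : nat * nat) : in_box Q -> (u.1 + u.2 <= d)%N ->
      `|sigma i (val (Q.1 ^+ u.1 * Q.2 ^+ u.2))| <= Z%:R.
    by move=> Qb ud; exact: norm_monomial.
  have Pf k1 : in_box (P (f k1)) by have [] := TP _ (PT (f k1)).
  have Moz k1 k2 : `|sigma i (val (Mo k1 k2))| <= Z%:R.
    by rewrite mxE; apply: bound1 => //; rewrite -e'l; exact: e'd.
  have [j ->|->] := unliftP ord0 k; last by rewrite c'0; exact: norm_det_unif.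
  rewrite c'l /cj !rmorphN normrN mxE !rmorph_sum.
  apply: le_trans (ler_norm_sum _ _ _) _.
  have s1E : s1 = s1.-1.+1 by case: (s1) (j) => [[]|].
  apply: (@le_trans _ _ (\sum_(k1 < s1) ((s1.-1)`! * Z ^ s1.-1 * Z)%:R)).
    apply: ler_sum => k1 _; rewrite sigma_valM normrM natrM.
    apply: ler_pM; rewrite ?normr_ge0 //; last first.
      by rewrite mxE; apply: (bound1 _ (a, b)) => //=; rewrite ab_d.
    rewrite mxE /cofactor sigma_valM !rmorphXn !rmorphN1 normrM normrX normrN1 expr1n mul1r.
    by apply: norm_det_unif => k2 k3; rewrite 2!mxE; exact: Moz.
  rewrite sumr_const card_ord -mulrnA ler_nat.
  by rewrite [X in (_ <= X)%N](_ : _ = (s1.-1)`! * Z ^ s1.-1 * Z * s1)%N // {1 2}s1E factS expnSr -s1E; ring.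
exists (mono_bipoly e' c'), lam; split=> //.
- apply/polyP => j; apply/polyP => i.
  rewrite coefZ coefCM !coef_map FE !coef_mono_bipoly raddf_sum mulr_sumr.
  by apply: eq_bigr => k _; exact: c'E.
- have := @size_bipoly_le _ (mono_bipoly e' c') d.+1.
  case=> // i j /coef_mono_bipoly_supp[k ek]; have := e'd k; rewrite ek /=; lia.
move=> Q Qb; rewrite normr_prod.
have le1 i : `|sigma i (val (bieval (mono_bipoly e' c')^`() Q.1 Q.2))| <=
    (l ^ (W * d * (d.+1 * d.+1).+1).+1)%:R.
  rewrite bieval_deriv_mono !rmorph_sum; apply: le_trans (ler_norm_sum _ _ _) _.
  apply: (@le_trans _ _ (\sum_(k < s1.+1) (s1`! * Z ^ s1 * Z * d)%:R)).
    apply: ler_sum => k _; rewrite !rmorphMn normrMn natrM -[X in X <= _]mulr_natr.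
    apply: ler_pM; rewrite ?normr_ge0 ?ler0n //; last first.
      by rewrite ler_nat; have := e'd k; lia.
    rewrite sigma_valM normrM natrM.
    apply: ler_pM; rewrite ?normr_ge0 //.
    apply: (norm_monomial (u := ((e' k).1, (e' k).2.-1))) => //=.
    by have := e'd k; lia.
  rewrite sumr_const card_ord -mulrnA ler_nat.
  apply: (@leq_trans (scaling_constant * l ^ (W * d * (d.+1 * d.+1).+1))); last first.
    by rewrite expnS leq_mul2r cl orbT.
  have -> : (s1`! * Z ^ s1 * Z * d * s1.+1 = (s1.+1 * d * s1`!) * Z ^ s1.+1)%N.
    by rewrite expnSr; ring.
  apply: leq_mul; last by rewrite expnM leq_pexp2l.
  rewrite /scaling_constant leq_mul ?leq_mul ?leq_fact //.
apply: le_trans (_ : \prod_(i < n) (l ^ (W * d * (d.+1 * d.+1).+1).+1)%:R <= _).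
  by apply: ler_prod => i _; rewrite normr_ge0 le1.
by rewrite prodr_const card_ord -natrX -expnM mulnC.
Qed.

End Determinants.

Lemma size_leq_cover (T U : eqType) (s : seq T) (ps : seq U) (a : pred T)
  (b : U -> pred T) : (forall t, t \in s -> a t || has (b^~ t) ps) ->
  (size s <= count a s + \sum_(p <- ps) count (b p) s)%N.
Proof.
elim: s => //= t s IH cov.
have {}IH : (size s <= count a s + \sum_(p <- ps) count (b p) s)%N.
  by apply: IH => u us; apply: cov; rewrite in_cons us orbT.
rewrite big_split /= addnACA -add1n leq_add //.
have -> : (\sum_(p <- ps) b p t = count (b^~ t) ps)%N.
  by rewrite -sum1_count [RHS]big_mkcond; apply: eq_bigr => p _; case: (b p t).
have := cov t (mem_head _ _); rewrite has_count.
by case: (a t) => //= h; rewrite add0n.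
Qed.

Lemma bieval_scale (A : comNzRingType) (c : A) (f : {poly {poly A}}) x y :
  bieval (c%:P *: f) x y = c * bieval f x y.
Proof. by rewrite /bieval hornerZ hornerM hornerC. Qed.

Lemma bin2_double s : (2 * 'C(s, 2) = s * s.-1)%N.
Proof. by rewrite mulnC -[2%N in LHS]/(2`!) bin_ffact ffactnS ffactn1. Qed.

(** * The points of one box *)

Section BoxBound.
Variables (K : fieldExtType rat) (C : numClosedFieldType) (n : nat).
Variable sigma : 'I_n -> {rmorphism K -> C}.
Hypothesis norm_cof : forall x, x \in integers K -> x != 0 -> exists z : int,
  [/\ z != 0, \prod_i sigma i x = z%:~R &
      exists2 w, w \in integers K & x * w = z%:~R].
Variable N : nat.
Hypothesis residues : forall p, prime p -> (N < p)%N -> residue_data K n p.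
Local Notation O := (integer K).

(** What the argument uses of the leading monomial of a graded order, stated without the order so
    that it survives the exchange of the two variables. *)
Definition leading_exponent (F : {poly {poly K}}) (d a b : nat) : Prop :=
  [/\ forall i j, F`_j`_i != 0 -> (i + j <= d)%N, (a + b = d)%N &
   forall G : {poly {poly K}}, G != 0 ->
    (forall i j, G`_j`_i != 0 -> ~ (a <= i /\ b <= j)%N) -> ~ exists k, G = F * k].

(** The numerical hypothesis ensures twice the comparison n + W S < e n C(s,2) between exponents of
    l, where s = dM and S is the sum of the degrees of the monomials: n accounts for the factor s!^n
    <= l^n, and p >= l^e gives the right-hand side. *)
Lemma box_bound (d M W e : nat) : (0 < e)%N ->
  (2 * n + W * (d * M * (M + d)) < e * n * (d * M * (d * M).-1))%N ->
  exists k0 B, forall k, (k0 <= k)%N -> forall F a b (kx ky : 'I_n -> nat) T,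
    irreducible_bipoly F -> (1 < size F)%N -> leading_exponent F d a b ->
    (\sum_i kx i <= W)%N -> (\sum_i ky i <= W)%N -> uniq T ->
    (forall P : O * O, P \in T -> bieval F (val P.1) (val P.2) = 0 /\
       in_box sigma (2 ^ k) kx ky P) ->
    (size T <= B * 2 ^ (k * e.+1 * n))%N.
Proof.
move=> e0 num; pose s := (d * M)%N; pose E := scaling_exponent n W d.
have [k0 primes_k0] := primes_in_range E.+1 e.
pose Bz := bezout_bound (d + M).+1.
(* For such [k] the scale l = 2^k exceeds all the constants, and the primes exceed [N]. *)
exists (k0 + s`! + scaling_constant d + N).+2, (2 * Bz + E.+1 * (d ^ n * Bz))%N.
move=> k kk F a b kx ky T Firr sF [Fdeg abd Flead] kxW kyW uT TP.
pose l := (2 ^ k)%N.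
have kl : (k < l)%N by rewrite ltn_expl.
have l0 : (0 < l)%N by lia.
have l1 : (1 < l)%N by lia.
have l_e1n : (0 < 2 ^ (k * e.+1 * n))%N by rewrite expn_gt0.
have [leT|gtT] := leqP (size T) Bz.
  apply: leq_trans leT _; apply: leq_trans (leq_pmulr _ l_e1n).
  by rewrite mul2n -addnn -!addnA leq_addr.
have cl : (scaling_constant d <= l)%N by lia.
have [g [c [c0 gE sg gbound]]] :=
  scaling l0 kxW kyW Firr sF Fdeg abd Flead uT TP gtT cl.
have [|ps [ups sps psP]] := primes_k0 k; first by lia.
have aps : all prime ps by apply/allP => p /psP[].
have lle : (l <= l ^ e)%N by rewrite -{1}(expn1 l) leq_pexp2l.
have lps : all (fun p => l <= p)%N ps.
  by apply/allP => p /psP[_ + _]; rewrite expnM; exact: leq_trans.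
have bg (P : O * O) : val (bieval g P.1 P.2) = c * bieval F (val P.1) (val P.2).
  by rewrite -bieval_map gE bieval_scale.
have bg' (P : O * O) : val (bieval g^`() P.1 P.2) = c * bieval F^`() (val P.1) (val P.2).
  by rewrite -bieval_map -!deriv_map gE derivZ bieval_scale.
pose bad (P : O * O) := bieval g^`() P.1 P.2 == 0.
pose good p (P : O * O) := `[< exists u, divides p%:R (1 - u * bieval g^`() P.1 P.2) >].
have cov P : P \in T -> bad P || has (good^~ P) ps.
  move=> PT; rewrite /bad; case: eqVneq => //= ne; apply/hasP.
  have [p pps pu] := good_prime norm_cof ups aps lps sps l1 ne (gbound _ (TP _ PT).2).
  by exists p => //; apply/asboolP.
have sE : size (hook_exponents a b M) = s by rewrite size_hook_exponents abd.
have bound_good p : p \in ps ->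
    (count (good p) T <= 2 ^ (k * e.+1 * n) * (d ^ n * Bz))%N.
  move=> pps; have [pp lep pel] := psP _ pps; rewrite -size_filter.
  apply: leq_trans (_ : p ^ n * (d ^ n * Bz) <= _)%N; last first.
    rewrite leq_mul2r; apply/orP; right; rewrite expnM.
    by case: (posnP n) => [->|n0]; rewrite ?expn0 // leq_exp2r.
  have Np : (N < p)%N by have := allP lps p pps; lia.
  apply: (residue_bound norm_cof l0 kxW kyW Firr sF Fdeg abd Flead pp
    (residues pp Np) _ sg) => //.
  - by rewrite filter_uniq.
  - move=> P; rewrite mem_filter => /andP[/asboolP gP PT].
    have [FP Pb] := TP _ PT; split=> //; apply: val_inj.
    by rewrite bg FP mulr0.
  rewrite sE; set S0 := (\sum_(v <- _) _)%N.
  have S0le : (2 * S0 <= d * M * (M + d))%N.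
    by have := sum_hook_exponents a b M; rewrite abd.
  apply: leq_ltn_trans (_ : l ^ (n + W * S0) < _)%N.
    have sl : (s`! <= l)%N by lia.
    rewrite expnD leq_mul //.
    by case: (posnP n) => [->|n0]; rewrite ?expn0 // leq_exp2r.
  apply: leq_trans (_ : l ^ (e * ('C(s, 2) * n)) <= _)%N.
    rewrite ltn_exp2l //; have := bin2_double s; rewrite -/s in num.
    move: num S0le; move: ('C(s, 2)) => c2; nia.
  rewrite expnM; move: lep; rewrite expnM -/l => lep.
  by case: (posnP ('C(s, 2) * n)) => [->|n0]; rewrite ?expn0 // leq_exp2r.
(* In characteristic 0 the derivative in y is nonzero; having smaller degree in y than [F], it is no
   multiple of [F], and Bezout's bound applies to their common zeros. *)
have bound_bad : (count bad T <= Bz)%N.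
  rewrite -size_filter.
  have F'0 : F^`() != 0.
    apply/eqP => /(congr1 (fun p : {poly {poly K}} => p`_(size F).-2)).
    rewrite coef_deriv coef0 prednK; last by move: sF; case: (size F) => [|[]].
    move/eqP; rewrite -lead_coefE -mulr_natr mulf_eq0 lead_coef_eq0.
    case: Firr => [/negPf -> _ _] /=; rewrite -polyC_natr polyC_eq0.
    rewrite -(rmorph_nat (in_alg K)) fmorph_eq0 pnatr_eq0.
    by move: sF; case: (size F) => [|[]].
  have nF' : ~ exists h, F^`() = F * h.
    move=> [h hE]; have h0 : h != 0 by apply: contraNneq F'0 => h0; rewrite hE h0 mulr0.
    have F0 : F != 0 by case: Firr.
    have := lt_size_deriv F0; rewrite hE size_mul // ltnNge => /negP; apply.
    by rewrite -size_poly_gt0 in h0; rewrite -(prednK h0) addnS leq_addr.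
  apply: (vanishing_bound Firr sF Fdeg nF').
  - move=> i j; rewrite coef_deriv coefMn => ne.
    have /Fdeg : F`_j.+1`_i != 0 by apply: contraNneq ne => ->; rewrite mul0rn.
    by lia.
  - by rewrite filter_uniq.
  - move=> P; rewrite mem_filter => /andP[/eqP badP PT].
    have [FP _] := TP _ PT; split=> //; apply: (mulfI c0).
    by rewrite -bg' badP rmorph0 mulr0.
apply: leq_trans (size_leq_cover cov) _.
apply: leq_trans (leq_add bound_bad (_ : _ <= E.+1 * (2 ^ (k * e.+1 * n) * (d ^ n * Bz)))%N) _.
  rewrite -sps; elim: (ps) bound_good => [|p ps' IH] bg2; first by rewrite big_nil.
  rewrite big_cons mulSn leq_add ?bg2 ?mem_head //; apply: IH => p' pp'.
  by apply: bg2; rewrite in_cons pp' orbT.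
rewrite mulnDl leq_add //; last by apply: eq_leq; ring.
by rewrite mul2n -addnn mulnDl (leq_trans _ (leq_addr _ _)) // leq_pmulr.
Qed.

End BoxBound.

(** * Heights of integers *)

Section PrimeIdeals.
Variable K : fieldExtType rat.
Implicit Types (P T : set K) (x y z : K) (s t : seq (set K)).

Lemma ring_of_integersE x : ring_of_integers x <-> x \in integers K.
Proof. by split => [h|/integersP//]; apply/integersP. Qed.

Lemma ideal_mul_sub P I J : is_ideal P ->
  (forall x y, I x -> J y -> P (x * y)) -> ideal_mul I J `<=` P.
Proof.
move=> [_ P0 PD _] IJ _ [s sIJ ->]; rewrite big_seq.
apply: (big_ind P) => // u /sIJ[Iu Ju]; exact: IJ.
Qed.

Lemma ring_of_integers_ideal : is_ideal (@ring_of_integers K).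
Proof.
split=> // [|x y|a x].
- by apply/ring_of_integersE; rewrite rpred0.
- by move=> /ring_of_integersE xi /ring_of_integersE yi; apply/ring_of_integersE; rewrite rpredD.
- by move=> /ring_of_integersE xi /ring_of_integersE yi; apply/ring_of_integersE; rewrite rpredM.
Qed.

Lemma ideal_prod_integers s : {in s, forall P, is_prime_ideal P} ->
  ideal_prod s `<=` @ring_of_integers K.
Proof.
elim: s => [_ x xO|P s IH sP /=]; first exact: xO.
apply: (ideal_mul_sub ring_of_integers_ideal) => x y Px sy.
have [[PO _ _ _] _ _ _] := sP P (mem_head _ _).
have [_ _ _ OM] := ring_of_integers_ideal; apply: OM; first exact: PO.
by apply: IH sy => Q Qs; apply: sP; rewrite in_cons Qs orbT.
Qed.

Lemma ideal_prod_sub s P : {in s, forall Q, is_prime_ideal Q} -> P \in s ->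
  ideal_prod s `<=` P.
Proof.
elim: s => [_|Q s IH sP]; first by rewrite in_nil.
rewrite in_cons /= => /predU1P[PQ|Ps].
  have [Qi _ _ _] := sP Q (mem_head _ _); rewrite PQ.
  apply: (ideal_mul_sub Qi) => x y Qx sy; have [_ _ _ QM] := Qi.
  rewrite mulrC; apply: QM Qx; apply: ideal_prod_integers sy => R Rs.
  by apply: sP; rewrite in_cons Rs orbT.
have [Pi _ _ _] := sP P (mem_behead (s := Q :: s) Ps).
apply: (ideal_mul_sub Pi) => x y Qx sy; have [_ _ _ PM] := Pi; apply: PM.
  by have [[QO _ _ _] _ _ _] := sP Q (mem_head _ _); exact: QO.
by apply: IH sy => // R Rs; apply: sP; rewrite in_cons Rs orbT.
Qed.

(** If the first ideal has an element outside [P], multiplying by it takes the product of the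
    remaining ideals into [P], so primality puts that product inside [P]. *)
Lemma prime_ideal_prod s P : is_prime_ideal P ->
  {in s, forall Q, is_prime_ideal Q} -> ideal_prod s `<=` P ->
  exists2 Q, Q \in s & Q `<=` P.
Proof.
move=> Pp; have [Pi _ P1 PM] := Pp; elim: s => [_ OP|Q s IH sQ QsP].
  by case: P1; apply: OP; apply/ring_of_integersE; rewrite rpred1.
have sQ' : {in s, forall Q, is_prime_ideal Q}.
  by move=> R Rs; apply: sQ; rewrite in_cons Rs orbT.
have [QP|/existsNP[a /not_implyP[Qa nPa]]] := pselect (Q `<=` P).
  by exists Q => //; exact: mem_head.
have [R Rs RP] : exists2 R, R \in s & R `<=` P.
  apply: (IH sQ') => b sb; have := PM a b; case=> //.
  - by have [[QO _ _ _] _ _ _] := sQ Q (mem_head _ _); exact: QO.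
  - exact: (ideal_prod_integers sQ' sb).
  - apply: QsP; exists [:: (a, b)]; last by rewrite big_seq1.
    by move=> u; rewrite mem_seq1 => /eqP ->.
by exists R => //; rewrite in_cons Rs orbT.
Qed.

(** A nonzero element of [T] has a nonzero integer multiple in [T], and primality extracts a prime
    factor of it. *)
Lemma prime_ideal_int T : is_prime_ideal T -> exists2 p : nat, prime p & T p%:R.
Proof.
move=> [[TO T0 TD TM] [t Tt t0] T1 Tp].
have Oint (z : int) : ring_of_integers (z%:~R : K).
  by apply/ring_of_integersE; rewrite rpred_int.
have ti : t \in integers K by apply/ring_of_integersE; exact: TO.
have [z z0 [w wi tw]] := integers_cofactor ti t0.
have Tz : T z%:~R by rewrite -tw mulrC; apply: TM => //; apply/ring_of_integersE.
have : T (`|z|%N%:R).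
  have -> : (`|z|%N%:R : K) = (Num.sg z)%:~R * z%:~R.
    by rewrite pmulrn abszE normrEsg intrM.
  exact: TM.
have : (0 < `|z|)%N by rewrite absz_gt0.
have [m] := ubnP (`|z|)%N; move: (`|z|)%N => k; elim: m k => // m IH k km k0 Tk.
have [k1|k1] := eqVneq k 1%N; first by case: T1; rewrite -[1]/(1%:R) -k1.
have pk : prime (pdiv k) by apply: pdiv_prime; lia.
have kE : k = (pdiv k * (k %/ pdiv k))%N by rewrite mulnC divnK ?pdiv_dvd.
move: Tk; rewrite kE natrM => /Tp[]; rewrite ?pmulrn //.
  by exists (pdiv k).
rewrite -pmulrn; apply: IH.
  by apply: leq_trans (ltn_Pdiv (prime_gt1 pk) k0) _; rewrite -ltnS.
by rewrite divn_gt0 ?prime_gt0 // dvdn_leq // pdiv_dvd.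
Qed.

(** [T] and [P] contain the same integers, namely the multiples of a prime. For a in [P] with h(a)
    in [T], h monic, write h(a) = a g(a) + h_0: then h_0 lies in [P], hence in [T], and so does a
    g(a). Either a is in [T] or g(a) is, with g monic of smaller degree; the descent cannot reach
    the constant 1. *)
Lemma prime_ideal_maximal T P : is_prime_ideal T -> is_prime_ideal P ->
  T `<=` P -> T = P.
Proof.
move=> Tp Pp TP; apply/seteqP; split=> // a Pa.
have [p pp Tpp] := prime_ideal_int Tp.
have [[TO T0 TD TM] _ T1 TM2] := Tp; have [[PO P0 PD PM] _ P1 _] := Pp.
have Oint (z : int) : ring_of_integers (z%:~R : K).
  by apply/ring_of_integersE; rewrite rpred_int.
have intT (c : int) : P c%:~R -> T c%:~R.
  move=> Pc; have [/dvdzP[k ->]|npc] := boolP (p %| c)%Z.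
    by rewrite rmorphM; exact: (TM _ _ (Oint k) Tpp).
  have /coprimezP[[u v] /= uv] : coprimez c p.
    by rewrite /coprimez /gcdz /= eqz_nat -/(coprime _ _) coprime_sym prime_coprime.
  case: P1; rewrite -[1]/(1%:~R) -uv rmorphD !rmorphM /=.
  apply: PD; first exact: (PM _ _ (Oint u) Pc).
  exact: (PM _ _ (Oint v) (TP _ Tpp)).
have ai : a \in integers K by apply/ring_of_integersE; exact: PO.
have [h hm ha] := integersP _ ai.
have : T (map_poly intr h).[a] by rewrite (rootP ha).
have [m] := ubnP (size h); elim: m h hm {ha} => // m IH h hm hlt Th.
have hE : h = (drop_poly 1 h) * 'X + (h`_0)%:P.
  rewrite -{1}(poly_take_drop 1 h) addrC expr1; congr (_ + _).
  by apply/polyP => i; rewrite coef_take_poly coefC; case: i.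
have evE : (map_poly intr h).[a] =
    a * (map_poly intr (drop_poly 1 h)).[a] + (h`_0)%:~R.
  rewrite {1}hE rmorphD rmorphM /= map_polyX map_polyC hornerD hornerMX hornerC.
  by rewrite mulrC.
have di : ring_of_integers (map_poly intr (drop_poly 1 h)).[a].
  apply/ring_of_integersE; rewrite horner_poly; apply: rpred_sum => i _.
  by rewrite rpredM ?rpredX // rpred_int.
have Th0 : T (h`_0)%:~R.
  apply: intT; have -> : (h`_0)%:~R = (map_poly intr h).[a] +
     (- (map_poly intr (drop_poly 1 h)).[a]) * a.
    by rewrite evE mulNr mulrC addrAC subrr add0r.
  apply: PD; first exact: TP.
  by apply: PM => //; apply/ring_of_integersE; rewrite rpredN; apply/ring_of_integersE.
have Tad : T (a * (map_poly intr (drop_poly 1 h)).[a]).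
  have -> : a * (map_poly intr (drop_poly 1 h)).[a] =
     (map_poly intr h).[a] + (-1)%:~R * (h`_0)%:~R.
    by rewrite evE mulN1r addrK.
  by apply: TD => //; exact: TM.
have [h1|h1] := leqP (size h) 1.
  case: T1; move: hm; rewrite monicE lead_coefE.
  have -> : (size h).-1 = 0%N by move: h1; case: (size h) => [|[]].
  by move=> /eqP h01; rewrite h01 in Th0.
have [|//|Td] := TM2 _ _ _ di Tad; first exact: PO.
apply: IH Td.
  rewrite monicE lead_coefE size_drop_poly coef_drop_poly.
  by rewrite subn1 addn1 prednK ?lead_coefE -?lead_coefE //; move: h1; case: (size h) => [|[]].
by rewrite size_drop_poly; move: h1 hlt; case: (size h) => [|k] //; rewrite subn1.
Qed.

(** The argument applies to whichever factorization is selected. If [P] occurred in the denominator,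
    the product of the numerator would lie in [P], so one of its primes would be contained in [P]
    and hence equal to it, although the two lists are disjoint. *)
Lemma prime_val_ge0 P x : is_prime_ideal P -> x \in integers K -> 0 <= prime_val P x.
Proof.
move=> Pp xi; rewrite /prime_val; case: xgetP => // k _ [t [s [[tp sp ts xst] ->]]].
have [Ps|Pns] := boolP (P \in s); last first.
  by rewrite (count_memPn Pns) subr0.
have tsub : ideal_prod t `<=` P.
  rewrite -xst; have [Pi _ _ _] := Pp; apply: (ideal_mul_sub Pi) => _ y [a Oa <-] sy.
  have [_ _ _ PM] := Pi; apply: PM; last exact: (ideal_prod_sub sp Ps).
  apply/ring_of_integersE; rewrite rpredM //; exact/ring_of_integersE.
have [Q Qt QP] := prime_ideal_prod Pp tp tsub.
have QE := prime_ideal_maximal (tp Q Qt) Pp QP.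
by have := ts Q Qt; rewrite QE Ps.
Qed.

Lemma prime_abs_le1 (R : realType) P x : is_prime_ideal P -> x \in integers K ->
  prime_abs R P x <= 1.
Proof.
move=> Pp xi; rewrite /prime_abs; case: ifP => // _.
(* At the default value 0 of [residue_char], the power is 0 or 1. *)
have [->|p0] := posnP (residue_char P).
  have [->|e0] := eqVneq (- (prime_val P x)%:~R / (ramification_index P)%:~R : R) 0.
    by rewrite powRr0.
  by rewrite powR0.
rewrite -[leRHS](powRr0 (residue_char P)%:R); apply: ler_powR; first by rewrite ler1n.
rewrite mulNr oppr_le0 divr_ge0 // ler0z prime_val_ge0 //.
by rewrite rpred_nat.
Qed.

End PrimeIdeals.

(** * Archimedean places and their local degrees *)

Section ArchimedeanPlaces.
Variables (R : realType) (K : fieldExtType rat).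
Local Notation C := (complex R).
Local Open Scope complex_scope.

Definition modulus (z : C) : R := complex.Re `|z|.

Lemma modulusE z : (modulus z)%:C = `|z|.
Proof. by rewrite /modulus RRe_real // normr_real. Qed.

Lemma modulus_ge0 z : 0 <= modulus z.
Proof. by rewrite -ler0c modulusE. Qed.

Lemma modulusM z w : modulus (z * w) = modulus z * modulus w.
Proof. by apply: complexI; rewrite rmorphM /= !modulusE normrM. Qed.

Lemma modulusD z w : modulus (z + w) <= modulus z + modulus w.
Proof. by rewrite -lecR rmorphD /= !modulusE ler_normD. Qed.

Lemma modulusN z : modulus (- z) = modulus z.
Proof. by rewrite /modulus normrN. Qed.

Lemma modulus0 : modulus 0 = 0. Proof. by rewrite /modulus normr0. Qed.
Lemma modulus1 : modulus 1 = 1. Proof. by rewrite /modulus normr1. Qed.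

Lemma modulus_real (r : R) : modulus r%:C = `|r|.
Proof.
apply: complexI; rewrite modulusE.
have [r0|r0] := leP 0 r; first by rewrite !ger0_norm ?ler0c.
have -> : r%:C = - (- r)%:C by rewrite rmorphN opprK.
by rewrite (ltr0_norm r0) normrN ger0_norm // ler0c oppr_ge0 ltW.
Qed.

Lemma modulus_sum (I : finType) (F : I -> C) :
  modulus (\sum_i F i) <= \sum_i modulus (F i).
Proof.
rewrite -lecR rmorph_sum modulusE; apply: le_trans (ler_norm_sum _ _ _) _.
by apply: ler_sum => i _; rewrite -modulusE.
Qed.

Lemma modulus_sqr z : modulus z ^+ 2 = complex.Re z ^+ 2 + complex.Im z ^+ 2.
Proof.
rewrite /modulus normc_def /= sqr_sqrtr //.
by rewrite addr_ge0 ?sqr_ge0.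
Qed.

Lemma Im_le_modulus z : `|complex.Im z| <= modulus z.
Proof.
rewrite -(@ler_pXn2r _ 2) ?nnegrE ?modulus_ge0 ?normr_ge0 //.
by rewrite modulus_sqr real_normK ?num_real // lerDr sqr_ge0.
Qed.

Lemma rat_dense (x e : R) : 0 < e -> exists q : rat, `|x - ratr q| < e.
Proof.
move=> e0; have lt : x - e < x + e by lra.
have [q] := rat_in_itvoo lt; rewrite in_itv /= => /andP[h1 h2].
by exists q; rewrite ltr_norml; apply/andP; split; lra.
Qed.

Lemma is_nullP (v : K -> R) (u : nat -> K) : is_null v u <->
  forall e, 0 < e -> exists N, forall k, (N <= k)%N -> `|v (u k)| < e.
Proof.
rewrite /is_null; split.
  move=> /cvgrPdist_lt h e /h [N _ NP]; exists N => k Nk.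
  by have := NP k Nk; rewrite /= sub0r normrN.
move=> h; apply/cvgrPdist_lt => e /h[N NP]; exists N => // k Nk /=.
by rewrite sub0r normrN; exact: NP.
Qed.

Section Place.
Variable sigma : {rmorphism K -> C}.
Local Notation v := (arch_abs sigma).

Lemma arch_absE x : v x = modulus (sigma x). Proof. by []. Qed.

Lemma arch_absD x y : v (x + y) <= v x + v y.
Proof. by rewrite !arch_absE rmorphD modulusD. Qed.

Lemma arch_absN x : v (- x) = v x.
Proof. by rewrite !arch_absE rmorphN modulusN. Qed.

Lemma sigma_ratr (c : rat) : sigma (ratr c) = (ratr c : R)%:C.
Proof.
rewrite -alg_num_field rmorphZ_num rmorph1 mulr1.
by rewrite -(fmorph_rat (real_complex R)).
Qed.

Lemma sigma_ratrM (c : rat) x : sigma (ratr c * x) = (ratr c : R)%:C * sigma x.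
Proof. by rewrite rmorphM sigma_ratr. Qed.

Lemma arch_abs_ratr (c : rat) : v (ratr c) = `|ratr c : R|.
Proof. by rewrite arch_absE sigma_ratr modulus_real. Qed.

(** The hypotheses say that the images of the [a i] span the image of the field over the reals, with
    coordinates controlled by the modulus. Real coordinates are approximated by rational ones; the
    control by [kappa] makes these Cauchy sequences and gives independence. *)
Lemma local_basis_of_coordinates n (a : 'I_n -> K) (kappa : R) : 0 < kappa ->
  (forall y, exists r : 'I_n -> R, sigma y = \sum_i (r i)%:C * sigma (a i)) ->
  (forall (r : 'I_n -> R) i,
     `|r i| <= kappa * modulus (\sum_j (r j)%:C * sigma (a j))) ->
  is_local_basis v (fun i (_ : nat) => a i).
Proof.
move=> k0 span stable.
have vsum (c : 'I_n -> rat) :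
    v (\sum_i ratr (c i) * a i) = modulus (\sum_i (ratr (c i) : R)%:C * sigma (a i)).
  by rewrite arch_absE rmorph_sum; congr modulus; apply: eq_bigr => i _; rewrite rmorphM sigma_ratr.
pose S := 1 + \sum_i modulus (sigma (a i)).
have S0 : 0 < S.
  by rewrite ltr_pwDl // sumr_ge0 // => i _; exact: modulus_ge0.
split.
- move=> i e e0; exists 0%N => m m' _ _.
  by rewrite subrr arch_absE rmorph0 modulus0.
- move=> u ucauchy.
  have approx k : exists c : 'I_n -> rat,
      v (u k - \sum_i ratr (c i) * a i) <= k.+1%:R^-1.
    have [r rE] := span (u k).
    have e0 : 0 < k.+1%:R^-1 / S by rewrite divr_gt0 // invr_gt0 ltr0n.
    have [c cE] := boolp.choice (fun i => rat_dense (r i) e0).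
    exists c; rewrite arch_absE rmorphB rmorph_sum rE -sumrB.
    apply: le_trans (modulus_sum _) _.
    apply: (@le_trans _ _ (\sum_i k.+1%:R^-1 / S * modulus (sigma (a i)))).
      apply: ler_sum => i _; rewrite rmorphM sigma_ratr -mulrBl -rmorphB modulusM.
      by rewrite modulus_real ler_wpM2r ?modulus_ge0 // ltW.
    rewrite -mulr_sumr -mulrA ler_piMr ?invr_ge0 ?ler0n //.
    by rewrite mulrC ler_pdivrMr // mul1r /S lerDr.
  have [c cE] := boolp.choice approx.
  have small e : 0 < e -> exists N, forall k, (N <= k)%N -> (k.+1%:R^-1 : R) < e.
    move=> e0; have [N _ NP] := near_infty_natSinv_lt (PosNum e0).
    by exists N => k Nk; exact: NP.
  exists (fun i k => c k i); split.
    move=> i e e0; have e1 : 0 < e / kappa / 3 by rewrite !divr_gt0.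
    have [N1 N1P] := ucauchy _ e1; have [N2 N2P] := small _ e1.
    exists (maxn N1 N2) => m m'; rewrite !geq_max => /andP[m1 m2] /andP[m1' m2'].
    rewrite -alg_num_field -[X in _ - X]alg_num_field -scalerBl alg_num_field arch_abs_ratr.
    have := stable (fun i => ratr (c m i - c m' i)) i.
    rewrite -(vsum (fun i => c m i - c m' i)).
    have -> : \sum_i ratr (c m i - c m' i) * a i =
       (\sum_i ratr (c m i) * a i - u m) + (u m - u m') + (u m' - \sum_i ratr (c m' i) * a i).
      rewrite [RHS](_ : _ = \sum_i ratr (c m i) * a i - \sum_i ratr (c m' i) * a i); last by ring.
      rewrite -sumrB; apply: eq_bigr => j _.
      by rewrite -!alg_num_field scalerBl mulrBl.
    move=> /le_lt_trans; apply; rewrite mulrC -ltr_pdivlMr //.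
    apply: le_lt_trans (arch_absD _ _) _.
    apply: le_lt_trans (lerD (arch_absD _ _) (lexx _)) _.
    have h1 := le_lt_trans (cE m) (N2P _ m2).
    have h2 := le_lt_trans (cE m') (N2P _ m2').
    have h3 := N1P _ _ m1 m1'.
    by rewrite -[X in v X + _ + _]opprB arch_absN; lra.
  apply/is_nullP => e e0; have [N NP] := small _ e0; exists N => k Nk.
  by rewrite ger0_norm ?modulus_ge0 //; exact: le_lt_trans (cE k) (NP k Nk).
- move=> c _ /is_nullP cnull i; apply/is_nullP => e e0.
  have [N NP] := cnull _ (divr_gt0 e0 k0); exists N => k Nk.
  rewrite arch_abs_ratr normr_id; apply: le_lt_trans (stable (fun i => ratr (c i k)) i) _.
  rewrite -vsum mulrC -ltr_pdivlMr //.
  by apply: le_lt_trans (NP k Nk); rewrite ler_norm.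
Qed.

(** A basis is 1 for a real embedding, and otherwise 1 with an element of nonreal image. Hence
    [local_degree] is the size of an actual basis, not a default value. *)
Lemma exists_local_basis : exists n, exists b : 'I_n -> nat -> K, is_local_basis v b.
Proof.
have [[a ima]|/boolp.forallNP real] :=
    boolp.pselect (exists y, complex.Im (sigma y) != 0); last first.
  have re y : sigma y = (complex.Re (sigma y))%:C.
    have /negP/negPn/eqP im0 := real y.
    by rewrite {1}[sigma y]complexE im0 mulr0 addr0.
  exists 1%N, (fun i (_ : nat) => 1).
  apply: (@local_basis_of_coordinates 1 (fun=> 1) 1) => //.
    by move=> y; exists (fun=> complex.Re (sigma y)); rewrite big_ord1 rmorph1 mulr1.
  by move=> r i; rewrite big_ord1 rmorph1 mulr1 modulus_real mul1r ord1.
set w := sigma a in ima.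
pose b (i : 'I_2) := if i == ord0 then 1 : K else a.
have sumE (r : 'I_2 -> R) :
    \sum_i (r i)%:C * sigma (b i) = (r ord0)%:C + (r (lift ord0 ord0))%:C * w.
  by rewrite big_ord_recl big_ord1 /b /= rmorph1 mulr1.
exists 2%N, (fun i (_ : nat) => b i).
pose I := `|complex.Im w|; have I0 : 0 < I by rewrite normr_gt0.
(* The imaginary part bounds the second coordinate by |z|/I, and then the first one is at most |z| +
   |w| |z|/I. *)
pose kappa := 1 + (1 + modulus w) / I.
have kappa0 : 0 < kappa.
  by rewrite ltr_pwDl // divr_ge0 ?addr_ge0 ?modulus_ge0 // ltW.
apply: (local_basis_of_coordinates kappa0).
  move=> y; case: (sigma y) => s1 s2; pose t := s2 / complex.Im w.
  exists (fun i => if i == ord0 then s1 - t * complex.Re w else t).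
  rewrite sumE /= /t; case: (w) ima => [w1 w2] /= w20.
  apply/eqP; rewrite eq_complex /= !mul0r !add0r !subr0 addr0 subrK eqxx /=.
  by rewrite divfK.
move=> r i; rewrite sumE; set z := _ + _.
have imz : complex.Im z = r (lift ord0 ord0) * complex.Im w.
  by rewrite /z; case: (w) => w1 w2 /=; rewrite mul0r addr0 add0r.
have r1le : `|r (lift ord0 ord0)| <= modulus z / I.
  by rewrite ler_pdivlMr // /I -normrM -imz Im_le_modulus.
have r0le : `|r ord0| <= modulus z + modulus w * (modulus z / I).
  rewrite -(modulus_real (r ord0)).
  have -> : (r ord0)%:C = z - (r (lift ord0 ord0))%:C * w by rewrite /z addrK.
  apply: le_trans (modulusD _ _) _; rewrite modulusN modulusM modulus_real lerD2l.
  by rewrite mulrC ler_wpM2l // modulus_ge0.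
have zI : 0 <= modulus z / I by rewrite divr_ge0 ?modulus_ge0 // ltW.
have wzI : 0 <= modulus w * (modulus z / I) by rewrite mulr_ge0 // modulus_ge0.
have -> : kappa * modulus z = modulus z + (modulus z / I) + modulus w * (modulus z / I).
  by rewrite /kappa; ring.
have z0 := modulus_ge0 z.
have [->|->] : i = ord0 \/ i = lift ord0 ord0.
  by case: i => [[|[|]]] // lt; [left|right]; exact: val_inj.
  by move: r0le; lra.
by move: r1le; lra.
Qed.

Lemma local_degree_basis : exists b : 'I_(local_degree v) -> nat -> K, is_local_basis v b.
Proof. exact: (xgetPex 0%N exists_local_basis). Qed.

Lemma const_cauchy y : is_cauchy v (fun _ : nat => y).
Proof.
by move=> e e0; exists 0%N => m m' _ _; rewrite subrr arch_absE rmorph0 modulus0.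
Qed.

Lemma local_degree_gt0 : (0 < local_degree v)%N.
Proof.
have [b [_ span _]] := local_degree_basis; rewrite lt0n; apply/eqP => n0.
have [c [_ /is_nullP/(_ 1 ltr01)[N]]] := span _ (const_cauchy 1).
move=> /(_ N (leqnn N)); rewrite big1; last first.
  by move=> i _; have : (i < 0)%N by apply: leq_trans (ltn_ord i) _; rewrite n0.
by rewrite subr0 arch_absE rmorph1 modulus1 normr1 ltxx.
Qed.

(** With a one-element basis, 1 and [y] would be close to rational multiples g b and g' b of the
    same element. Then b (g' - g sigma(y)) would be small, although its modulus is at least |g b|
    |Im sigma(y)| with |g b| close to 1. *)
Lemma local_degree_gt1 y : complex.Im (sigma y) != 0 -> (1 < local_degree v)%N.
Proof.
move=> im0; have := local_degree_gt0; rewrite leq_eqVlt => /predU1P[n1|//].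
have [b [_ span _]] := local_degree_basis.
pose I := `|complex.Im (sigma y)|; have I0 : 0 < I by rewrite normr_gt0.
pose Z := modulus (sigma y); have Z0 : 0 <= Z := modulus_ge0 _.
have den0 : 0 < 2 * (1 + Z + I) by rewrite mulr_gt0 // addr_gt0 // ltr_pwDl.
(* Chosen so that eta (1 + Z + I) = I/2, against the inequality (1 - eta) I <= eta (1 + Z) derived
   below. *)
pose eta := I / (2 * (1 + Z + I)); have eta0 : 0 < eta by rewrite divr_gt0.
have i0 : 'I_(local_degree v) by rewrite -n1; exact: ord0.
have sum1 (F : 'I_(local_degree v) -> K) : \sum_i F i = F i0.
  have lt1 (i : 'I_(local_degree v)) : (i < 1)%N.
    by apply: leq_trans (ltn_ord i) _; rewrite n1.
  rewrite (bigD1 i0) //= big1 ?addr0 // => i; rewrite -val_eqE /=.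
  by move: (lt1 i) (lt1 i0); rewrite !ltnS !leqn0 => /eqP -> /eqP ->.
have [c [_ /is_nullP/(_ _ eta0)[N NP]]] := span _ (const_cauchy 1).
have [c' [_ /is_nullP/(_ _ eta0)[N' NP']]] := span _ (const_cauchy y).
pose k := maxn N N'.
have := NP k (leq_maxl _ _); have := NP' k (leq_maxr _ _).
rewrite !sum1 !arch_absE !ger0_norm ?modulus_ge0 // !rmorphB rmorph1 !sigma_ratrM.
set beta := sigma (b i0 k); set g := ratr (c i0 k); set g' := ratr (c' i0 k).
move=> h' h; exfalso.
have le1 : modulus (beta * (g'%:C - g%:C * sigma y)) <= eta + Z * eta.
  have -> : beta * (g'%:C - g%:C * sigma y) =
     - (sigma y - g'%:C * beta) + sigma y * (1 - g%:C * beta) by ring.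
  apply: le_trans (modulusD _ _) _; rewrite modulusN modulusM.
  by apply: lerD; [exact: ltW|apply: ler_wpM2l => //; exact: ltW].
have le2 : (1 - eta) * I <= modulus (beta * (g'%:C - g%:C * sigma y)).
  rewrite modulusM.
  apply: (@le_trans _ _ (modulus beta * (`|g| * I))); last first.
    rewrite ler_wpM2l ?modulus_ge0 // /I -normrM.
    apply: le_trans (Im_le_modulus _); case: (sigma y) => y1 y2 /=.
    by rewrite mul0r addr0 add0r normrN.
  rewrite mulrA ler_wpM2r ?(ltW I0) //.
  have : modulus 1 <= modulus (1 - g%:C * beta) + modulus (g%:C * beta).
    by apply: le_trans (modulusD _ _); rewrite subrK.
  rewrite modulus1 modulusM modulus_real; move: h; lra.
have : eta * (1 + Z + I) = I / 2.
  by rewrite /eta; field; apply: lt0r_neq0; lra.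
by move: le1 le2; nra.
Qed.

End Place.
End ArchimedeanPlaces.

(** * The height bounds the product of the conjugates *)

Section HeightBound.
Variables (R : realType) (K : fieldExtType rat) (n : nat).
Local Notation C := (complex R).
Variable sigma : 'I_n -> {rmorphism K -> C}.
Variable theta : K.
Hypothesis sigma_inj : injective (fun i => sigma i theta).
Hypothesis sigma_all : forall tau : {rmorphism K -> C}, exists i, tau =1 sigma i.

(** Comparing the moduli at [y] and at [y + 1] gives the real part, and then the imaginary part up
    to sign. *)
Lemma arch_abs_eq_conj (s t : {rmorphism K -> C}) y : arch_abs s = arch_abs t ->
  complex.Re (s y) = complex.Re (t y) /\
  (complex.Im (s y) = complex.Im (t y) \/ complex.Im (s y) = - complex.Im (t y)).
Proof.
move=> E; have sq x : modulus (s x) ^+ 2 = modulus (t x) ^+ 2.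
  by have := congr1 (fun v => v x ^+ 2) E.
have := sq y; have := sq (y + 1); rewrite !modulus_sqr !rmorphD !rmorph1.
case: (s y) (t y) => [a b] [a' b'] /=; rewrite !addr0 => h1 h2.
have aa : a = a' by nra.
split=> //; have /eqP : b ^+ 2 = b' ^+ 2 by move: h2; rewrite aa; lra.
by rewrite eqf_sqr => /orP[/eqP ->|/eqP ->]; [left|right].
Qed.

(** Each [sigma i] is known by its value at [theta], which is that of [sigma i0] or its conjugate:
    one possibility if it is real, two otherwise, which matches the lower bounds for the local
    degree. *)
Lemma card_arch_fiber i0 :
  (#|[pred i | arch_abs (sigma i) == arch_abs (sigma i0)]| <= local_degree (arch_abs (sigma i0)))%N.
Proof.
set A := [pred i | _]; set z := sigma i0 theta.
have bound (s : seq C) : {in A, forall i, sigma i theta \in s} -> (#|A| <= size s)%N.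
  move=> As; rewrite cardE -(size_map (fun i => sigma i theta)); apply: uniq_leq_size.
    by rewrite map_inj_uniq // enum_uniq.
  by move=> _ /mapP[i iA ->]; apply: As; rewrite mem_enum in iA.
have [im0|im0] := eqVneq (complex.Im z) 0.
  apply: leq_trans (bound [:: z] _) (local_degree_gt0 _) => i iA.
  have /eqP E : arch_abs (sigma i) == arch_abs (sigma i0) := iA.
  have [re im] := arch_abs_eq_conj theta E.
  rewrite mem_seq1; apply/eqP; move: re im im0; rewrite /z.
  by case: (sigma i theta) (sigma i0 theta) => [a b] [a' b'] /= -> [] -> ->; rewrite ?oppr0.
apply: leq_trans (bound [:: z; (conjc z)%C] _) (local_degree_gt1 im0) => i iA.
have /eqP E : arch_abs (sigma i) == arch_abs (sigma i0) := iA.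
  have [re im] := arch_abs_eq_conj theta E.
rewrite in_cons mem_seq1; move: re im im0; rewrite /z.
case: (sigma i theta) (sigma i0 theta) => [a b] [a' b'] /= -> [] -> _.
  by rewrite eqxx.
by rewrite eqxx orbT.
Qed.

(** An integer contributes the factor 1 at a finite place, and the local degree of an Archimedean
    place is at least the number of embeddings that induce it. *)
Lemma height_ge x : x \in integers K ->
  \prod_i Num.max 1 (modulus (sigma i x)) <= height R x.
Proof.
move=> xi; pose v i := arch_abs (sigma i).
pose A : set (K -> R) := range v.
have fA : finite_set A by apply: finite_image; exact: finite_finset.
rewrite /height -(fsbig_widen A (@places R K)); last 2 first.
- by move=> _ [i _ <-]; left; exists (sigma i).
- move=> w [[[tau wE]|[P Pp wE]] nA].
    have [i iE] := sigma_all tau; case: nA; exists i => //.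
    by rewrite wE; apply/funext => y; rewrite /v /arch_abs iE.
  apply/max_idPl; rewrite wE exprn_ile1 ?prime_abs_le1 //.
  by rewrite /prime_abs; case: ifP => // _; exact: powR_ge0.
rewrite fsbig_finite //=.
have vA i : v i \in fset_set A by rewrite in_fset_set // inE; exists i.
have -> : \prod_i Num.max 1 (modulus (sigma i x)) =
  \prod_(w <- fset_set A) \prod_(i | v i == w) Num.max 1 (modulus (sigma i x)).
  rewrite (exchange_big_dep predT) //=; apply: eq_bigr => i _.
  rewrite (eq_bigl (pred1 (v i))); last by move=> w; rewrite /= eq_sym.
  rewrite big_mkcond (bigD1_seq (v i) (vA i) (fset_uniq _)) /=.
  case: ifP => [_|/eqP//]; rewrite big1 ?mulr1 // => w.
  by move=> /negPf ->.
rewrite big_seq [leRHS]big_seq; apply: ler_prod => w.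
rewrite in_fset_set // inE => -[i0 _ <-]; apply/andP; split.
  by apply: prodr_ge0 => i _; rewrite le_max ler01.
apply: (@le_trans _ _ (Num.max 1 (v i0 x) ^+ #|[pred i | v i == v i0]|)).
  rewrite -prodr_const; apply: ler_prod => i.
  by move=> /eqP <-; rewrite lexx le_max ler01.
apply: (@le_trans _ _ (Num.max 1 (v i0 x) ^+ local_degree (v i0))).
  by rewrite ler_weXn2l ?le_max ?lexx // card_arch_fiber.
have [le1|lt1] := leP (v i0 x) 1; first by rewrite expr1n le_max lexx.
by rewrite le_max lexx orbT.
Qed.

End HeightBound.

(** * From multivariate to bivariate polynomials *)

Lemma irreducible_bipoly_swap (L : fieldType) (f : {poly {poly L}}) :
  irreducible_bipoly f -> irreducible_bipoly (swapXY f).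
Proof.
have unitS (g : {poly {poly L}}) : g \is a GRing.unit -> swapXY g \is a GRing.unit.
  move=> /unitrPr[h gh]; apply/unitrPr; exists (swapXY h).
  by rewrite -rmorphM gh rmorph1.
have unitE (g : {poly {poly L}}) :
    (swapXY g \is a GRing.unit) = (g \is a GRing.unit).
  by apply/idP/idP => [/unitS|/unitS //]; rewrite swapXYK.
move=> [f0 fu firr].
split; rewrite ?swapXY_eq0 ?unitE // => g h gh.
have := congr1 (@swapXY L) gh; rewrite swapXYK rmorphM => /firr.
by rewrite !unitE.
Qed.

Lemma bieval_swap (L : fieldType) (f : {poly {poly L}}) x y :
  bieval (swapXY f) y x = bieval f x y.
Proof. by rewrite /bieval horner2_swapXY. Qed.

Lemma leading_exponent_swap (K : fieldExtType rat) (F : {poly {poly K}}) d a b :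
  leading_exponent F d a b -> leading_exponent (swapXY F) d b a.
Proof.
move=> [Fdeg abd Flead]; split; first by move=> i j; rewrite coef_swapXY addnC; exact: Fdeg.
  by rewrite addnC.
move=> G G0 Gsupp [k GE]; apply: (Flead (swapXY G)); first by rewrite swapXY_eq0.
  by move=> i j; rewrite coef_swapXY => /Gsupp ne [ai bj]; exact: ne.
by exists (swapXY k); rewrite GE rmorphM /= swapXYK.
Qed.

Section MultivariateToBivariate.
Variable K : fieldExtType rat.
Local Notation mpoly2 := (mpoly.mpoly 2 K).

Definition bipoly_var (i : 'I_2) : {poly {poly K}} := if i == ord0 then 'X%:P else 'X.

Definition bipoly_of (f : mpoly2) : {poly {poly K}} :=
  mpoly.mmap (polyC \o polyC) bipoly_var f.

Lemma bipoly_ofM f g : bipoly_of (f * g) = bipoly_of f * bipoly_of g.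
Proof. exact: (rmorphM (mpoly.mmap (polyC \o polyC : {rmorphism K -> {poly {poly K}}}) bipoly_var)). Qed.

Lemma bipoly_ofE f : bipoly_of f = \sum_(m <- mpoly.msupp f)
  ((mpoly.mcoeff m f)%:P * 'X^(m ord0))%:P * 'X^(m (lift ord0 ord0)).
Proof.
rewrite /bipoly_of /mpoly.mmap; apply: eq_bigr => m _.
rewrite /mpoly.mmap1 big_ord_recl big_ord1 /bipoly_var /= mulrA.
by rewrite rmorphM /= rmorphXn.
Qed.

Lemma coef_bipoly_of f (m : mpoly.multinom 2) :
  (bipoly_of f)`_(m (lift ord0 ord0))`_(m ord0) = mpoly.mcoeff m f.
Proof.
rewrite bipoly_ofE !coef_sum.
have coefE (m' : mpoly.multinom 2) : (((mpoly.mcoeff m' f)%:P * 'X^(m' ord0))%:P *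
    'X^(m' (lift ord0 ord0)))`_(m (lift ord0 ord0))`_(m ord0) =
    if m' == m then mpoly.mcoeff m' f else 0.
  rewrite coefCM coefXn.
  have [->|ne] := eqVneq m' m.
    by rewrite eqxx mulr1 coefCM coefXn eqxx mulr1.
  case: eqP => [e1|]; last by rewrite mulr0 coef0.
  rewrite mulr1 coefCM coefXn; case: eqP => [e0|]; last by rewrite mulr0.
  case/eqP: ne; apply/mpoly.mnmP => i.
  have [->|->] : i = ord0 \/ i = lift ord0 ord0.
    by case: i => [[|[|]]] // lt; [left|right]; exact: val_inj.
    by rewrite e0.
  by rewrite e1.
rewrite (eq_bigr _ (fun m' _ => coefE m')) -big_mkcond /=.
have [ms|mns] := boolP (m \in mpoly.msupp f); last first.
  rewrite mpoly.memN_msupp_eq0 // big_seq_cond big1 // => m' /andP[m's /eqP m'm].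
  by rewrite -m'm m's in mns.
rewrite big_mkcond (bigD1_seq m ms (mpoly.msupp_uniq f)) /= eqxx big1 ?addr0 //.
by move=> m' /negPf ->.
Qed.

Lemma bipoly_of_inj : injective bipoly_of.
Proof.
move=> f g fg; apply/mpoly.mpolyP => m.
by rewrite -!coef_bipoly_of fg.
Qed.

Definition multinom2 (i j : nat) : mpoly.multinom 2 := mpoly.Multinom [tuple i; j].

Lemma bipoly_of_surj G : exists g, bipoly_of g = G.
Proof.
exists (\sum_(j < size G) \sum_(i < size G`_j)
  G`_j`_i *: mpoly.mpolyX K (multinom2 i j)).
rewrite /bipoly_of raddf_sum /= -[RHS]coefK poly_def; apply: eq_bigr => j _.
have Gj : G`_j = \sum_(i < size G`_j) G`_j`_i *: 'X^i by rewrite -poly_def coefK.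
rewrite raddf_sum /= -mul_polyC [in RHS]Gj rmorph_sum mulr_suml.
apply: eq_bigr => i _; rewrite mpoly.mmapZ mpoly.mmapX /mpoly.mmap1.
rewrite big_ord_recl big_ord1 /bipoly_var /=.
by rewrite -mul_polyC rmorphM rmorphXn mulrA.
Qed.

Lemma bieval_bipoly_of f x y : bieval (bipoly_of f) x y = eval2 f x y.
Proof.
rewrite /eval2 mpoly.mevalE bipoly_ofE /bieval !horner_sum; apply: eq_bigr => m _.
rewrite hornerM hornerC hornerXn -rmorphXn hornerM hornerC hornerM hornerC hornerXn.
by rewrite big_ord_recl big_ord1 mulrA.
Qed.

Lemma bipoly_of_supp f i j : (bipoly_of f)`_j`_i != 0 ->
  multinom2 i j \in mpoly.msupp f.
Proof. by rewrite mpoly.mcoeff_msupp -coef_bipoly_of. Qed.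

Lemma mdeg2 (m : mpoly.multinom 2) : mpoly.mdeg m = (m ord0 + m (lift ord0 ord0))%N.
Proof. by rewrite mpoly.mdegE big_ord_recl big_ord1. Qed.

Lemma bipoly_of_unit f : (bipoly_of f \is a GRing.unit) -> f \is a GRing.unit.
Proof.
move=> /unitrPr[G]; have [g <-] := bipoly_of_surj G.
rewrite -bipoly_ofM => fg; apply/unitrPr; exists g; apply: bipoly_of_inj.
by rewrite fg /bipoly_of rmorph1.
Qed.

Lemma bipoly_of_irreducible f : mpoly_irreducible f -> irreducible_bipoly (bipoly_of f).
Proof.
move=> [f0 fu firr]; split.
- by apply: contra_neq f0 => F0; apply: bipoly_of_inj; rewrite F0 /bipoly_of raddf0.
- by apply: contra fu; exact: bipoly_of_unit.
move=> G H; have [g <-] := bipoly_of_surj G; have [h <-] := bipoly_of_surj H.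
have unit_of (u : mpoly2) : u \is a GRing.unit -> bipoly_of u \is a GRing.unit.
  move=> /unitrPr[v uv]; apply/unitrPr; exists (bipoly_of v).
  by rewrite -bipoly_ofM uv /bipoly_of rmorph1.
by rewrite -bipoly_ofM => /bipoly_of_inj/firr[] /unit_of; [left|right].
Qed.

(* X^a Y^b is the leading monomial for the graded order of the library, which is
   multiplicative. *)
Lemma bipoly_of_leading f : f != 0 ->
  exists a b, leading_exponent (bipoly_of f) (total_degree f) a b.
Proof.
move=> f0; exists (mpoly.mlead f ord0), (mpoly.mlead f (lift ord0 ord0)).
split.
- move=> i j /bipoly_of_supp /mpoly.msize_mdeg_lt; rewrite mdeg2 /total_degree.
  by rewrite -[X in (_ < X)%N](ltn_predK (m := 0%N)) ?ltnS // -mpoly.mlead_deg.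
- by rewrite -mdeg2 /total_degree -mpoly.mlead_deg.
move=> G G0 Gsupp [H]; have [g gE] := bipoly_of_surj G; have [h <-] := bipoly_of_surj H.
rewrite -gE -bipoly_ofM => /bipoly_of_inj gfh.
have g0 : g != 0.
  by apply: contra_neq G0 => g0; rewrite -gE g0 /bipoly_of raddf0.
have h0 : h != 0 by apply: contraNneq g0 => h0; rewrite gfh h0 mulr0.
have := mpoly.mlead_supp g0; rewrite mpoly.mcoeff_msupp -coef_bipoly_of gE.
move=> /Gsupp; apply; rewrite gfh mpoly.mleadM // !mpoly.mnmDE.
by rewrite !leq_addr.
Qed.

End MultivariateToBivariate.

(** * Choice of the parameters and conclusion *)

Lemma finite_set_card_le (T : choiceType) (A : set T) (N : nat) :
  (forall s : seq T, uniq s -> (forall x, x \in s -> A x) -> (size s <= N)%N) ->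
  finite_set A /\ (#|` fset_set A|%fset <= N)%N.
Proof.
move=> AN; have fA : finite_set A.
  apply: contrapT => iA; have [B BA NB] := infinite_set_fset N.+1 iA.
  have := AN (enum_fset B) (fset_uniq B) (fun x xB => BA x xB).
  by rewrite leqNgt NB.
split=> //; rewrite AN ?fset_uniq // => x.
by rewrite in_fset_set // => /set_mem.
Qed.

(* M is the length of the hook of auxiliary monomials, absolute values are rounded
   to powers of H^(1/L), and the primes are of size about H^(e/L). *)
Lemma exponent_choice (R : realType) (n d : nat) (eps : R) :
  (0 < n)%N -> (0 < d)%N -> 0 < eps -> exists M L e : nat,
  [/\ (0 < L)%N, (0 < e)%N,
    (2 * n + (L + n) * (d * M * (M + d)) < e * n * (d * M * (d * M).-1))%N &
    (e.+1 * n)%:R <= L%:R * (d%:R^-1 + eps)].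
Proof.
move=> n0 d0 eps0.
have nR : 0 < n%:R :> R by rewrite ltr0n.
have dR : 0 < d%:R :> R by rewrite ltr0n.
have d1 : 1 <= d%:R :> R by rewrite ler1n.
(* Beyond this threshold (M + d)/(dM - 1) exceeds 1/d by at most eps/3. *)
have [M [M2 ME]] : exists M, (1 < M)%N /\ 3 * (d%:R ^+ 2 + 1) / eps < (M.-1)%:R.
  exists (Num.truncn (3 * (d%:R ^+ 2 + 1) / eps)).+2.
  by split=> //; exact: Num.Theory.truncnS_gt.
have M0 : (0 < M)%N by exact: ltnW.
pose q := (d * M).-1.
have Mq : (M.-1 <= q)%N by rewrite /q -!subn1 leq_sub2r // leq_pmull.
have q0 : 0 < q%:R :> R.
  by rewrite ltr0n; apply: leq_trans Mq; rewrite -ltnS prednK.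
have dME : (d%:R * M%:R = q%:R + 1 :> R).
  by rewrite -natrM natr1 prednK // muln_gt0 d0.
(* Divided by d M q, the required strict inequality becomes e n > (L + n) rho + 2n/(d M q). *)
pose rho : R := (M + d)%:R / q%:R.
have rho0 : 0 <= rho by rewrite divr_ge0 ?ler0n.
have rhoE : rho <= d%:R^-1 + eps / 3.
  rewrite /rho ler_pdivrMr // natrD.
  have ME' : 3 * (d%:R ^+ 2 + 1) < eps * q%:R.
    rewrite [ltRHS]mulrC -ltr_pdivrMr //; apply: lt_le_trans ME _.
    by rewrite ler_nat.
  have -> : M%:R = (q%:R + 1) / d%:R :> R by rewrite -dME mulrC mulKf // gt_eqF.
  have dV1 : d%:R^-1 <= 1 :> R by rewrite invf_le1.
  rewrite mulrDl mulrDl [q%:R / _]mulrC mul1r; nra.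
(* The roundings add n (rho + 4) in all, which this choice keeps below eps L/3. *)
have [L [L0 LE]] : exists L, (0 < L)%N /\ 3 * n%:R * (rho + 4) / eps < L%:R.
  exists (Num.truncn (3 * n%:R * (rho + 4) / eps)).+1.
  by split=> //; exact: Num.Theory.truncnS_gt.
pose X : R := (L + n)%:R * rho / n%:R + 2.
have X0 : 0 <= X by rewrite addr_ge0 ?divr_ge0 ?mulr_ge0 ?ler0n.
have [e [e0 e1 e2]] : exists e, [/\ (0 < e)%N, X < e%:R & e%:R <= X + 1].
  exists (Num.truncn X).+1; split=> //; first exact: Num.Theory.truncnS_gt.
  by rewrite -natr1 lerD2r Num.Theory.truncn_le.
have dM0 : (0 < d * M)%N by rewrite muln_gt0 d0.
have rhoq : rho * q%:R = (M + d)%:R by rewrite /rho divfK // gt_eqF.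
exists M, L, e; split=> //.
  rewrite -(ltr_nat R) !natrD !natrM -/q.
  have en : (L + n)%:R * rho + 2 * n%:R < e%:R * n%:R.
    by have := e1; rewrite -(ltr_pM2r nR) mulrDl divfK // gt_eqF.
  have Dq : 1 <= d%:R * M%:R * q%:R :> R.
    rewrite -!natrM ler1n muln_gt0 dM0 /=.
    by rewrite -(ltr0n R).
  have -> : e%:R * n%:R * (d%:R * M%:R * q%:R) = (e%:R * n%:R) * (d%:R * M%:R * q%:R) :> R by [].
  apply: le_lt_trans (_ : ((L + n)%:R * rho + 2 * n%:R) * (d%:R * M%:R * q%:R) < _).
    rewrite -rhoq.
    rewrite [leRHS](_ : _ = 2 * n%:R * (d%:R * M%:R * q%:R) +
      (L + n)%:R * (d%:R * M%:R * (rho * q%:R))); last by ring.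
    rewrite lerD2r (_ : n%:R + _ = 2 * n%:R); last by ring.
    by apply: ler_peMr => //; rewrite mulr_ge0 // ler0n.
  by rewrite ltr_pM2r // (lt_le_trans ltr01).
have Le : 3 * (n%:R * (rho + 4)) < eps * L%:R.
  by move: LE; rewrite ltr_pdivrMr // mulrA [L%:R * _]mulrC.
have en2 : e.+1%:R * n%:R <= (L + n)%:R * rho + 4 * n%:R.
  have : e.+1%:R <= (L + n)%:R * rho / n%:R + 4 by rewrite -natr1; move: e2; rewrite /X; lra.
  move=> h; apply: le_trans (_ : ((L + n)%:R * rho / n%:R + 4) * n%:R <= _).
    by apply: ler_wpM2r => //; exact: ltW.
  by rewrite mulrDl divfK // gt_eqF.
rewrite natrM; apply: le_trans en2 _; rewrite natrD.
have LR : 0 <= L%:R :> R by rewrite ler0n.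
nra.
Qed.

Section Boxes.
Variables (R : realType) (K : fieldExtType rat) (n : nat).
Local Notation C := (complex R).
Variable sigma : 'I_n -> {rmorphism K -> C}.

(** Each max(1, |sigma_i x|) lies between l^t and l^(t+1) for some t. The lower bounds multiply to
    at most l^L, and rounding up adds one unit for each of the n embeddings. *)
Lemma box_exponents (l L : nat) (x : K) : (1 < l)%N ->
  \prod_i Num.max 1 (modulus (sigma i x)) <= (l ^ L)%:R ->
  exists t : {ffun 'I_n -> 'I_L.+1}, (\sum_i (t i).+1 <= L + n)%N /\
    forall i, `|sigma i x| <= (l ^ (t i).+1)%:R.
Proof.
move=> l1 hL; pose h i := Num.max 1 (modulus (sigma i x)).
have h1 i : 1 <= h i by rewrite /h le_max lexx.
have hle i : h i <= (l ^ L)%:R.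
  apply: le_trans hL; rewrite (bigD1 i) //= ler_peMr ?(le_trans ler01) //.
  apply: (big_ind (fun y => 1 <= y)) => [|y z y1 z1|j _]; [by []|exact: mulr_ege1|exact: h1].
have ex i : exists t : 'I_L.+1, (l ^ t)%:R <= h i /\ h i <= (l ^ t.+1)%:R.
  have : exists t, (t <= L)%N && ((l ^ t)%:R <= h i) by exists 0%N; rewrite expn0 h1.
  move=> /(@ex_maxnP _ L)[|t /andP[tL lt] tmax]; first by move=> t /andP[].
  exists (Ordinal (tL : (t < L.+1)%N)); split=> //=.
  rewrite leNgt; apply/negP => /ltW lt'.
  have [tL'|tL'] := ltnP t L; first by have := tmax t.+1; rewrite tL' lt' ltnn => /(_ isT).
  have := le_trans lt' (hle i); rewrite ler_nat leq_exp2l //; lia.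
have [t tP] := boolp.choice ex.
exists [ffun i => t i]; split.
  rewrite (eq_bigr (fun i => (t i).+1)); last by move=> i _; rewrite ffunE.
  rewrite (eq_bigr (fun i => t i + 1)%N); last by move=> i _; rewrite addn1.
  rewrite big_split /= sum1_card card_ord leq_add2r -(leq_exp2l _ _ l1) -(ler_nat R).
  apply: le_trans hL; rewrite expn_sum natr_prod; apply: ler_prod => i _.
  by rewrite ler0n; case: (tP i).
move=> i; rewrite ffunE -modulusE -(rmorph_nat (real_complex R)) lecR.
by apply: le_trans (proj2 (tP i)); rewrite le_max lexx orbT.
Qed.

End Boxes.

Section Count.
Variables (R : realType) (K : fieldExtType rat).
Local Notation O := (integer K).

(** The height bound is 2^(kL) and the scale is l = 2^k; the number of boxes depends only on L and
    n. *)
Lemma count_points (d : nat) (eps : R) : (0 < d)%N -> 0 < eps ->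
  exists L m k0 B : nat, [/\ (0 < L)%N, m%:R <= L%:R * (d%:R^-1 + eps) &
  forall k, (k0 <= k)%N -> forall (F : {poly {poly K}}) a b,
    irreducible_bipoly F -> leading_exponent F d a b ->
    forall T : seq (O * O), uniq T ->
    (forall P, P \in T -> [/\ bieval F (val P.1) (val P.2) = 0,
       height R (val P.1) <= (2 ^ (k * L))%:R & height R (val P.2) <= (2 ^ (k * L))%:R]) ->
    (size T <= B * 2 ^ (k * m))%N].
Proof.
move=> d0 eps0.
have [n [sigma [theta [n0 [sinj sall] ncof [N res]]]]] := number_field_structure K (complex R).
have [M [L [e [L0 e0 num enL]]]] := exponent_choice n0 d0 eps0.
have [k1 [B1 bound]] := box_bound ncof res e0 num.
exists L, (e.+1 * n)%N, k1.+1, (#|{: {ffun 'I_n -> 'I_L.+1} * {ffun 'I_n -> 'I_L.+1}}| * B1)%N.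
split=> // k kk F a b Firr Flead T uT TP.
have l1 : (1 < 2 ^ k)%N by rewrite (@ltn_exp2l 2 0); lia.
have ex (x : O) : exists t : {ffun 'I_n -> 'I_L.+1}, height R (val x) <= (2 ^ (k * L))%:R ->
    (\sum_i (t i).+1 <= L + n)%N /\
    forall i, `|sigma i (val x)| <= ((2 ^ k) ^ (t i).+1)%:R.
  have [hx|hx] := boolp.pselect (height R (val x) <= (2 ^ (k * L))%:R); last first.
    by exists [ffun => ord0] => /hx.
  have [|t tP] := @box_exponents R K n sigma (2 ^ k) L (val x) l1; last by exists t.
  by rewrite -expnM; apply: le_trans hx; exact: (height_ge sinj sall (valP x)).
have [t tP] := boolp.choice ex.
rewrite -mulnA; apply: (@size_leq_fibers _ _ (fun P : O * O => (t P.1, t P.2))).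
  have /card_uniqP <- := undup_uniq [seq (t P.1, t P.2) | P <- T].
  exact: max_card.
move=> P0 P0T; set T0 := [seq P <- T | _].
have T0T P : P \in T0 -> P \in T by rewrite mem_filter => /andP[].
have T0t P : P \in T0 -> t P.1 = t P0.1 /\ t P.2 = t P0.2.
  by rewrite mem_filter => /andP[/eqP[-> ->]].
have uT0 : uniq T0 by rewrite filter_uniq.
have [_ h1 h2] := TP _ P0T.
have [sx _] := tP _ h1; have [sy _] := tP _ h2.
have box P : P \in T0 -> in_box sigma (2 ^ k) (fun i => (t P0.1 i).+1) (fun i => (t P0.2 i).+1) P.
  move=> PT0 i; have [_ h1' h2'] := TP _ (T0T _ PT0); have [<- <-] := T0t _ PT0.
  by split; [have [_] := tP _ h1'|have [_] := tP _ h2']; exact.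
rewrite mulnA; have [sF|sF] := ltnP 1 (size F).
  apply: (bound k (ltnW kk) F a b _ _ T0 Firr sF Flead sx sy uT0) => P PT0.
  by split; [case: (TP _ (T0T _ PT0))|exact: box].
(* Here [F] does not involve y. Being irreducible it is not constant, so the exchange of the
   variables gives it positive degree in the outer one. *)
pose sw (P : O * O) := (P.2, P.1).
rewrite -(size_map sw).
apply: (bound k (ltnW kk) (swapXY F) b a _ _ _ (irreducible_bipoly_swap Firr) _
  (leading_exponent_swap Flead) sy sx).
- have FE := size1_polyC sF; rewrite FE swapXY_polyC size_map_polyC.
  rewrite ltnNge; apply/negP => s1; case: Firr => F0 /negP[].
  rewrite FE (size1_polyC s1) poly_unitE size_polyC coefC eqxx polyC_eq0.
  have c0 : F`_0`_0 != 0.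
    by apply: contraNneq F0 => c0; rewrite FE (size1_polyC s1) c0.
  by rewrite c0 /= poly_unitE size_polyC coefC eqxx c0 unitfE.
- by rewrite map_inj_uniq // => -[x y] [x' y'] [-> ->].
- move=> _ /mapP[P PT0 ->] /=; split.
    by rewrite bieval_swap; case: (TP _ (T0T _ PT0)).
  by move=> i; have [] := box _ PT0 i.
Qed.

End Count.

Lemma height_ge1 (R : realType) (K : fieldExtType rat) (x : K) :
  x \in integers K -> 1 <= height R x.
Proof.
move=> xi; have [n [sigma [theta [_ [sinj sall] _ _]]]] :=
  number_field_structure K (complex R).
apply: le_trans (height_ge sinj sall xi).
apply: (big_ind (fun y : R => 1 <= y)) => [|y z y1 z1|i _]; [by []|exact: mulr_ege1|].
by rewrite le_max lexx.
Qed.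

(** Take the least k: unless it equals [k0], the value k - 1 fails, so that 2^(k-1) is at most
    H^(1/L). *)
Lemma pow2_scale (R : realType) (H : R) (L k0 : nat) : 1 <= H -> (0 < L)%N ->
  exists k, [/\ (k0 <= k)%N, H <= (2 ^ (k * L))%:R &
    (2 ^ k)%:R <= (2 ^ k0.+1)%:R * H `^ L%:R^-1].
Proof.
move=> H1 L0; have H0 : 0 <= H := le_trans ler01 H1.
have LR : 0 < L%:R :> R by rewrite ltr0n.
have root1 : 1 <= H `^ L%:R^-1.
  by rewrite -[leLHS](powRr0 H) ler_powR // invr_ge0 ltW.
have ex : exists k, (k0 <= k)%N && (H <= (2 ^ (k * L))%:R).
  pose t := (Num.truncn H).+1; exists (k0 + t)%N; rewrite leq_addr /=.
  apply: le_trans (ltW (Num.Theory.truncnS_gt H)) _; rewrite ler_nat -/t.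
  apply: leq_trans (ltnW (ltn_expl _ (ltnSn 1))) _; rewrite leq_exp2l //.
  by rewrite (leq_trans (leq_addl k0 t)) // leq_pmulr.
case: (ex_minnP ex) => k /andP[k0k Hk] kmin; exists k; split=> //.
have [lt|ge] := ltnP k0 k; last first.
  have -> : k = k0 by lia.
  apply: (@le_trans _ _ ((2 ^ k0.+1)%:R * 1)); last by rewrite ler_wpM2l ?ler0n.
  by rewrite mulr1 ler_nat leq_exp2l.
have k1E : k = k.-1.+1 by lia.
have ltH : (2 ^ (k.-1 * L))%:R < H.
  rewrite ltNge; apply/negP => le; have := kmin k.-1; rewrite le andbT.
  have -> : (k0 <= k.-1)%N by lia.
  by move=> /(_ isT); lia.
have rE : (2 ^ k.-1)%:R <= H `^ L%:R^-1.
  have -> : (2 ^ k.-1)%:R = (2 ^ (k.-1 * L))%:R `^ L%:R^-1 :> R.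
    rewrite expnM (natrX _ (2 ^ k.-1)) -powR_mulrn ?ler0n // -powRrM mulfV ?powRr1 ?ler0n //.
    exact: lt0r_neq0.
  apply: ge0_ler_powR; rewrite ?nnegrE ?ler0n ?invr_ge0 //; exact: ltW.
rewrite k1E expnS natrM; apply: ler_pM; rewrite ?ler0n //.
by rewrite ler_nat -{1}(expn1 2) leq_exp2l.
Qed.

Theorem theorem1p3 (R : realType) (K : fieldExtType rat) (d : nat) (eps : R)
    (d_ge1 : (1 <= d)%N) (eps_gt0 : 0 < eps) :
  exists2 B : R, 0 < B &
    forall f : mpoly.mpoly 2 K,
      (forall m, ring_of_integers (mpoly.mcoeff m f)) ->
      total_degree f = d ->
      mpoly_irreducible f ->
      forall H : R, 0 < H ->
        let S := [set p : K * K |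
          [/\ ring_of_integers p.1, ring_of_integers p.2,
              height R p.1 <= H, height R p.2 <= H & eval2 f p.1 p.2 = 0]] in
        finite_set S /\ #|` fset_set S|%fset%:R <= B * H `^ (d%:R^-1 + eps).
Proof.
have [L [m [k0 [B [L0 mL count]]]]] := count_points K d_ge1 eps_gt0.
(* The constant comes from (2^k)^m <= (2^(k0+1) H^(1/L))^m; the successor makes it positive. *)
exists (B * 2 ^ (k0.+1 * m)).+1%:R => [|f _ fd firr H H0 S]; first by rewrite ltr0n.
(* Integers have height at least 1, so there is no point when H < 1. *)
have [H1|H1] := leP 1 H; last first.
  have S0 : S = set0.
    apply/seteqP; split=> // -[x y] [/= /ring_of_integersE xi _ hx _ _].
    by have := le_lt_trans (le_trans (height_ge1 R xi) hx) H1; rewrite ltxx.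
  by rewrite S0 fset_set0 cardfs0 mulr_ge0 ?ler0n ?powR_ge0; split.
have [k [k0k Hk kH]] := pow2_scale k0 H1 L0.
have f0 : f != 0 by case: firr.
have [a [b flead]] := bipoly_of_leading f0; rewrite fd in flead.
have [|fS cS] := @finite_set_card_le _ S (B * 2 ^ (k * m)).
  move=> s us sS; pose lift (p : K * K) : integer K * integer K :=
    (insubd 0 p.1, insubd 0 p.2).
  have liftE p : p \in s -> val (lift p).1 = p.1 /\ val (lift p).2 = p.2.
    move=> /sS[/ring_of_integersE p1 /ring_of_integersE p2 _ _ _].
    by rewrite !val_insubd p1 p2.
  rewrite -(size_map lift).
  apply: (count k k0k _ a b (bipoly_of_irreducible firr) flead).
    rewrite map_inj_in_uniq // => p p' /liftE[p1 p2] /liftE[p1' p2'] E.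
    by rewrite (surjective_pairing p) (surjective_pairing p') -p1 -p2 E p1' p2'.
  move=> _ /mapP[p ps ->]; have [-> ->] := liftE p ps.
  have [_ _ h1 h2 fp] := sS p ps; rewrite bieval_bipoly_of.
  by split=> //; [exact: le_trans Hk|exact: le_trans Hk].
split=> //; apply: (@le_trans _ _ (B * 2 ^ (k * m))%:R); first by rewrite ler_nat.
apply: (@le_trans _ _ ((B * 2 ^ (k0.+1 * m))%:R * H `^ (d%:R^-1 + eps))); last first.
  by rewrite ler_wpM2r ?powR_ge0 // ler_nat.
rewrite !natrM -mulrA ler_wpM2l ?ler0n // !expnM !(natrX _ (2 ^ _)).
apply: (@le_trans _ _ (((2 ^ k0.+1)%:R * H `^ L%:R^-1) ^+ m)).
  by apply: lerXn2r; rewrite ?nnegrE ?ler0n // mulr_ge0 ?ler0n ?powR_ge0.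
rewrite exprMn ler_wpM2l ?exprn_ge0 ?ler0n // -powR_mulrn ?powR_ge0 // -powRrM.
(* Since H >= 1, the inequality m/L <= 1/d + eps between the exponents suffices. *)
apply: ler_powR => //; rewrite mulrC ler_pdivrMr ?ltr0n // mulrC.
exact: mL.
Qed.
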